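(* Let $n=1$ and let $a_1,a_2,a_3\in\mathbb{R}$ satisfy one of the following: (DFF) $a_1<0$, $a_2>0$, $a_3>0$; (DDF) $a_1<0$, $a_2<0$, $a_3>0$; (DFD) $a_1=a_3=-1$ and $a_2>\frac{8}{\sqrt{15}}$. Then the equation $$\phi''+a_1|\phi|\phi+a_2|\phi|^2\phi+a_3|\phi|^3\phi=0\quad\text{on }\mathbb{R}$$ has a unique even positive solution $\phi$ in the space $H^1(\mathbb{R})$. Moreover, all nontrivial (complex-valued) solutions in $X$ of this equation are of the form $e^{i\theta}\phi(x-x_0)$ for some $\theta,x_0\in\mathbb{R}$. They are all algebraic standing waves, i.e. they all belong to $\mathcal{G}$.
   Context: Functions are complex-valued. Here $X:=\dot H^1(\mathbb{R})\cap L^3(\mathbb{R})$ with norm $\|u\|_X=\|\nabla u\|_{L^2}+\|u\|_{L^3}$, and $$S(v):=\frac12\|\nabla v\|_{L^2}^2-\frac{a_1}{3}\|v\|_{L^3}^3-\frac{a_2}{4}\|v\|_{L^4}^4-\frac{a_3}{5}\|v\|_{L^5}^5 ,\qquad v\in X.$$ The equation is $S'(\phi)=0$. Put $d:=\inf\{S(v): v\in X\setminus\{0\},\ S'(v)=0\}$ and $\mathcal{G}:=\{v\in X\setminus\{0\}: S'(v)=0,\ S(v)=d\}$. An algebraic standing wave of $iu_t+u_{xx}+a_1|u|u+a_2|u|^2u+a_3|u|^3u=0$ is by definition an element of $\mathcal{G}$. The letters D (defocusing) and F (focusing) mean $a_i<0$ and $a_i>0$ respectively, listed for $i=1,2,3$.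 *)

(* Defs.v *)
From mathcomp Require Import all_boot all_order all_algebra.
From mathcomp Require Import complex.
From mathcomp Require Import all_classical all_reals all_analysis.

Set Implicit Arguments.
Unset Strict Implicit.
Unset Printing Implicit Defensive.

Import Order.TTheory GRing.Theory Num.Theory.
Import numFieldNormedType.Exports.

Local Open Scope classical_set_scope.
Local Open Scope ring_scope.

(* The elements of the function spaces are (Borel) representatives
   u : R -> R[i]; two representatives are identified when they agree almost
   everywhere for the Lebesgue measure. *)

Section FunctionSpaces.
Context {R : realType}.
Local Notation mu := (@lebesgue_measure R).
Implicit Types (u v g h : R -> R[i]) (p : R).

Definition Lp p u : Prop :=
  [/\ measurable_fun setT (@complex.Re R \o u),
      measurable_fun setT (@complex.Im R \o u) &
      (@Normc.normc R \o u) \in Lfun mu p%:E].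

Definition Lp_norm p u : R :=
  fine ('N[mu]_(p%:E)[EFin \o (@Normc.normc R \o u)])%E.

Definition test_function (psi : R -> R) : Prop :=
  (forall (n : nat) (x : R), derivable (derive1n n psi) x 1) /\
  compact (closure [set x | psi x != 0]).

Definition is_weak_deriv_real (f g : R -> R) : Prop :=
  [/\ locally_integrable setT f, locally_integrable setT g &
      forall psi, test_function psi ->
        \int[mu]_x (f x * derive1 psi x) = - \int[mu]_x (g x * psi x)].

(* Real test functions suffice for complex-valued distributions, by
   linearity. *)
Definition is_weak_deriv u g : Prop :=
  is_weak_deriv_real (@complex.Re R \o u) (@complex.Re R \o g) /\
  is_weak_deriv_real (@complex.Im R \o u) (@complex.Im R \o g).

(* Some representative of the weak derivative, which is unique up to a.e.
   equality; junk value 0 when u has no locally integrable weak derivative. *)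
Definition weak_deriv u : R -> R[i] :=
  xget (fun=> 0) [set g | is_weak_deriv u g].

Definition in_Hdot1 u : Prop :=
  exists g, is_weak_deriv u g /\ Lp 2 g.

Definition in_H1 u : Prop := Lp 2 u /\ in_Hdot1 u.

Definition in_X u : Prop := in_Hdot1 u /\ Lp 3 u.

Definition X_norm u : R := Lp_norm 2 (weak_deriv u) + Lp_norm 3 u.

Definition nontrivial u : Prop := ~ (u = (fun=> 0) %[ae mu]).

Section Equation.
Variables a1 a2 a3 : R.

(* u'' + a1 |u| u + a2 |u|^2 u + a3 |u|^3 u = 0 in the sense of
   distributions. *)
Definition is_solution u : Prop :=
  is_weak_deriv (weak_deriv u) (fun x =>
    let r := Normc.normc (u x) in
    - (((a1 * r + a2 * r ^+ 2 + a3 * r ^+ 3)%:C)%C * u x)).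

Definition action v : R :=
  2^-1 * Lp_norm 2 (weak_deriv v) ^+ 2
  - a1 / 3 * Lp_norm 3 v ^+ 3
  - a2 / 4 * Lp_norm 4 v ^+ 4
  - a3 / 5 * Lp_norm 5 v ^+ 5.

(* S'(v) = 0: the Frechet derivative of the action at v in the normed space X
   exists and is the zero functional. *)
Definition is_critical_point v : Prop :=
  forall eps : R, 0 < eps -> exists2 delta : R, 0 < delta &
    forall h, in_X h -> X_norm h < delta ->
      `|action (fun x => v x + h x) - action v| <= eps * X_norm h.

Definition nontrivial_critical v : Prop :=
  [/\ in_X v, nontrivial v & is_critical_point v].

(* The infimum is taken in the extended reals, so that it is not a junk value
   if the set is empty or unbounded below. *)
Definition ground_level : \bar R :=
  ereal_inf [set (action v)%:E | v in [set v | nontrivial_critical v]].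

Definition algebraic_standing_wave v : Prop :=
  nontrivial_critical v /\ (action v)%:E = ground_level.

(* Evenness and positivity are pointwise properties of the continuous
   representative.  In R[i], 0 < z means that z is real and positive. *)
Definition even_positive_H1_solution (phi : R -> R[i]) : Prop :=
  [/\ in_H1 phi /\ is_solution phi,
      continuous (@complex.Re R \o phi) /\ continuous (@complex.Im R \o phi),
      forall x, phi (- x) = phi x &
      forall x, 0 < phi x].

End Equation.

Definition phase (theta : R) : R[i] := (cos theta +i* sin theta)%C.

End FunctionSpaces.

(* Main.v *)
Require Import Defs.
From mathcomp Require Import all_boot all_order all_algebra.
From mathcomp Require Import complex.
From mathcomp Require Import all_classical all_reals all_analysis.
From mathcomp Require Import measurable_realfun ring lra.
Set Implicit Arguments.
Unset Strict Implicit.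
Unset Printing Implicit Defensive.
Import Order.TTheory GRing.Theory Num.Theory.
Import numFieldNormedType.Exports.
Local Open Scope classical_set_scope.
Local Open Scope ring_scope.

(** The equation is an ordinary differential equation in disguise, and phase plane
    analysis solves it completely.

    Functions in X are bounded, by the one-dimensional Sobolev embedding
    ([weak_deriv_sup]); hence the action has a second-order expansion
    ([action_expansion]), and S'(v) = 0 means that the first variation vanishes, which
    makes v a distributional solution ([critical_point_solution]). A solution has a
    continuous representative, so the fundamental theorem of calculus turns it into a
    classical solution u = P + i Q of a system of ordinary differential equations
    ([solution_orbit]).

    Such an orbit conserves the energy |u'|^2 / 2 + V(|u|) and the angular momentum
    P Q' - Q P'. Since a power of |u| and |u'|^2 are integrable, the orbit comes
    arbitrarily close to rest near both ends of the line, so both quantities are 0. At an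
    interior maximum of |u| the derivative u' therefore vanishes, and V(|u|) = 0
    ([orbit_turning_point]). In the three cases for the coefficients,
    V(r) = - q0 r^3 (1 - w0 r) (1 - w1 r) / 2 with q0 > 0, w0 > 0 and w0 > w1
    ([coefficients_exist]), and V <= 0 on all moduli below the maximum; this leaves only
    |u| = 1/w0 at the maximum ([amplitude]). Hence, up to a phase and a translation,
    all nontrivial solutions have the same Cauchy data and are equal ([orbit_unique],
    [solution_is_wave]).

    For existence, the zero-energy equation f'^2 = - 2 V(f) is degenerate at the maximum
    of f; writing f = 1 / (w0 + z^2) it becomes an autonomous equation z' = h(z) with h
    between two positive constants, which is integrated explicitly ([autonomous_ode],
    [profile_exists]). As z grows linearly, f decays like 1/x^2 and lies in all the
    spaces. Reflection and uniqueness make it even, and among its waves the only even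
    positive one is f itself, since f has a strict maximum ([even_positive_wave]).

    Finally, waves are critical points ([wave_critical]) and all have the same action
    ([wave_action]). Hence the set of actions of nontrivial critical points is a singleton
    and every wave attains the infimum. *)

(** * Elementary calculus of derivatives *)

Definition has_deriv (R : realType) (f g : R -> R) : Prop :=
  forall x : R, is_derive x 1 f (g x).

Section DerivRules.
Context {R : realType}.
Implicit Types (f g : R -> R) (x a b c : R).

Lemma is_derive_addf f g x a b : is_derive x 1 f a -> is_derive x 1 g b ->
  is_derive x 1 (fun y => f y + g y) (a + b).
Proof. by move=> df dg; apply: is_deriveD. Qed.

Lemma is_derive_subf f g x a b : is_derive x 1 f a -> is_derive x 1 g b ->
  is_derive x 1 (fun y => f y - g y) (a - b).
Proof. by move=> df dg; apply: is_deriveB. Qed.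

Lemma is_derive_oppf f x a : is_derive x 1 f a ->
  is_derive x 1 (fun y => - f y) (- a).
Proof. by move=> df; apply: is_deriveN. Qed.

Lemma is_derive_mulf f g x a b : is_derive x 1 f a -> is_derive x 1 g b ->
  is_derive x 1 (fun y => f y * g y) (a * g x + f x * b).
Proof.
move=> df dg; apply: (is_derive_eq (is_deriveM df dg)).
by rewrite /GRing.scale/= addrC mulrC.
Qed.

Lemma is_derive_scalef c f x a : is_derive x 1 f a ->
  is_derive x 1 (fun y => c * f y) (c * a).
Proof.
move=> df; have dc : is_derive x 1 (fun=> c) (0 : R) by exact: is_derive_cst.
by apply: (is_derive_eq (is_derive_mulf dc df)); rewrite mul0r add0r.
Qed.

Lemma is_derive_expf f x a n : is_derive x 1 f a ->
  is_derive x 1 (fun y => f y ^+ n) (n%:R * f x ^+ n.-1 * a).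
Proof.
move=> df; have -> : (fun y => f y ^+ n) = f ^+ n.
  by apply/funext => y; rewrite exprfctE.
exact: is_deriveX.
Qed.

Lemma is_derive_invf f x a : f x != 0 -> is_derive x 1 f a ->
  is_derive x 1 (fun y => (f y)^-1) (- a / f x ^+ 2).
Proof.
move=> f0 df; apply: (is_derive_eq (is_deriveV f0 df)).
by rewrite /GRing.scale/= mulNr mulNr mulrC.
Qed.

Lemma is_derive_compf f g x a b : is_derive x 1 g b -> is_derive (g x) 1 f a ->
  is_derive x 1 (fun y => f (g y)) (a * b).
Proof. by move=> dg df; exact: is_derive1_comp. Qed.

Lemma is_derive_affine c d x : is_derive x 1 (fun y => c * y + d) c.
Proof.
apply: (is_derive_eq (is_derive_addf (is_derive_scalef c (is_derive_id x 1))
  (is_derive_cst d x 1))).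
by rewrite mulr1 addr0.
Qed.

Lemma is_derive_shift f c x a : is_derive (x - c) 1 f a ->
  is_derive x 1 (fun y => f (y - c)) a.
Proof.
move=> df; have dg : is_derive x 1 (fun y => y - c) (1 : R).
  have := is_derive_affine 1 (- c) x.
  by under eq_fun do rewrite mul1r.
by have := @is_derive_compf f (fun y => y - c) x a 1 dg df; rewrite mulr1.
Qed.

Lemma is_derive_derive1 f x a : is_derive x 1 f a -> (derive1 f) x = a.
Proof. by move=> [_ <-]; rewrite derive1E. Qed.

Lemma derivable_is_derive f x : derivable f x 1 -> is_derive x 1 f ((derive1 f) x).
Proof. by rewrite derive1E => /derivableP. Qed.

Lemma has_deriv_derive1 f g : has_deriv f g -> (derive1 f) = g.
Proof. by move=> fg; apply/funext => x; apply: is_derive_derive1. Qed.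

Lemma is_derive_continuous f x a : is_derive x 1 f a -> {for x, continuous f}.
Proof.
by move=> df; apply/differentiable_continuous/derivable1_diffP/ex_derive.
Qed.

Lemma has_deriv_continuous f g : has_deriv f g -> continuous f.
Proof. by move=> fg x; apply: is_derive_continuous (fg x). Qed.

End DerivRules.

(** * Smooth functions and test functions *)

Section Smooth.
Context {R : realType}.
Implicit Types (f g : R -> R).

Record smooth f : Prop := Smooth {
  smooth_derivable : forall n x, derivable (derive1n n f) x 1 }.

(** By induction the iterated derivatives stay in [S]; this avoids computing
    them. *)
Lemma smooth_family (S : set (R -> R)) :
  (forall f, S f -> exists2 g, has_deriv f g & S g) ->
  forall f, S f -> smooth f.
Proof.
move=> clS f Sf; split=> n x.
have Sn : S (derive1n n f).
  elim: n => // n IHn; rewrite derive1nS.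
  by have [g fg Sg] := clS _ IHn; rewrite (has_deriv_derive1 fg).
by have [g fg _] := clS _ Sn; apply: ex_derive.
Qed.

Lemma smooth_has_deriv f : smooth f -> has_deriv f (derive1 f).
Proof. by move=> [sf] x; apply: derivable_is_derive; apply: (sf 0). Qed.

Lemma smooth_derive1 f : smooth f -> smooth (derive1 f).
Proof. by move=> [sf]; split=> n x; rewrite -derive1Sn; exact: sf. Qed.

Lemma smooth_of_deriv f g : has_deriv f g -> smooth g -> smooth f.
Proof.
move=> fg [sg]; split=> -[|n] x.
  by rewrite derive1n0; have [] := fg x.
by rewrite derive1Sn (has_deriv_derive1 fg); exact: sg.
Qed.

Lemma smooth_continuous f : smooth f -> continuous f.
Proof. by move=> /smooth_has_deriv/has_deriv_continuous. Qed.

Lemma smooth_cst c : smooth (fun=> c : R).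
Proof.
apply: (@smooth_family [set f | exists c, f = fun=> c]); last by exists c.
by move=> _ [d ->]; exists (fun=> 0); [move=> x; exact: is_derive_cst|exists 0].
Qed.

Lemma smoothD f g : smooth f -> smooth g -> smooth (fun x => f x + g x).
Proof.
move=> sf sg; apply: (@smooth_family
  [set h | exists f g, [/\ smooth f, smooth g & h = fun x => f x + g x]]);
  last by exists f, g.
move=> _ [h [k [sh sk ->]]]; exists (fun x => (derive1 h) x + (derive1 k) x).
  by move=> x; apply: is_derive_addf; exact: smooth_has_deriv.
by exists (derive1 h), (derive1 k); split => //; exact: smooth_derive1.
Qed.

(** By the Leibniz rule the finite sums of products of smooth functions form a
    family stable under differentiation; a list records the factors. *)
Lemma smoothM f g : smooth f -> smooth g -> smooth (fun x => f x * g x).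
Proof.
move=> sf sg; pose S (h : R -> R) := exists s : seq ((R -> R) * (R -> R)),
  (forall p, List.In p s -> smooth p.1 /\ smooth p.2) /\
  h = fun x => \sum_(p <- s) p.1 x * p.2 x.
apply: (@smooth_family S); last first.
  exists [:: (f, g)]; split; first by move=> p [<-|[]].
  by apply/funext => x; rewrite big_seq1.
move=> _ [s [ss ->]].
exists (fun x => \sum_(p <- flatten [seq [:: ((derive1 p.1), p.2); (p.1, (derive1 p.2))] | p <- s])
   p.1 x * p.2 x).
  move=> x; elim: s ss => [_|p s IHs ss].
    under eq_fun do rewrite big_nil; rewrite big_nil.
    exact: is_derive_cst.
  under eq_fun do rewrite big_cons.
  rewrite /= !big_cons/= addrA.
  apply: is_derive_addf; last by apply: IHs => q qs; apply: ss; right.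
  have [s1 s2] : smooth p.1 /\ smooth p.2 by apply: ss; left.
  by apply: is_derive_mulf; exact: smooth_has_deriv.
eexists; split; last by [].
elim: s ss => [_ p []//|p s IHs ss q /=].
have [s1 s2] : smooth p.1 /\ smooth p.2 by apply: ss; left.
move=> [<-|[<-|qs]]; first by split => //; exact: smooth_derive1.
  by split => //; exact: smooth_derive1.
by apply: IHs qs => r rs; apply: ss; right.
Qed.

Lemma smoothZ c f : smooth f -> smooth (fun x => c * f x).
Proof. by move=> sf; apply: smoothM => //; exact: smooth_cst. Qed.

Lemma smoothB f g : smooth f -> smooth g -> smooth (fun x => f x - g x).
Proof.
move=> sf sg; have := smoothD sf (@smoothZ (-1) _ sg).
by under eq_fun do rewrite mulN1r.
Qed.

Lemma smooth_affine f c d : smooth f -> smooth (fun x => f (c * x + d)).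
Proof.
move=> sf; apply: (@smooth_family [set h | exists k f, smooth f /\
   h = fun x => k * f (c * x + d)]); last first.
  by exists 1, f; split => //; apply/funext => x; rewrite mul1r.
move=> _ [k [g [sg ->]]]; exists (fun x => (k * c) * (derive1 g) (c * x + d)); last first.
  by exists (k * c), (derive1 g); split => //; exact: smooth_derive1.
move=> x; rewrite -mulrA; apply: is_derive_scalef; rewrite mulrC.
by apply: (is_derive_compf (is_derive_affine c d x)); exact: smooth_has_deriv.
Qed.

End Smooth.

(** * A smooth step *)

Section Step.
Context {R : realType}.

Lemma nbhs_gt_self (a x : R) : a < x -> \forall y \near x, a < y.
Proof.
move=> ax; have : - x < - a by rewrite ltrN2.
by move=> /Nlt_nbhsl; apply: filterS => y; rewrite ltrN2.
Qed.

(** The functions p(1/x) exp(-1/x), extended by 0 to x <= 0: differentiation only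
    changes the polynomial p, also at the origin, so all of them are smooth. *)
Let flat (p : {poly R}) (x : R) : R :=
  if 0 < x then p.[x^-1] * expR (- x^-1) else 0.

(** The exponential dominates every power of 1/x with one power of x to spare. *)
Let flat_bound (p : {poly R}) : exists2 C : R, 0 <= C &
  forall x, `|flat p x| <= C * `|x|.
Proof.
exists (\sum_(i < size p) `|p`_i| * (i.+1)`!%:R).
  by apply: sumr_ge0 => i _; rewrite mulr_ge0.
move=> x; rewrite /flat; case: ltP => x0; last first.
  by rewrite normr0 mulr_ge0// sumr_ge0// => i _; rewrite mulr_ge0.
rewrite normrM (gtr0_norm (expR_gt0 _)) horner_coef (gtr0_norm x0) expRN.
rewrite ler_pdivrMr ?expR_gt0//.
apply: le_trans (ler_norm_sum _ _ _) _.
rewrite -mulrA mulr_suml; apply: ler_sum => i _.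
rewrite normrM -mulrA; apply: ler_wpM2l => //.
rewrite ger0_norm ?exprn_ge0 ?invr_ge0 ?(ltW x0)//.
have xi0 : 0 <= x^-1 by rewrite invr_ge0 ltW.
have := expR_ge1Dxn i xi0.
have f0 : 0 < (i.+1)`!%:R :> R by rewrite ltr0n fact_gt0.
move=> h; have : x^-1 ^+ i.+1 / (i.+1)`!%:R <= expR x^-1.
  by apply: le_trans h; rewrite lerDr.
rewrite ler_pdivrMr// exprS mulrC => h'.
have := ler_wpM2l (ltW x0) h'.
rewrite [x * (_ * x^-1)]mulrCA divff ?gt_eqF// mulr1.
by move=> /le_trans; apply; rewrite le_eqVlt; apply/orP; left; apply/eqP; ring.
Qed.

Let flat_continuous0 (p : {poly R}) : {for 0, continuous (flat p)}.
Proof.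
have [C C0 bC] := flat_bound p.
rewrite /prop_for /continuous_at /flat ltxx.
apply/cvgr0Pnorm_le => e e0.
have C1 : 0 < C + 1 by rewrite ltr_wpDl.
have := @nbhs0_lt R R (e / (C + 1)); rewrite divr_gt0// => /(_ isT).
apply: filterS => y ye; apply: le_trans (bC y) _.
apply: (@le_trans _ _ ((C + 1) * `|y|)); first by rewrite ler_wpM2r// lerDl.
by rewrite mulrC -ler_pdivlMr// ltW.
Qed.

Let flat_has_deriv (p : {poly R}) :
  has_deriv (flat p) (flat ('X^2 * (p - deriv p))).
Proof.
move=> x; have [x0|x0|->] := ltgtP x 0.
- have -> : flat ('X^2 * (p - deriv p)) x = 0 by rewrite /flat lt_gtF.
  apply: (@near_eq_is_derive _ _ _ (cst 0)).
  by near=> y; rewrite /flat lt_gtF//; near: y; exact: lt_nbhsl.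
- have -> : flat ('X^2 * (p - deriv p)) x =
    (p.[x^-1] - (deriv p).[x^-1]) * (x ^- 2) * expR (- x^-1).
    by rewrite /flat x0 !hornerE; rewrite exprVn; ring.
  apply: (@near_eq_is_derive _ _ _ (fun y : R => p.[y^-1] * expR (- y^-1))).
    by near=> y; rewrite /flat ifT//; near: y; exact: nbhs_gt_self.
  have dV : is_derive x 1 (fun y : R => y^-1) (- 1 / x ^+ 2).
    by apply: (@is_derive_invf R id); rewrite gt_eqF.
  have dp := is_derive_compf dV (is_derive_poly p x^-1).
  have de := is_derive_compf (is_derive_oppf dV) (is_derive_expR (- x^-1)).
  apply: (is_derive_eq (is_derive_mulf dp de)); rewrite -exprVn; ring.
- have -> : flat ('X^2 * (p - deriv p)) 0 = 0 by rewrite /flat ltxx.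
  apply/is_derive1_caratheodory; exists (flat ('X * p)); split.
  + move=> z; rewrite /flat ltxx !subr0; case: ifPn => z0; last by rewrite mul0r.
    by rewrite !hornerE; field; rewrite gt_eqF.
  + exact: flat_continuous0.
  + by rewrite /flat ltxx.
Unshelve. all: by end_near. Qed.

Let smooth_flat p : smooth (flat p).
Proof.
apply: (@smooth_family _ [set f | exists p, f = flat p]); last by exists p.
move=> _ [q ->]; exists (flat ('X^2 * (q - deriv q))).
  exact: flat_has_deriv.
by exists ('X^2 * (q - deriv q)).
Qed.

Let bump (x : R) : R := flat 1 x * flat 1 (- 1 * x + 1).

Let smooth_bump : smooth bump.
Proof. by apply: smoothM (smooth_flat _) _; exact/smooth_affine/smooth_flat. Qed.

Let bump_ge0 x : 0 <= bump x.
Proof.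
by apply: mulr_ge0; rewrite /flat; case: ifP => // _; rewrite hornerE ?mul1r expR_ge0.
Qed.

Let bump_gt0 x : 0 < x -> x < 1 -> 0 < bump x.
Proof.
move=> x0 x1; rewrite /bump /flat x0 mulN1r addrC subr_gt0 x1.
have h1 y : (1 : {poly R}).[y] = 1 by rewrite hornerE.
by rewrite !h1 !mul1r mulr_gt0 ?expR_gt0.
Qed.

Let bump_le0 x : x <= 0 -> bump x = 0.
Proof. by move=> x0; rewrite /bump /flat ltNge x0/= mul0r. Qed.

Let bump_ge1 x : 1 <= x -> bump x = 0.
Proof.
by move=> x1; rewrite /bump /flat mulN1r [- x + 1]addrC subr_gt0 [x < 1]ltNge x1/= mulr0.
Qed.

(** The normalized primitive of a bump supported in [0, 1]. *)
Lemma exists_smooth_step : exists eta : R -> R,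
  [/\ smooth eta, forall x : R, x <= 0 -> eta x = 0,
      forall x : R, 1 <= x -> eta x = 1 & forall x, 0 <= derive1 eta x].
Proof.
pose mu := @lebesgue_measure R.
have cb : continuous bump by exact: smooth_continuous.
have ib y : mu.-integrable `]-oo, y] (EFin \o bump).
  have i1 : mu.-integrable `[0, 1] (EFin \o bump).
    apply: continuous_compact_integrable; first exact: segment_compact.
    exact: continuous_subspaceT.
  apply: (@integrableS _ _ _ mu setT) => //.
  have : mu.-integrable setT ((EFin \o bump) \_ `[0, 1]).
    by apply/integrable_restrict => //; rewrite setTI.
  congr (_.-integrable _ _); apply/funext => x; rewrite patchE.
  case: ifPn => //; rewrite notin_setE/= in_itv/= => /negP; rewrite negb_and -!ltNge.
  by case/orP => /ltW xx; rewrite ?(bump_le0 xx) ?(bump_ge1 xx).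
pose F y := \int[mu]_(t in `]-oo, y]) bump t.
have dF : has_deriv F bump.
  move=> x; have [||d <-] := @continuous_FTC1 R bump -oo%O x (x + 1) _ (ib _) _ (cb x).
  - by rewrite ltrDl.
  - by rewrite ltNyr.
  exact: derivable_is_derive.
have cF : continuous F by exact: has_deriv_continuous dF.
have mvt a b : a < b -> exists2 c, a < c < b & F b - F a = bump c * (b - a).
  move=> ab; have [c] := @MVT R F bump a b ab (fun x _ => dF x) (continuous_subspaceT cF).
  by rewrite in_itv/= => ? ?; exists c.
have I0 : 0 < F 1 - F 0.
  have [c /andP[c0 c1] ->] := mvt 0 1 ltr01.
  by rewrite subr0 mulr1 bump_gt0.
have F0 x : x <= 0 -> F x = F 0.
  rewrite le_eqVlt => /predU1P[->//|x0].
  have [c /andP[_ c0]] := mvt _ _ x0; rewrite bump_le0 ?ltW// mul0r => /eqP.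
  by rewrite subr_eq0 => /eqP.
have F1 x : 1 <= x -> F x = F 1.
  rewrite le_eqVlt => /predU1P[<-//|x1].
  have [c /andP[c1 _]] := mvt _ _ x1; rewrite bump_ge1 ?ltW// mul0r => /eqP.
  by rewrite subr_eq0 => /eqP.
pose eta x := (F 1 - F 0)^-1 * (F x - F 0).
have deta : has_deriv eta (fun x => (F 1 - F 0)^-1 * bump x).
  move=> x; apply: is_derive_scalef; rewrite -[bump x]subr0.
  by apply: is_derive_subf; exact: dF.
exists eta; split.
- by apply: (smooth_of_deriv deta); exact: smoothZ.
- by move=> x x0; rewrite /eta (F0 x x0) subrr mulr0.
- by move=> x x1; rewrite /eta (F1 x x1) mulVf// gt_eqF.
- by move=> x; rewrite (has_deriv_derive1 deta) mulr_ge0// invr_ge0 ltW.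
Qed.
End Step.

(** * Real-valued Lebesgue integrals over the line *)

Section LineIntegral.
Context {R : realType}.
Local Notation mu := (@lebesgue_measure R).
Implicit Types (f g h : R -> R) (a b c x : R).

Lemma ae_sub (P Q : R -> Prop) : (forall x, P x -> Q x) ->
  {ae mu, forall x, P x} -> {ae mu, forall x, Q x}.
Proof. by move=> PQ; exact: (@filterS _ _ (ae_filter_ringOfSetsType mu)). Qed.

Lemma ae_sub2 (P Q S : R -> Prop) : (forall x, P x -> Q x -> S x) ->
  {ae mu, forall x, P x} -> {ae mu, forall x, Q x} -> {ae mu, forall x, S x}.
Proof. by move=> PQS; exact: (@filterS2 _ _ (ae_filter_ringOfSetsType mu)). Qed.

Lemma ae_all (P : R -> Prop) : (forall x, P x) -> {ae mu, forall x, P x}.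
Proof. by move=> h; exact: (@filterE _ _ (ae_filter_ringOfSetsType mu)). Qed.

Lemma ae_eqP (T : Type) (u v : R -> T) :
  u = v %[ae mu] <-> {ae mu, forall x, u x = v x}.
Proof. by split; apply: ae_sub => // x; apply. Qed.

Definition L1 f : Prop := mu.-integrable setT (EFin \o f).

Lemma L1_measurable f : L1 f -> measurable_fun setT f.
Proof. by move=> /integrableP[/measurable_EFinP]. Qed.

Lemma L1_le f g : measurable_fun setT f -> L1 g ->
  (forall x, `|f x| <= g x) -> L1 f.
Proof.
move=> mf ig fg; apply: le_integrable ig => //; first exact/measurable_EFinP.
move=> x _ /=; rewrite lee_fin.
by apply: le_trans (fg x) _; exact: ler_norm.
Qed.

Lemma L1_D f g : L1 f -> L1 g -> L1 (fun x => f x + g x).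
Proof. by move=> i j; have := @integrableD _ _ _ mu setT measurableT _ _ i j. Qed.

Lemma L1_Z c f : L1 f -> L1 (fun x => c * f x).
Proof. by move=> i; have := @integrableZl _ _ _ mu setT measurableT c _ i. Qed.

Lemma L1_N f : L1 f -> L1 (fun x => - f x).
Proof.
by move=> /(@L1_Z (-1)); under [X in L1 X -> _]eq_fun do rewrite mulN1r.
Qed.

Lemma L1_B f g : L1 f -> L1 g -> L1 (fun x => f x - g x).
Proof. by move=> i /L1_N j; exact: L1_D. Qed.

Lemma L1_norm f : L1 f -> L1 (fun x => `|f x|).
Proof. by move=> i; have := @integrable_abse _ _ _ mu setT _ i. Qed.

Lemma integralD_L1 f g : L1 f -> L1 g ->
  \int[mu]_x (f x + g x) = \int[mu]_x f x + \int[mu]_x g x.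
Proof. by move=> i j; rewrite RintegralD. Qed.

Lemma integralB_L1 f g : L1 f -> L1 g ->
  \int[mu]_x (f x - g x) = \int[mu]_x f x - \int[mu]_x g x.
Proof. by move=> i j; rewrite RintegralB. Qed.

Lemma integralZ_L1 c f : L1 f ->
  \int[mu]_x (c * f x) = c * \int[mu]_x f x.
Proof. by move=> i; rewrite RintegralZl. Qed.

Lemma integralN_L1 f : L1 f -> \int[mu]_x (- f x) = - \int[mu]_x f x.
Proof.
move=> i; rewrite -mulN1r -integralZ_L1//.
by apply: eq_Rintegral => x _; rewrite mulN1r.
Qed.

Lemma le_integral_L1 f g : L1 f -> L1 g -> (forall x, f x <= g x) ->
  \int[mu]_x f x <= \int[mu]_x g x.
Proof. by move=> i j fg; apply: le_Rintegral. Qed.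

Lemma norm_integral_le f g : measurable_fun setT f -> L1 g ->
  (forall x, `|f x| <= g x) -> `|\int[mu]_x f x| <= \int[mu]_x g x.
Proof.
move=> mf ig fg; have i := L1_le mf ig fg.
by apply: le_trans (le_normr_Rintegral _ i) _ => //; apply: le_integral_L1 => //; exact: L1_norm.
Qed.

Lemma L1_ae_eq f g : measurable_fun setT f -> measurable_fun setT g ->
  f = g %[ae mu] -> L1 f -> L1 g.
Proof.
move=> mf mg fg /integrableP[_ i]; apply/integrableP; split; first exact/measurable_EFinP.
rewrite (@ae_eq_integral _ _ _ mu setT (fun x => `|(EFin \o f) x|%E))//.
- by apply: measurableT_comp => //; exact/measurable_EFinP.
- by apply: measurableT_comp => //; exact/measurable_EFinP.
- by move/ae_eqP : fg; apply: ae_sub => x /= -> _.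
Qed.

Lemma integral_ae_eq f g : measurable_fun setT f -> measurable_fun setT g ->
  f = g %[ae mu] -> \int[mu]_x f x = \int[mu]_x g x.
Proof.
move=> mf mg fg; congr fine; apply: ae_eq_integral => //.
- exact/measurable_EFinP.
- exact/measurable_EFinP.
- by move/ae_eqP : fg; apply: ae_sub => x /= -> _.
Qed.

Lemma dominated_cvg_integral (f_ : nat -> R -> R) f g :
  (forall n, measurable_fun setT (f_ n)) -> measurable_fun setT f -> L1 g ->
  (forall x, f_ n x @[n --> \oo] --> f x) ->
  (forall n x, `|f_ n x| <= g x) ->
  \int[mu]_x f_ n x @[n --> \oo] --> \int[mu]_x f x.
Proof.
move=> mf_ mf ig cf fg.
have [|||||i _] := @dominated_convergence _ _ _ mu setT measurableT
   (fun n => EFin \o f_ n) (EFin \o f) (EFin \o g).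
- by move=> n; apply/measurable_EFinP; exact: mf_.
- exact/measurable_EFinP.
- by apply: ae_all => x _; apply/fine_cvgP; split; [exact: nearW|exact: cf].
- exact: ig.
- by apply: ae_all => x n _; rewrite lee_fin.
move=> h; apply: fine_cvg; move: h; rewrite /comp/= => h.
rewrite fineK; last exact: integrable_fin_num.
exact: h.
Qed.

Lemma continuous_integrable_segment f a b : continuous f ->
  mu.-integrable `[a, b] (EFin \o f).
Proof.
move=> cf; apply: continuous_compact_integrable; first exact: segment_compact.
exact: continuous_subspaceT.
Qed.

Lemma integrable_segment_restrict f a b :
  mu.-integrable `[a, b] (EFin \o f) <-> L1 (f \_ `[a, b]).
Proof. by rewrite /L1 -restrict_EFin -integrable_mkcond. Qed.

Lemma restrict_segment_id f a b : (forall x, x < a -> f x = 0) ->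
  (forall x, b < x -> f x = 0) -> f \_ `[a, b] = f.
Proof.
move=> fa fb; apply/funext => x; rewrite patchE; case: ifPn => //.
rewrite notin_setE/= in_itv/= => /negP; rewrite negb_and -!ltNge.
by case/orP => xx; rewrite ?(fa _ xx) ?(fb _ xx).
Qed.

Lemma continuous_L1 f a b : continuous f -> (forall x, x < a -> f x = 0) ->
  (forall x, b < x -> f x = 0) -> L1 f.
Proof.
move=> cf fa fb; rewrite -(restrict_segment_id fa fb).
by apply/integrable_segment_restrict; exact: continuous_integrable_segment.
Qed.

Lemma integral_segment f a b : (forall x, x < a -> f x = 0) ->
  (forall x, b < x -> f x = 0) -> \int[mu]_(x in `[a, b]) f x = \int[mu]_x f x.
Proof. by move=> fa fb; rewrite Rintegral_mkcond restrict_segment_id. Qed.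

Lemma integral_deriv_segment f g a b : has_deriv f g -> continuous g -> a <= b ->
  \int[mu]_(x in `[a, b]) g x = f b - f a.
Proof.
move=> fg cg; rewrite le_eqVlt => /predU1P[->|ab].
  by rewrite set_itv1 /Rintegral integral_set1 subrr.
have cf := has_deriv_continuous fg.
rewrite /Rintegral (@continuous_FTC2 R g f)//.
- exact: continuous_subspaceT.
- split; first by move=> x _; have [] := fg x.
  + by apply: cvg_at_right_filter; exact: cf.
  + by apply: cvg_at_left_filter; exact: cf.
- by move=> x _; rewrite (has_deriv_derive1 fg).
Qed.

(** ** Local integrability *)

Lemma locally_integrable_segment f a b : locally_integrable setT f ->
  mu.-integrable `[a, b] (EFin \o f).
Proof.
move=> [mf _ lf]; apply/integrableP; split.
  by apply/measurable_EFinP; exact: measurable_funTS.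
by apply: lf => //; exact: segment_compact.
Qed.

Lemma locally_integrableP f : measurable_fun setT f ->
  (forall a b, mu.-integrable `[a, b] (EFin \o f)) -> locally_integrable setT f.
Proof.
move=> mf sf; split => //; first exact: openT.
move=> K _ cK.
have [M [Mreal MK]] := compact_bounded cK.
have KM : K `<=` `[- (M + 1), M + 1].
  move=> x Kx; rewrite /= in_itv/= -ler_norml.
  by apply: (MK (M + 1)) => //; rewrite ltrDl.
have /integrableP[_] := sf (- (M + 1)) (M + 1).
apply: le_lt_trans; apply: ge0_subset_integral => //.
- exact: compact_measurable.
- apply/measurable_EFinP; apply: measurableT_comp => //.
  exact: measurable_funTS.
Qed.

Lemma continuous_locally_integrable f : continuous f -> locally_integrable setT f.
Proof.
move=> cf; apply: locally_integrableP; last first.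
  by move=> a b; exact: continuous_integrable_segment.
exact: continuous_measurable_fun.
Qed.

Lemma locally_integrable_ae_eq f g : measurable_fun setT g -> f = g %[ae mu] ->
  locally_integrable setT f -> locally_integrable setT g.
Proof.
move=> mg fg lf; have [mf _ _] := lf; apply: locally_integrableP => // a b.
apply/integrable_segment_restrict.
have /integrable_segment_restrict := locally_integrable_segment a b lf.
apply: L1_ae_eq.
- by apply/(measurable_restrictT _ _).1 => //; exact: measurable_funTS.
- by apply/(measurable_restrictT _ _).1 => //; exact: measurable_funTS.
- by move/ae_eqP : fg => fg; apply/ae_eqP; apply: ae_sub fg => x /= fgx; rewrite !patchE fgx.
Qed.

Lemma locally_integrable_mul f g a b M : locally_integrable setT f ->
  measurable_fun setT g -> (forall x, `|g x| <= M) ->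
  (forall x, x < a -> g x = 0) -> (forall x, b < x -> g x = 0) ->
  L1 (fun x => f x * g x).
Proof.
move=> lf mg gM ga gb; have [mf _ _] := lf.
have /integrable_segment_restrict/L1_norm/(@L1_Z M) i := locally_integrable_segment a b lf.
apply: (L1_le _ i); first exact: measurable_funM.
move=> x; rewrite patchE; case: ifPn => [_|].
  by rewrite normrM mulrC ler_wpM2r.
rewrite notin_setE/= in_itv/= => /negP; rewrite negb_and -!ltNge.
by case/orP => xx; rewrite ?(ga _ xx) ?(gb _ xx) mulr0 !normr0 mulr0.
Qed.

End LineIntegral.

(** * Test functions and the scaled step *)

Section TestFunctions.
Context {R : realType}.
Local Notation mu := (@lebesgue_measure R).
Implicit Types (f g psi : R -> R) (a b e x : R).

Lemma smooth_test_function f a b : smooth f -> (forall x, x < a -> f x = 0) ->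
  (forall x, b < x -> f x = 0) -> test_function f.
Proof.
move=> [sf] fa fb; split=> //.
apply: (@subclosed_compact _ _ `[a, b]); first exact: closed_closure.
  exact: segment_compact.
rewrite [X in _ `<=` X](closure_id _).1; last exact: itv_closed.
apply: closureS => x /= fx0; rewrite in_itv/= !leNgt; apply/andP.
by split; apply/negP => xx; move: fx0; rewrite ?(fa _ xx) ?(fb _ xx) eqxx.
Qed.

Lemma smooth_measurable f : smooth f -> measurable_fun setT f.
Proof. by move=> /smooth_continuous/continuous_measurable_fun. Qed.

Lemma test_function_smooth psi : test_function psi -> smooth psi.
Proof. by case. Qed.

Lemma test_function_support psi : test_function psi -> exists M,
  (forall x, x < - M -> psi x = 0) /\ (forall x, M < x -> psi x = 0).
Proof.
move=> [_ /compact_bounded [M [_ MK]]]; exists (M + 1).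
have out x : M + 1 < `|x| -> psi x = 0.
  move=> xM; apply/eqP/negPn/negP => px; move: xM; apply/negP; rewrite -leNgt.
  by apply: (MK (M + 1)); [rewrite ltrDl|exact: subset_closure].
split=> x xx; apply: out.
  by rewrite -normrN; apply: lt_le_trans (ler_norm (- x)); rewrite ltrNr.
exact: lt_le_trans (ler_norm x).
Qed.

Lemma derive1_out f g (A : R) : has_deriv f g ->
  (forall x, x < A -> f x = 0) -> forall x, x < A -> g x = 0.
Proof.
move=> fg fA x xA; rewrite -(is_derive_derive1 (fg x)).
apply: is_derive_derive1; apply: (@near_eq_is_derive _ _ _ (cst 0)).
by near=> y; rewrite fA//; near: y; exact: lt_nbhsl.
Unshelve. all: by end_near. Qed.

Lemma derive1_out_r f g (A : R) : has_deriv f g ->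
  (forall x, A < x -> f x = 0) -> forall x, A < x -> g x = 0.
Proof.
move=> fg fA x xA; rewrite -(is_derive_derive1 (fg x)).
apply: is_derive_derive1; apply: (@near_eq_is_derive _ _ _ (cst 0)).
by near=> y; rewrite fA//; near: y; exact: nbhs_gt_self.
Unshelve. all: by end_near. Qed.

Lemma continuous_bounded f a b : continuous f -> (forall x, x < a -> f x = 0) ->
  (forall x, b < x -> f x = 0) -> exists2 M, 0 < M & forall x, `|f x| <= M.
Proof.
move=> cf fa fb; have [ab|ba] := leP a b; last first.
  exists 1 => // x; have [xa|ax] := ltP x a; first by rewrite fa// normr0.
  by rewrite fb ?normr0//; exact: lt_le_trans ax.
have cn : {within `[a, b], continuous (fun x => `|f x|)}.
  apply: continuous_subspaceT => x.
  by apply: (@continuous_comp _ _ _ f Num.norm); [exact: cf|exact: norm_continuous].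
have [c _ cmax] := EVT_max ab cn.
exists (`|f c| + 1); first by rewrite ltr_wpDl.
move=> x; have [xa|ax] := ltP x a; first by rewrite fa// normr0 addr_ge0.
have [bx|xb] := ltP b x; first by rewrite fb// normr0 addr_ge0.
by apply: (@le_trans _ _ `|f c|); [rewrite cmax// in_itv/= ax xb|rewrite lerDl].
Qed.

Definition unit_step : R -> R := projT1 (cid (@exists_smooth_step R)).

(** A smooth passage from 0 to 1 on [a, a + e]: its derivative is an approximate
    unit mass at [a], and differences of two steps are smooth cutoffs. *)
Definition step a e x := unit_step (e^-1 * x + - (a / e)).

Lemma smooth_step a e : smooth (step a e).
Proof. by apply: smooth_affine; rewrite /unit_step; case: cid => ? []. Qed.

Section ScaledStep.
Variables (a e : R).
Hypothesis e0 : 0 < e.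

Lemma step_le x : x <= a -> step a e x = 0.
Proof.
move=> xa; rewrite /step /unit_step; case: cid => s /= [_ s0 _ _]; apply: s0.
by rewrite subr_le0 mulrC ler_wpM2r// invr_ge0 ltW.
Qed.

Lemma step_ge x : a + e <= x -> step a e x = 1.
Proof.
move=> xa; rewrite /step /unit_step; case: cid => s /= [_ _ s1 _]; apply: s1.
by rewrite mulrC -mulrBl ler_pdivlMr// mul1r lerBrDr addrC.
Qed.

Lemma derive1_step x :
  derive1 (step a e) x = e^-1 * derive1 unit_step (e^-1 * x + - (a / e)).
Proof.
apply: is_derive_derive1; rewrite mulrC.
apply: (is_derive_compf (is_derive_affine _ _ _)).
by apply: smooth_has_deriv; rewrite /unit_step; case: cid => ? [].
Qed.

Lemma derive1_step_ge0 x : 0 <= derive1 (step a e) x.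
Proof.
rewrite derive1_step mulr_ge0 ?invr_ge0 ?(ltW e0)//.
by rewrite /unit_step; case: cid => ? [].
Qed.

Lemma derive1_step_lt x : x < a -> derive1 (step a e) x = 0.
Proof.
apply: derive1_out; first exact/smooth_has_deriv/smooth_step.
by move=> y /ltW; exact: step_le.
Qed.

Lemma derive1_step_gt x : a + e < x -> derive1 (step a e) x = 0.
Proof.
move=> xa; have d : has_deriv (fun x => step a e x - 1) (derive1 (step a e)).
  move=> y; rewrite -[derive1 _ y]subr0; apply: is_derive_subf.
  exact/smooth_has_deriv/smooth_step.
apply: (derive1_out_r d) xa => y /ltW ya; by rewrite step_ge// subrr.
Qed.

Lemma step_itv x : 0 <= step a e x <= 1.
Proof.
have nd : {homo step a e : x y / x <= y}.
  move=> u v uv.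
  have [c _ E] := @MVT_segment R (step a e) (derive1 (step a e)) u v uv
    (fun x _ => smooth_has_deriv (smooth_step a e) x)
    (continuous_subspaceT (smooth_continuous (smooth_step a e))).
  by rewrite -subr_ge0 E mulr_ge0 ?derive1_step_ge0// subr_ge0.
apply/andP; split.
  have [xa|ax] := leP x a; first by rewrite step_le.
  by rewrite -(step_le (lexx a)) nd// ltW.
have [xa|ax] := leP (a + e) x; first by rewrite step_ge.
by rewrite -(step_ge (lexx (a + e))) nd// ltW.
Qed.

Lemma step_norm x : `|step a e x| <= 1.
Proof. by have /andP[s0 s1] := step_itv x; rewrite ger0_norm. Qed.

End ScaledStep.

Lemma derive1_step_bounded : exists2 M, 0 < M & forall a e x, 0 < e ->
  `|derive1 (step a e) x| <= M / e.
Proof.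
have c1 : continuous (derive1 (step 0 1)).
  exact/smooth_continuous/smooth_derive1/smooth_step.
have [M M0 bM] := continuous_bounded c1
  (derive1_step_lt (ltr01)) (fun x => @derive1_step_gt 0 1 ltr01 x).
exists M => // a e x e0; rewrite derive1_step mulrC normrM.
rewrite [`|e^-1|]gtr0_norm ?invr_gt0// ler_wpM2r ?invr_ge0 ?(ltW e0)//.
have := bM (e^-1 * x + - (a / e)); rewrite derive1_step.
by rewrite invr1 !mul1r mul0r oppr0 addr0.
Qed.

Lemma integral_derive1_step a e : 0 < e -> \int[mu]_x derive1 (step a e) x = 1.
Proof.
move=> e0; rewrite -(@integral_segment _ _ a (a + e)).
- rewrite (integral_deriv_segment (smooth_has_deriv (smooth_step a e)))//.
  + by rewrite step_ge// step_le// subr0.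
  + exact/smooth_continuous/smooth_derive1/smooth_step.
  + by rewrite lerDl ltW.
- by move=> x; exact: derive1_step_lt.
- by move=> x; exact: derive1_step_gt.
Qed.

End TestFunctions.

(** * Weak derivatives on the line *)

Section WeakDerivative.
Context {R : realType}.
Local Notation mu := (@lebesgue_measure R).
Local Notation wd := (@is_weak_deriv_real R).
Implicit Types (f g psi : R -> R) (a b e x : R).

Let eps (n : nat) : R := harmonic n.
Let eps_gt0 n : 0 < eps n. Proof. exact: harmonic_gt0. Qed.
Let cvg_eps : eps n @[n --> \oo] --> 0. Proof. exact: cvg_harmonic. Qed.

Lemma locally_integrable_derive1_step f a e : locally_integrable setT f -> 0 < e ->
  L1 (fun x => f x * derive1 (step a e) x).
Proof.
move=> lf e0; have [M M0 bM] := @derive1_step_bounded R.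
apply: (@locally_integrable_mul _ _ _ a (a + e) (M / e)) => //.
- by apply: smooth_measurable; apply: smooth_derive1; exact: smooth_step.
- by move=> x; exact: bM.
- by move=> x; exact: derive1_step_lt.
- by move=> x; exact: derive1_step_gt.
Qed.

(** The derivative of a steep step has integral 1, and it is bounded by a multiple
    of the inverse length of the interval that carries it; so the error is
    controlled by the mean oscillation of [f] around [a]. *)
Lemma lebesgue_pt_mollify f a : locally_integrable setT f -> lebesgue_pt f a ->
  \int[mu]_x (f x * derive1 (step a (eps n)) x) @[n --> \oo] --> f a.
Proof.
move=> lf fa; have [M M0 bM] := @derive1_step_bounded R; have [mf _ _] := lf.
pose J r := \int[mu]_(y in ball a r) `|f y - f a|.
have lc : locally_integrable setT (fun y => f y - f a).
  apply: (@locally_integrableB _ _ f (cst (f a)) lf).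
  by apply: continuous_locally_integrable => x; exact: cvg_cst.
have iJ r : mu.-integrable (ball a r) (EFin \o (fun y => f y - f a)).
  apply: (@integrableS _ _ _ mu `[a - r, a + r]) => //.
  - exact: measurable_ball.
  - by rewrite ball_itv; apply: subset_itvW.
  - exact: locally_integrable_segment.
have davgE r : 0 < r -> fine (davg f a r) = J r / (r *+ 2).
  move=> r0; rewrite /davg /iavg lebesgue_measure_ball ?ltW// inver.
  rewrite mulrn_eq0/= gt_eqF// fineM//.
    by rewrite mulrC.
  have mB : measurable (ball a r : set (measurableTypeR R)) by exact: measurable_ball.
  exact: (integrable_fin_num mB (integrable_abse (iJ r))).
have bound n : `|\int[mu]_x (f x * derive1 (step a (eps n)) x) - f a| <=
    4 * M * fine (davg f a (2 * eps n)).
  have e0 := eps_gt0 n; set e := eps n in e0 *.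
  have -> : \int[mu]_x (f x * derive1 (step a e) x) - f a =
      \int[mu]_x ((f x - f a) * derive1 (step a e) x).
    transitivity (\int[mu]_x (f x * derive1 (step a e) x - f a * derive1 (step a e) x)).
      rewrite integralB_L1; [|exact: locally_integrable_derive1_step|]; last first.
        apply: locally_integrable_derive1_step => //.
        by apply: continuous_locally_integrable => x; exact: cvg_cst.
      rewrite integralZ_L1 ?integral_derive1_step ?mulr1//.
      apply: (@continuous_L1 _ _ a (a + e)).
      - by apply: smooth_continuous; apply: smooth_derive1; exact: smooth_step.
      - by move=> x; exact: derive1_step_lt.
      - by move=> x; exact: derive1_step_gt.
    by apply: eq_Rintegral => x _; rewrite mulrBl.
  have e20 : 0 < 2 * e by rewrite mulr_gt0.
  rewrite davgE//.
  have -> : 4 * M * (J (2 * e) / ((2 * e) *+ 2)) = (M / e) * J (2 * e).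
    by field; rewrite gt_eqF.
  have iB : L1 ((fun y => `|f y - f a|) \_ (ball a (2 * e))).
    have mB : measurable (ball a (2 * e) : set (measurableTypeR R)).
      exact: measurable_ball.
    rewrite /L1 -restrict_EFin.
    exact: ((integrable_mkcond _ mB).1 (integrable_abse (iJ (2 * e)))).
  have -> : J (2 * e) = \int[mu]_x ((fun y => `|f y - f a|) \_ (ball a (2 * e))) x.
    by rewrite /J Rintegral_mkcond.
  rewrite -integralZ_L1//.
  apply: norm_integral_le; last 1 first.
  - move=> x; rewrite patchE; case: ifPn => [_|].
      by rewrite normrM mulrC ler_wpM2r//; exact: bM.
    rewrite notin_setE ball_itv/= in_itv/= => /negP; rewrite negb_and -!leNgt.
    case/orP => xx.
      by rewrite derive1_step_lt ?mulr0 ?normr0// (le_lt_trans xx)// ltrBlDr ltrDl.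
    rewrite derive1_step_gt ?mulr0 ?normr0//; apply: lt_le_trans xx.
    by rewrite ltrD2l ltr_pMl// ltr1n.
  - apply: measurable_funM; first by have [] := lc.
    by apply: smooth_measurable; apply: smooth_derive1; exact: smooth_step.
  - exact: L1_Z.
have cd : fine (davg f a (2 * eps n)) @[n --> \oo] --> 0.
  have /fine_cvg/cvg_at_rightP := fa; apply; split.
    by move=> n; rewrite mulr_gt0.
  by rewrite -[X in _ --> X](mulr0 2); apply: cvgM; [exact: cvg_cst|exact: cvg_eps].
apply/subr_cvg0.
apply/norm_cvg0P.
apply: (@squeeze_cvgr _ _ _ _ (cst 0) (fun n => 4 * M * fine (davg f a (2 * eps n)))).
- by apply: nearW => n; rewrite normr_ge0 bound.
- exact: cvg_cst.
- by rewrite -[X in _ --> X](mulr0 (4 * M)); apply: cvgM; [exact: cvg_cst|exact: cd].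
Qed.

Lemma weak_deriv_test f g psi a b : wd f g -> smooth psi ->
  (forall x, x < a -> psi x = 0) -> (forall x, b < x -> psi x = 0) ->
  \int[mu]_x (f x * derive1 psi x) = - \int[mu]_x (g x * psi x).
Proof. by move=> [_ _ h] sp pa pb; apply: h; exact: smooth_test_function pa pb. Qed.

Let cvg_step a x : (step a (eps n) x) @[n --> \oo] --> ((a < x)%R%:R : R).
Proof.
have [xa|ax] := leP x a.
  rewrite (_ : (fun n => _) = cst 0); first exact: cvg_cst.
  by apply/funext => n; rewrite step_le.
apply: cvg_near_cst; have xa0 : 0 < x - a by rewrite subr_gt0.
have h : \forall n \near \oo, eps n < x - a by exact: cvgr_lt cvg_eps _ xa0.
apply: filterS h => n en.
by rewrite step_ge// -lerBrDl ltW.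
Qed.

(** At Lebesgue points the fundamental theorem of calculus holds for weak
    derivatives: test with a smoothed indicator of the segment and let the
    slopes become infinitely steep. *)
Lemma weak_deriv_increment f g a b : wd f g -> lebesgue_pt f a ->
  lebesgue_pt f b -> a <= b -> f b - f a = \int[mu]_(x in `[a, b]) g x.
Proof.
move=> fg fa fb ab; have [lf lg _] := fg; have [mg _ _] := lg.
pose psi n x := step a (eps n) x - step b (eps n) x.
have spsi n : smooth (psi n) by apply: smoothB; exact: smooth_step.
have psia n x : x <= a -> psi n x = 0.
  by move=> xa; rewrite /psi !step_le ?subrr// (le_trans xa).
have psib n x : b + 1 < x -> psi n x = 0.
  move=> /ltW xb; have e1 : eps n <= 1 by rewrite /eps invf_le1 ?ler1n// ltr0n.
  rewrite /psi !step_ge ?subrr// (le_trans _ xb)// ?lerD//.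
have E n : \int[mu]_x (f x * derive1 (step b (eps n)) x) -
           \int[mu]_x (f x * derive1 (step a (eps n)) x) =
           \int[mu]_x (g x * psi n x).
  rewrite -[RHS]opprK -(weak_deriv_test fg (spsi n) (a := a) (b := b + 1)); last 2 first.
  - by move=> x /ltW; exact: psia.
  - exact: psib.
  rewrite -[LHS]opprB -integralB_L1; [|exact: locally_integrable_derive1_step..].
  congr (- _); apply: eq_Rintegral => x _; rewrite -mulrBr; congr (_ * _).
  rewrite (@has_deriv_derive1 _ (psi n) (fun x => derive1 (step a (eps n)) x - derive1 (step b (eps n)) x))//.
  by move=> y; apply: is_derive_subf; apply: smooth_has_deriv; exact: smooth_step.
have lhs : \int[mu]_x (g x * psi n x) @[n --> \oo] --> f b - f a.
  by under eq_fun do rewrite -E; apply: cvgB; exact: lebesgue_pt_mollify.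
rewrite -(cvg_lim (@Rhausdorff R) lhs); apply: cvg_lim => //.
rewrite -Rintegral_itv_obnd_cbnd; last first.
  apply: (@integrableS _ _ _ mu `[a, b]) => //; first exact: subset_itv_oc_cc.
  exact: locally_integrable_segment.
rewrite [X in _ --> X]Rintegral_mkcond.
apply: (@dominated_cvg_integral _ _ _ (fun x => 2 * `|(g \_ `[a, b + 1]) x|)).
- by move=> n; apply: measurable_funM => //; exact: smooth_measurable.
- by apply/(measurable_restrictT _ _).1 => //; exact: measurable_funTS.
- apply/L1_Z/L1_norm/integrable_segment_restrict.
  exact: locally_integrable_segment.
- move=> x; rewrite [X in _ --> X](_ : _ = g x * (((a < x)%R%:R : R) - ((b < x)%R%:R : R))).
    apply: cvgM; first exact: cvg_cst.
    by apply: cvgB; exact: cvg_step.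
  rewrite patchE; case: ifPn.
    rewrite inE/= in_itv/= => /andP[-> xb].
    by rewrite [b < x]ltNge xb subr0 mulr1.
  rewrite notin_setE/= in_itv/= => /negP; rewrite negb_and -leNgt -ltNge.
  case/orP => xx.
    by rewrite !ltNge (le_trans xx ab) xx subrr mulr0.
  by rewrite xx (le_lt_trans ab xx) subrr mulr0.
- move=> n x; have [xa|ax] := leP x a.
    by rewrite psia// mulr0 normr0 mulr_ge0.
  have [bx|xb] := ltP (b + 1) x.
    by rewrite psib// mulr0 normr0 mulr_ge0.
  rewrite patchE mem_set/= ?in_itv/= ?(ltW ax)// normrM mulrC ler_wpM2r//.
  by rewrite (le_trans (ler_normB _ _))// (_ : 2 = 1 + 1)// lerD// step_norm.
Qed.

(** The derivative of a step is itself a test function, so [g] and [h] have the same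
    averages against it, hence the same values at their Lebesgue points. *)
Lemma weak_deriv_unique f g h : wd f g -> wd f h -> g = h %[ae mu].
Proof.
move=> fg fh; have [_ lg _] := fg; have [_ lh _] := fh; apply/ae_eqP.
have := lebesgue_differentiation lh; have := lebesgue_differentiation lg.
apply: ae_sub2 => a ga ha.
have gE n : \int[mu]_x (g x * derive1 (step a (eps n)) x) =
    \int[mu]_x (h x * derive1 (step a (eps n)) x).
  apply: oppr_inj; rewrite -!(@weak_deriv_test f _ _ a (a + eps n)) => //.
  - by apply: smooth_derive1; exact: smooth_step.
  - by move=> x; exact: derive1_step_lt.
  - by move=> x; exact: derive1_step_gt.
  - by apply: smooth_derive1; exact: smooth_step.
  - by move=> x; exact: derive1_step_lt.
  - by move=> x; exact: derive1_step_gt.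
have := lebesgue_pt_mollify lg ga; under eq_fun do rewrite gE.
by move=> /(cvg_lim (@Rhausdorff R)) <-; apply: cvg_lim => //; exact: lebesgue_pt_mollify.
Qed.

Lemma weak_deriv_ae_eq f f' g g' : measurable_fun setT f' ->
  measurable_fun setT g' -> f = f' %[ae mu] -> g = g' %[ae mu] ->
  wd f g -> wd f' g'.
Proof.
move=> mf' mg' ff' gg' [lf lg h].
have [mf _ _] := lf; have [mg _ _] := lg.
split; [exact: locally_integrable_ae_eq lf|exact: locally_integrable_ae_eq lg|].
move=> psi tpsi; have := h _ tpsi; have /test_function_smooth sp := tpsi.
rewrite (@integral_ae_eq _ _ (fun x => f' x * derive1 psi x)).
- rewrite (@integral_ae_eq _ (fun x => g x * _) (fun x => g' x * psi x))//.
  + by apply: measurable_funM => //; exact: smooth_measurable.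
  + by apply: measurable_funM => //; exact: smooth_measurable.
  + by apply/ae_eqP; move/ae_eqP : gg'; apply: ae_sub => x ->.
- by apply: measurable_funM => //; apply: smooth_measurable; exact: smooth_derive1.
- by apply: measurable_funM => //; apply: smooth_measurable; exact: smooth_derive1.
- by apply/ae_eqP; move/ae_eqP : ff'; apply: ae_sub => x ->.
Qed.

Lemma has_deriv_weak_deriv f g : has_deriv f g -> continuous g -> wd f g.
Proof.
move=> fg cg; have cf := has_deriv_continuous fg.
split; [exact: continuous_locally_integrable..|].
move=> psi tpsi; have sp := test_function_smooth tpsi.
have [M [pM1 pM2]] := test_function_support tpsi.
have [dM1 dM2] := (derive1_out (smooth_has_deriv sp) pM1,
  derive1_out_r (smooth_has_deriv sp) pM2).
have cp := smooth_continuous sp.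
have cp' := smooth_continuous (smooth_derive1 sp).
have i1 : L1 (fun x => f x * derive1 psi x).
  apply: (@continuous_L1 _ _ (- M) M).
  - by move=> x; apply: cvgM; [exact: cf|exact: cp'].
  - by move=> x xM; rewrite dM1// mulr0.
  - by move=> x xM; rewrite dM2// mulr0.
have i2 : L1 (fun x => g x * psi x).
  apply: (@continuous_L1 _ _ (- M) M).
  - by move=> x; apply: cvgM; [exact: cg|exact: cp].
  - by move=> x xM; rewrite pM1// mulr0.
  - by move=> x xM; rewrite pM2// mulr0.
apply/eqP; rewrite -addr_eq0 -integralD_L1//; apply/eqP.
pose N : R := `|M| + 1; have MN : M < N by rewrite (le_lt_trans (ler_norm _))// ltrDl.
have MN' : - N < - M by rewrite ltrN2.
rewrite -(@integral_segment _ _ (- N) N); last 2 first.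
- move=> x xN; have xM := lt_trans xN MN'.
  by rewrite dM1// pM1// !mulr0 addr0.
- by move=> x xN; have xM := lt_trans MN xN; rewrite dM2// pM2// !mulr0 addr0.
have dfp : has_deriv (fun x => f x * psi x) (fun x => f x * derive1 psi x + g x * psi x).
  by move=> x; rewrite addrC; apply: is_derive_mulf => //; exact: smooth_has_deriv.
rewrite (integral_deriv_segment dfp).
- by rewrite (pM1 _ MN') (pM2 _ MN) !mulr0 subrr.
- by move=> x; apply: cvgD; apply: cvgM; [exact: cf|exact: cp'|exact: cg|exact: cp].
- by rewrite -subr_ge0 opprK addr_ge0// addr_ge0.
Qed.

Lemma locally_integrable_test f psi : locally_integrable setT f ->
  test_function psi ->
  L1 (fun x => f x * psi x) /\ L1 (fun x => f x * derive1 psi x).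
Proof.
move=> lf tpsi; have sp := test_function_smooth tpsi.
have [M [pM1 pM2]] := test_function_support tpsi.
have dM1 := derive1_out (smooth_has_deriv sp) pM1.
have dM2 := derive1_out_r (smooth_has_deriv sp) pM2.
have [B1 _ bp] := continuous_bounded (smooth_continuous sp) pM1 pM2.
have [B2 _ bd] := continuous_bounded (smooth_continuous (smooth_derive1 sp)) dM1 dM2.
split.
  by apply: (locally_integrable_mul lf _ bp pM1 pM2); exact: smooth_measurable.
apply: (locally_integrable_mul lf _ bd dM1 dM2).
by apply: smooth_measurable; exact: smooth_derive1.
Qed.

Lemma weak_derivD f1 g1 f2 g2 : wd f1 g1 -> wd f2 g2 ->
  wd (fun x => f1 x + f2 x) (fun x => g1 x + g2 x).
Proof.
move=> [lf1 lg1 h1] [lf2 lg2 h2]; split; [exact: locally_integrableD..|].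
move=> psi tpsi; under eq_Rintegral do rewrite mulrDl.
have [_ i1] := locally_integrable_test lf1 tpsi.
have [_ i2] := locally_integrable_test lf2 tpsi.
have [j1 _] := locally_integrable_test lg1 tpsi.
have [j2 _] := locally_integrable_test lg2 tpsi.
rewrite integralD_L1// h1// h2//.
under [in RHS]eq_Rintegral do rewrite mulrDl.
by rewrite integralD_L1// opprD.
Qed.

Lemma locally_integrableZ c f : locally_integrable setT f ->
  locally_integrable setT (fun x => c * f x).
Proof.
move=> lf; have [mf _ _] := lf; apply: locally_integrableP.
  by apply: measurable_funM => //; exact: measurable_cst.
move=> a b; have i := locally_integrable_segment a b lf.
by have := @integrableZl _ _ _ mu _ (measurable_itv _) c _ i.
Qed.

Lemma weak_derivZ c f g : wd f g -> wd (fun x => c * f x) (fun x => c * g x).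
Proof.
move=> [lf lg h]; split; [exact: locally_integrableZ..|].
move=> psi tpsi; under eq_Rintegral do rewrite -mulrA.
have [_ i1] := locally_integrable_test lf tpsi.
have [j1 _] := locally_integrable_test lg tpsi.
rewrite integralZ_L1// h// mulrN; congr (- _).
by under [in RHS]eq_Rintegral do rewrite -mulrA; rewrite integralZ_L1.
Qed.

(** ** The continuous representative *)

(** Otherwise the whole line would be contained in the null set of the Lebesgue
    differentiation theorem. *)

Lemma lebesgue_pt_exists f : locally_integrable setT f ->
  exists a, lebesgue_pt f a.
Proof.
move=> lf; apply: contrapT => no.
have := lebesgue_differentiation lf => -[N [mN N0 sub]].
have : mu setT = 0.
  apply/eqP; rewrite eq_le measure_ge0 andbT -N0; apply: le_measure.
  - by rewrite inE.
  - by rewrite inE.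
  - by move=> x _; apply: sub => /= fx; apply: no; exists x.
by rewrite (_ : setT = `]-oo, +oo[%classic) ?lebesgue_measure_itv//= -?set_itvNyy.
Qed.

Lemma integral_segment_cat g a b c : locally_integrable setT g ->
  a <= b -> b <= c -> \int[mu]_(x in `[a, c]) g x =
  \int[mu]_(x in `[a, b]) g x + \int[mu]_(x in `[b, c]) g x.
Proof.
move=> lg ab bc; have i := locally_integrable_segment a c lg.
have := @Rintegral_itvB R g (BLeft a) (BRight c) b i.
rewrite Rintegral_itv_obnd_cbnd.
  by rewrite !bnd_simp => <- //; rewrite addrC subrK.
apply: (@integrableS _ _ _ mu `[a, c]) => //.
by move=> x /=; rewrite !in_itv/= => /andP[bx ->]; rewrite (le_trans ab (ltW bx)).
Qed.

Definition primitive g x : R :=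
  if 0 <= x then \int[mu]_(y in `[0, x]) g y else - \int[mu]_(y in `[x, 0]) g y.

Lemma primitiveB g x y : locally_integrable setT g -> x <= y ->
  primitive g y - primitive g x = \int[mu]_(z in `[x, y]) g z.
Proof.
move=> lg xy; rewrite /primitive; case: ifPn => y0; case: ifPn => x0.
- by rewrite (integral_segment_cat lg x0 xy) addrC addKr.
- rewrite opprK addrC -integral_segment_cat//.
  by rewrite ltW// ltNge.
- by move: y0; rewrite (le_trans x0 xy).
- move: x0 y0; rewrite -!ltNge => x0 y0.
  by rewrite opprK (integral_segment_cat lg xy (ltW y0)) addrC addrK.
Qed.

Lemma primitive_continuous g : locally_integrable setT g ->
  continuous (primitive g).
Proof.
move=> lg x; have x1 : x - 1 < x by rewrite ltrBlDr ltrDl.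
have x2 : x < x + 1 by rewrite ltrDl.
have x12 : x - 1 <= x + 1 by exact/ltW/(lt_trans x1).
have := parameterized_integral_continuous x12
  (locally_integrable_segment (x - 1) (x + 1) lg).
have x12' : x - 1 < x + 1 by exact: lt_trans x1 x2.
move=> /(continuous_within_itvP _ x12')[h' _ _].
have h := h' x; rewrite in_itv/= x1 x2 in h; have {}h := h isT.
have : {for x, continuous (fun y => primitive g (x - 1) +
    parameterized_integral mu (x - 1) y g)}.
  by apply: cvgD; [exact: cvg_cst|exact: h].
rewrite /prop_for/= {1}/continuous_at.
have E y : x - 1 <= y -> primitive g (x - 1) +
    parameterized_integral mu (x - 1) y g = primitive g y.
  by move=> xy; rewrite /parameterized_integral -primitiveB// addrC subrK.
rewrite (E x (ltW x1)); apply: cvg_trans; apply: near_eq_cvg.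
by near=> y; rewrite E//; apply: ltW; near: y; exact: nbhs_gt_self.
Unshelve. all: by end_near. Qed.

Lemma primitive_has_deriv g : continuous g -> has_deriv (primitive g) g.
Proof.
move=> cg x; have x1 : x - 1 < x by rewrite ltrBlDr ltrDl.
have x2 : x < x + 1 by rewrite ltrDl.
have lg := continuous_locally_integrable cg.
have [d dE] := continuous_FTC1_closed x2
  (locally_integrable_segment (x - 1) (x + 1) lg) x1 (cg x).
apply: (@near_eq_is_derive _ _ _ (fun y => \int[mu]_(z in `[x - 1, y]) g z + primitive g (x - 1))).
  near=> y; rewrite -primitiveB ?subrK//; apply: ltW; near: y; exact: nbhs_gt_self.
rewrite -[g x]addr0; apply: is_derive_addf.
by have := derivable_is_derive d; rewrite dE.
Unshelve. all: by end_near. Qed.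

Lemma weak_deriv_primitive f g : wd f g ->
  exists c, f = (fun x => c + primitive g x) %[ae mu].
Proof.
move=> fg; have [lf lg _] := fg; have [a fa] := lebesgue_pt_exists lf.
exists (f a - primitive g a); apply/ae_eqP.
have := lebesgue_differentiation lf; apply: ae_sub => x fx.
have [xa|ax] := leP x a.
  have := weak_deriv_increment fg fx fa xa; rewrite -primitiveB// => E; lra.
have := weak_deriv_increment fg fa fx (ltW ax); rewrite -primitiveB ?ltW// => E; lra.
Qed.

Lemma weak_deriv_continuous f g : wd f g ->
  exists2 F, continuous F & f = F %[ae mu].
Proof.
move=> fg; have [_ lg _] := fg; have [c cE] := weak_deriv_primitive fg.
exists (fun x => c + primitive g x) => //.
by move=> x; apply: cvgD; [exact: cvg_cst|exact: primitive_continuous].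
Qed.

(** A weak derivative with a continuous representative is a classical one. *)
Lemma weak_deriv_C1 f g G : wd f g -> continuous G -> g = G %[ae mu] ->
  exists2 F, has_deriv F G & f = F %[ae mu].
Proof.
move=> fg cG gG; have [[mf _ _] _ _] := fg.
have fG : wd f G.
  apply: (weak_deriv_ae_eq mf (continuous_measurable_fun cG) _ gG fg).
  by apply/ae_eqP; exact: ae_all.
have [c cE] := weak_deriv_primitive fG.
exists (fun x => c + primitive G x) => //.
move=> x; rewrite -[G x]add0r; apply: is_derive_addf.
exact: primitive_has_deriv.
Qed.

End WeakDerivative.

(** * Lebesgue norms of complex-valued functions *)

Section ComplexNorms.
Context {R : realType}.
Local Notation mu := (@lebesgue_measure R).
Local Notation wd := (@is_weak_deriv_real R).
Implicit Types (u v h g k : R -> R[i]) (f : R -> R) (x : R).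

Definition re u : R -> R := @complex.Re R \o u.
Definition im u : R -> R := @complex.Im R \o u.
Definition modulus u x : R := Normc.normc (u x).

Lemma normc_sq (z : R[i]) : Normc.normc z ^+ 2 = complex.Re z ^+ 2 + complex.Im z ^+ 2.
Proof. by case: z => a b /=; rewrite sqr_sqrtr// addr_ge0 ?sqr_ge0. Qed.

Lemma normc_ge0 (z : R[i]) : 0 <= Normc.normc z.
Proof. by case: z => a b; exact: sqrtr_ge0. Qed.

Lemma normcE (z : R[i]) : Normc.normc z = Num.sqrt (complex.Re z ^+ 2 + complex.Im z ^+ 2).
Proof. by case: z. Qed.

Lemma modulus_ge0 u x : 0 <= modulus u x. Proof. exact: normc_ge0. Qed.

Lemma modulus_sq u x : modulus u x ^+ 2 = re u x ^+ 2 + im u x ^+ 2.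
Proof. exact: normc_sq. Qed.

Lemma re_le_normc (z : R[i]) : `|complex.Re z| <= Normc.normc z.
Proof.
rewrite -ler_sqr ?nnegrE ?normr_ge0 ?normc_ge0// normc_sq real_normK ?num_real//.
by rewrite lerDl sqr_ge0.
Qed.

Lemma im_le_normc (z : R[i]) : `|complex.Im z| <= Normc.normc z.
Proof.
rewrite -ler_sqr ?nnegrE ?normr_ge0 ?normc_ge0// normc_sq real_normK ?num_real//.
by rewrite lerDr sqr_ge0.
Qed.

Lemma re_le_modulus u x : `|re u x| <= modulus u x.
Proof. exact: re_le_normc. Qed.

Lemma im_le_modulus u x : `|im u x| <= modulus u x.
Proof. exact: im_le_normc. Qed.

Lemma normc_le (z : R[i]) : Normc.normc z <= `|complex.Re z| + `|complex.Im z|.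
Proof.
rewrite -ler_sqr ?nnegrE ?normc_ge0 ?addr_ge0// normc_sq sqrrD.
rewrite !real_normK ?num_real// [leRHS]addrAC lerDl.
by rewrite mulrn_wge0 ?mulr_ge0.
Qed.

Lemma modulus_le u x : modulus u x <= `|re u x| + `|im u x|.
Proof. exact: normc_le. Qed.

Lemma re_add u v : re (fun x => u x + v x) = fun x => re u x + re v x.
Proof. by apply/funext => x; rewrite /re/=; case: (u x) (v x) => ? ? []. Qed.

Lemma im_add u v : im (fun x => u x + v x) = fun x => im u x + im v x.
Proof. by apply/funext => x; rewrite /im/=; case: (u x) (v x) => ? ? []. Qed.

Definition measurable_complex u :=
  measurable_fun setT (re u) /\ measurable_fun setT (im u).

Lemma measurable_modulus u : measurable_complex u -> measurable_fun setT (modulus u).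
Proof.
move=> [mr mi].
rewrite (_ : modulus u = (Num.sqrt : R -> R) \o (fun x => re u x ^+ 2 + im u x ^+ 2)).
  apply: measurableT_comp; first by apply: continuous_measurable_fun; exact: sqrt_continuous.
  by apply: measurable_funD; exact: measurable_funX.
by apply/funext => x; rewrite /modulus normcE.
Qed.

Lemma measurable_complexD u v : measurable_complex u -> measurable_complex v ->
  measurable_complex (fun x => u x + v x).
Proof.
move=> [mru miu] [mrv miv]; rewrite /measurable_complex re_add im_add.
by split; exact: measurable_funD.
Qed.

Lemma LpP n u : (0 < n)%N -> Lp n%:R u <->
  measurable_complex u /\ L1 (fun x => modulus u x ^+ n).
Proof.
move=> n0; have nz : n%:R != 0 :> R by rewrite pnatr_eq0 -lt0n.
have E : (\int[mu]_x (`|(EFin \o modulus u) x| `^ n%:R))%E =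
         (\int[mu]_x `|(modulus u x ^+ n)%:E|)%E.
  apply: eq_integral => x _ /=; rewrite powR_mulrn//.
  by rewrite [`|modulus u x ^+ n|]normrX.
split=> [[mr mi]|[[mr mi] /integrableP[mm im']]].
  rewrite inE => /andP[/=]; rewrite !inE/= => mf fn; split => //.
  apply/integrableP; split.
    apply/measurable_EFinP; apply: measurable_funX.
    exact: (@measurable_modulus u).
  rewrite -[X in (X < _)%E]E -poweR_Lnorm//; apply: poweR_lty.
  exact: fn.
split => //; rewrite inE; apply/andP; rewrite !inE/=; split.
  exact: (@measurable_modulus u).
rewrite /finite_norm; have := lty_poweRy; apply; first exact: nz.
by rewrite poweR_Lnorm//; rewrite -[X in (X < _)%E]E in im'; exact: im'.
Qed.

Lemma Lp_normX n u : (0 < n)%N ->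
  Lp_norm n%:R u ^+ n = \int[mu]_x (modulus u x ^+ n).
Proof.
move=> n0; have nz : n%:R != 0 :> R by rewrite pnatr_eq0 -lt0n.
rewrite /Lp_norm -powR_mulrn ?fine_ge0 ?Lnorm_ge0// -fine_poweR poweR_Lnorm//.
congr fine; apply: eq_integral => x _ /=; rewrite powR_mulrn//.
by rewrite ger0_norm ?modulus_ge0.
Qed.

Lemma Lp_norm_ge0 p u : 0 <= Lp_norm p u.
Proof. by rewrite fine_ge0 ?Lnorm_ge0. Qed.

(** ** Weak derivatives in [X] *)

Lemma is_weak_deriv_measurable u g : is_weak_deriv u g ->
  measurable_complex u /\ measurable_complex g.
Proof. by move=> [[[? _ _] [? _ _] _] [[? _ _] [? _ _] _]]. Qed.

Lemma weak_deriv_spec u g : is_weak_deriv u g -> is_weak_deriv u (weak_deriv u).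
Proof. by move=> ug; rewrite /weak_deriv; apply: xgetPex; exists g. Qed.

Lemma weak_derivP u : in_Hdot1 u -> is_weak_deriv u (weak_deriv u).
Proof. by move=> [g [/weak_deriv_spec]]. Qed.

Lemma is_weak_deriv_unique u g g' : is_weak_deriv u g -> is_weak_deriv u g' ->
  g = g' %[ae mu].
Proof.
move=> [h1 h2] [h1' h2']; apply/ae_eqP.
have /ae_eqP := weak_deriv_unique h1 h1'; have /ae_eqP := weak_deriv_unique h2 h2'.
apply: ae_sub2 => x /=; case: (g x) (g' x) => ? ? [? ?] /=.
by move=> -> ->.
Qed.

Lemma modulus_ae_eq u v : u = v %[ae mu] -> {ae mu, forall x, modulus u x = modulus v x}.
Proof. by move=> /ae_eqP; apply: ae_sub => x; rewrite /modulus => ->. Qed.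

Lemma L1_modulus_ae_eq n u v : measurable_complex u -> measurable_complex v ->
  u = v %[ae mu] -> L1 (fun x => modulus u x ^+ n) -> L1 (fun x => modulus v x ^+ n).
Proof.
move=> mu' mv uv; apply: L1_ae_eq.
- by apply: measurable_funX; exact: measurable_modulus.
- by apply: measurable_funX; exact: measurable_modulus.
- by apply/ae_eqP; have := modulus_ae_eq uv; apply: ae_sub => x ->.
Qed.

Lemma integral_modulus_ae_eq n u v : measurable_complex u -> measurable_complex v ->
  u = v %[ae mu] ->
  \int[mu]_x (modulus u x ^+ n) = \int[mu]_x (modulus v x ^+ n).
Proof.
move=> mu' mv uv; apply: integral_ae_eq.
- by apply: measurable_funX; exact: measurable_modulus.
- by apply: measurable_funX; exact: measurable_modulus.
- by apply/ae_eqP; have := modulus_ae_eq uv; apply: ae_sub => x ->.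
Qed.

Lemma weak_deriv_L2 u : in_Hdot1 u ->
  measurable_complex (weak_deriv u) /\ L1 (fun x => modulus (weak_deriv u) x ^+ 2).
Proof.
move=> hu; have := weak_derivP hu; move: hu => [g [ug /(@LpP 2 g isT)[mg ig]]] uw.
have [_ mw] := is_weak_deriv_measurable uw; split => //.
by apply: L1_modulus_ae_eq ig => //; exact: is_weak_deriv_unique ug uw.
Qed.

Lemma in_XP u : in_X u <->
  [/\ is_weak_deriv u (weak_deriv u), L1 (fun x => modulus (weak_deriv u) x ^+ 2) &
      L1 (fun x => modulus u x ^+ 3)].
Proof.
split=> [[hu /(@LpP 3 u isT)[mu' iu]]|[uw iw iu]].
  by split => //; [exact: weak_derivP|have [] := weak_deriv_L2 hu].
have [mu' mw] := is_weak_deriv_measurable uw.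
split; last by apply/(@LpP 3 u isT).
by exists (weak_deriv u); split => //; apply/(@LpP 2 _ isT).
Qed.

Lemma is_weak_derivD u g v k : is_weak_deriv u g -> is_weak_deriv v k ->
  is_weak_deriv (fun x => u x + v x) (fun x => g x + k x).
Proof.
move=> [u1 u2] [v1 v2]; split.
  by rewrite -/(re _) -/(re (fun x => g x + k x)) !re_add; exact: weak_derivD.
by rewrite -/(im _) -/(im (fun x => g x + k x)) !im_add; exact: weak_derivD.
Qed.

Lemma weak_deriv_ae u g : is_weak_deriv u g -> weak_deriv u = g %[ae mu].
Proof.
by move=> ug; apply: (is_weak_deriv_unique (weak_deriv_spec ug)).
Qed.

Lemma weak_deriv_modulus n u g : is_weak_deriv u g ->
  L1 (fun x => modulus g x ^+ n) -> L1 (fun x => modulus (weak_deriv u) x ^+ n) /\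
  \int[mu]_x (modulus (weak_deriv u) x ^+ n) = \int[mu]_x (modulus g x ^+ n).
Proof.
move=> ug ig; have wg := weak_deriv_ae ug.
have uw := weak_deriv_spec ug.
have [_ mg] := is_weak_deriv_measurable ug.
have [_ mw] := is_weak_deriv_measurable uw.
split; last exact: integral_modulus_ae_eq.
apply: L1_modulus_ae_eq ig => //; apply/ae_eqP.
by move/ae_eqP : wg; apply: ae_sub => x ->.
Qed.

Lemma is_weak_deriv_in_X u g : is_weak_deriv u g ->
  L1 (fun x => modulus g x ^+ 2) -> L1 (fun x => modulus u x ^+ 3) -> in_X u.
Proof.
move=> ug ig iu; have [iw _] := weak_deriv_modulus ug ig.
by apply/in_XP; split => //; exact: weak_deriv_spec ug.
Qed.

Lemma actionE a1 a2 a3 u : action a1 a2 a3 u =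
  2^-1 * \int[mu]_x (modulus (weak_deriv u) x ^+ 2)
  - a1 / 3 * \int[mu]_x (modulus u x ^+ 3)
  - a2 / 4 * \int[mu]_x (modulus u x ^+ 4)
  - a3 / 5 * \int[mu]_x (modulus u x ^+ 5).
Proof. by rewrite /action (@Lp_normX 2)// (@Lp_normX 3)// (@Lp_normX 4)// (@Lp_normX 5). Qed.

(** ** Boundedness of functions in [X] *)

(** One-dimensional Sobolev embedding: the continuous representative F satisfies
    |F x| <= |F y| + int |g| for y in [x, x + 1]; average over y. *)
Lemma weak_deriv_bounded (f g : R -> R) A B : wd f g ->
  (forall x, \int[mu]_(y in `[x, x + 1]) `|f y| <= A) ->
  (forall x, \int[mu]_(y in `[x, x + 1]) `|g y| <= B) ->
  {ae mu, forall x, `|f x| <= A + B}.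
Proof.
move=> fg fA gB; have [c cE] := weak_deriv_primitive fg; have [[mf _ _] lg _] := fg.
pose F x := c + primitive g x.
have cF : continuous F.
  by move=> x; apply: cvgD; [exact: cvg_cst|exact: primitive_continuous].
suff bF x : `|F x| <= A + B.
  by move/ae_eqP : cE; apply: ae_sub => x ->; exact: bF.
have Fy y : x <= y <= x + 1 -> `|F x| <= `|F y| + B.
  move=> /andP[xy yx1]; have E := primitiveB lg xy.
  have -> : F x = F y - \int[mu]_(z in `[x, y]) g z by rewrite -E /F; ring.
  apply: le_trans (ler_normB _ _) _; rewrite lerD2l.
  have i := locally_integrable_segment x y lg.
  apply: le_trans (le_normr_Rintegral _ i) _ => //.
  apply: le_trans (gB x).
  rewrite -!/(Rintegral _ _ _) /Rintegral fine_le//.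
  - exact: (integrable_fin_num _ (integrable_abse i)).
  - exact: (integrable_fin_num _ (integrable_abse (locally_integrable_segment x (x + 1) lg))).
  - apply: ge0_subset_integral => //.
    + apply/measurable_EFinP; apply: measurableT_comp => //.
      by apply: measurable_funTS; case: lg.
    + by apply: subset_itvl; rewrite bnd_simp.
have mes1 : fine (mu `[x, x + 1]) = 1.
  by rewrite lebesgue_measure_itv/= lte_fin ltrDl ltr01/= addrAC subrr add0r.
have := fA x; rewrite -(lerD2r B); apply: le_trans.
have -> : \int[mu]_(y in `[x, x + 1]) `|f y| = \int[mu]_(y in `[x, x + 1]) `|F y|.
  congr fine; apply: ae_eq_integral => //.
  - by apply/measurable_EFinP; apply: measurableT_comp => //; exact: measurable_funTS.
  - apply/measurable_EFinP; apply: measurableT_comp => //.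
    by apply: measurable_funTS; exact: continuous_measurable_fun.
  - by move/ae_eqP : cE; apply: ae_sub => y /= -> _.
have iF : mu.-integrable `[x, x + 1] (EFin \o (fun y => `|F y|)).
  apply: continuous_integrable_segment => y.
  by apply: (@continuous_comp _ _ _ F Num.norm); [exact: cF|exact: norm_continuous].
have cstE (d : R) : d = \int[mu]_(y in `[x, x + 1]) d by rewrite Rintegral_cst// mes1 mulr1.
rewrite [X in _ <= _ + X]cstE [X in X <= _]cstE -RintegralD//; last first.
  by apply: continuous_integrable_segment => y; exact: cvg_cst.
apply: le_Rintegral => //.
- by apply: continuous_integrable_segment => y; exact: cvg_cst.
- apply: continuous_integrable_segment => y; apply: cvgD; last exact: cvg_cst.
  by apply: (@continuous_comp _ _ _ F Num.norm); [exact: cF|exact: norm_continuous].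
Qed.

(** An elementary substitute for the Hoelder inequality: t <= 1 + t^k, applied to
    t = |f| / n, gives |f| <= n + n (|f| / n)^k. *)
Lemma integral_segment_le (k : nat) f n : (0 < k)%N -> 0 < n ->
  measurable_fun setT f -> L1 (fun x => `|f x| ^+ k) ->
  \int[mu]_x (`|f x| ^+ k) <= n ^+ k ->
  forall x, \int[mu]_(y in `[x, x + 1]) `|f y| <= 2 * n.
Proof.
move=> k0 n0 mf ifk In x.
have young (t : R) : 0 <= t -> t <= n + n / n ^+ k * t ^+ k.
  move=> t0; have [tn|nt] := leP t n.
    rewrite ler_wpDr// mulr_ge0 ?exprn_ge0// divr_ge0 ?exprn_ge0// ltW//.
  rewrite ler_wpDl ?(ltW n0)//.
  have -> : n / n ^+ k * t ^+ k = n * (t / n) ^+ k by rewrite expr_div_n; ring.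
  rewrite mulrC -ler_pdivrMr//.
  rewrite -{1}[t / n]expr1 ler_weXn2l// ler_pdivlMr// mul1r ltW//.
have mes1 : fine (mu `[x, x + 1]) = 1.
  by rewrite lebesgue_measure_itv/= lte_fin ltrDl ltr01/= addrAC subrr add0r.
have iseg : mu.-integrable `[x, x + 1] (EFin \o (fun y => `|f y| ^+ k)).
  exact: (integrableS _ _ _ ifk).
have icst (d : R) : mu.-integrable `[x, x + 1] (EFin \o (fun=> d)).
  by apply: continuous_integrable_segment => y; exact: cvg_cst.
have ibd : mu.-integrable `[x, x + 1]
    (EFin \o (fun y => n + n / n ^+ k * `|f y| ^+ k)).
  have := @integrableZl _ _ _ mu _ (measurable_itv _) (n / n ^+ k) _ iseg.
  by move=> h; have := @integrableD _ _ _ mu _ (measurable_itv _) _ _ (icst n) h.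
apply: (@le_trans _ _ (\int[mu]_(y in `[x, x + 1]) (n + n / n ^+ k * `|f y| ^+ k))).
  apply: le_Rintegral => //; last by move=> y _; exact: young.
  apply: le_integrable ibd => //.
    by apply/measurable_EFinP; apply: measurableT_comp => //; exact: measurable_funTS.
  move=> y _; rewrite /= lee_fin normr_id.
  by apply: le_trans (young _ (normr_ge0 (f y))) _; exact: ler_norm.
rewrite RintegralD//; last first.
  exact: (@integrableZl _ _ _ mu _ (measurable_itv _) (n / n ^+ k) _ iseg).
rewrite Rintegral_cst// mes1 mulr1 RintegralZl// mulr2n mulrDl mul1r lerD2l.
rewrite mulrAC ler_pdivrMr ?exprn_gt0// ler_wpM2l ?(ltW n0)//.
apply: le_trans In; rewrite /Rintegral fine_le//.
- exact: (integrable_fin_num _ iseg).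
- exact: (integrable_fin_num _ ifk).
- apply: ge0_subset_integral => //.
  + by apply/measurable_EFinP; apply: measurable_funX; apply: measurableT_comp.
Qed.

End ComplexNorms.

(** * Second-order expansion of the action *)

Section PointwiseExpansion.
Context {R : realType}.
Implicit Types A B d s T : R.

Lemma cauchy_schwarz2 (a b c e : R) :
  `|a * c + b * e| <= Num.sqrt (a ^+ 2 + b ^+ 2) * Num.sqrt (c ^+ 2 + e ^+ 2).
Proof.
rewrite -sqrtrM ?addr_ge0 ?sqr_ge0// -sqrtr_sqr ler_wsqrtr//.
rewrite -subr_ge0 [leRHS](_ : _ = (a * e - b * c) ^+ 2) ?sqr_ge0//; ring.
Qed.

(** Here and below A, B and d stand for |v|, |v + h| and |h| at a point, and s for
    the real part of the product of v and the conjugate of h. *)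
Lemma triangle_bounds A B d s : 0 <= A -> 0 <= B -> 0 <= d ->
  B ^+ 2 = A ^+ 2 + 2 * s + d ^+ 2 -> `|s| <= A * d ->
  B <= A + d /\ (B - A) ^+ 2 <= d ^+ 2.
Proof.
move=> A0 B0 d0 BE sAd; have /ler_normlP[s1 s2] := sAd.
have BA : `|B - A| <= d.
  rewrite ler_norml; apply/andP; split.
    rewrite lerBrDr addrC; have [Ad|dA] := leP A d.
      by rewrite (le_trans _ B0)// subr_le0.
    rewrite -ler_sqr ?nnegrE ?subr_ge0 ?(ltW dA)// BE; nra.
  by rewrite lerBlDr addrC -ler_sqr ?nnegrE ?addr_ge0// BE; nra.
split; first by have /ler_normlP[_ h] := BA; rewrite -lerBlDl.
by rewrite -real_normK ?num_real// ler_sqr ?nnegrE ?normr_ge0.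
Qed.

(** As a function of B^2, the cube B^3 has at A the tangent (3/2) A B^2 - A^3/2, and
    the difference of the two is (B - A)^2 (B + A/2). *)
Lemma remainder3 A B d s T : 0 <= A -> 0 <= B -> 0 <= d ->
  B ^+ 2 = A ^+ 2 + 2 * s + d ^+ 2 -> `|s| <= A * d -> 1 <= T -> A + d <= T ->
  `|B ^+ 3 - A ^+ 3 - 3 * A * s| <= 10 * T ^+ 2 * (d ^+ 2 * (A + d)).
Proof.
move=> A0 B0 d0 BE sAd T1 AdT; have [BAd BA2] := triangle_bounds A0 B0 d0 BE sAd.
have -> : B ^+ 3 - A ^+ 3 - 3 * A * s =
    (B - A) ^+ 2 * (B + A / 2) + 3 / 2 * A * d ^+ 2.
  have -> : s = (B ^+ 2 - A ^+ 2 - d ^+ 2) / 2 by rewrite BE; field.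
  by field.
have h1 : 0 <= B + A / 2 <= 2 * (A + d) by apply/andP; split; lra.
have h2 : 0 <= (B - A) ^+ 2 * (B + A / 2).
  by rewrite mulr_ge0 ?sqr_ge0//; case/andP: h1.
have h3 : (B - A) ^+ 2 * (B + A / 2) <= d ^+ 2 * (2 * (A + d)).
  by case/andP: h1 => p q; apply: ler_pM => //; exact: sqr_ge0.
have q0 : 0 <= d ^+ 2 * (A + d) by rewrite mulr_ge0 ?sqr_ge0 ?addr_ge0.
have q1 : A * d ^+ 2 <= d ^+ 2 * (A + d) by rewrite mulrC ler_wpM2l ?sqr_ge0// lerDl.
have q2 : 0 <= A * d ^+ 2 by rewrite mulr_ge0 ?sqr_ge0.
have t2 : 1 <= T ^+ 2 by rewrite exprn_ege1.
rewrite ger0_norm; last by lra.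
have := ler_wpM2r q0 t2; lra.
Qed.

Lemma remainder4 A B d s T : 0 <= A -> 0 <= B -> 0 <= d ->
  B ^+ 2 = A ^+ 2 + 2 * s + d ^+ 2 -> `|s| <= A * d -> 1 <= T -> A + d <= T ->
  `|B ^+ 4 - A ^+ 4 - 4 * A ^+ 2 * s| <= 10 * T ^+ 2 * (d ^+ 2 * (A + d)).
Proof.
move=> A0 B0 d0 BE sAd T1 AdT; have [BAd BA2] := triangle_bounds A0 B0 d0 BE sAd.
have -> : B ^+ 4 - A ^+ 4 - 4 * A ^+ 2 * s =
    4 * s ^+ 2 + d ^+ 4 + 2 * A ^+ 2 * d ^+ 2 + 4 * s * d ^+ 2.
  have -> : B ^+ 4 = (B ^+ 2) ^+ 2 by rewrite -exprM.
  by rewrite BE; ring.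
have s2 : s ^+ 2 <= A ^+ 2 * d ^+ 2.
  by rewrite -exprMn -real_normK ?num_real// ler_sqr ?nnegrE ?mulr_ge0.
have s20 := sqr_ge0 s.
have dd := sqr_ge0 d.
have sd : `|s * d ^+ 2| <= A * d * d ^+ 2 by rewrite normrM (ger0_norm dd) ler_wpM2r.
have Ad := addr_ge0 A0 d0.
have P0 : 0 <= d ^+ 2 * (A + d) by rewrite mulr_ge0.
have h : `|4 * s ^+ 2 + d ^+ 4 + 2 * A ^+ 2 * d ^+ 2 + 4 * s * d ^+ 2| <=
    6 * (d ^+ 2 * (A + d)) * (A + d).
  apply: (@le_trans _ _ (6 * A ^+ 2 * d ^+ 2 + d ^+ 4 + 4 * (A * d * d ^+ 2))).
    have /ler_normlP[sd1 sd2] := sd; have d4 : 0 <= d ^+ 4 by rewrite exprn_ge0.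
    have Ad2 : 0 <= A ^+ 2 * d ^+ 2 by rewrite mulr_ge0 ?sqr_ge0.
    by apply/ler_normlP; split; lra.
  rewrite -subr_ge0 (_ : _ - _ = 8 * A * d ^+ 3 + 5 * d ^+ 4); last by ring.
  by rewrite addr_ge0// ?mulr_ge0// ?exprn_ge0.
apply: le_trans h _.
have T2 : T <= T ^+ 2 by rewrite ler_eXnr.
have TT : A + d <= T ^+ 2 by exact: le_trans T2.
have := ler_wpM2l P0 TT; have := mulr_ge0 P0 Ad; lra.
Qed.

(** The analogue of the tangent argument for the cube: B^5 - (5/2) A^3 B^2 + (3/2) A^5
    is divisible by (B - A)^2. *)
Lemma remainder5 A B d s T : 0 <= A -> 0 <= B -> 0 <= d ->
  B ^+ 2 = A ^+ 2 + 2 * s + d ^+ 2 -> `|s| <= A * d -> 1 <= T -> A + d <= T ->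
  `|B ^+ 5 - A ^+ 5 - 5 * A ^+ 3 * s| <= 10 * T ^+ 2 * (d ^+ 2 * (A + d)).
Proof.
move=> A0 B0 d0 BE sAd T1 AdT; have [BAd BA2] := triangle_bounds A0 B0 d0 BE sAd.
have -> : B ^+ 5 - A ^+ 5 - 5 * A ^+ 3 * s =
    (B - A) ^+ 2 * (B ^+ 3 + 2 * A * B ^+ 2 + 3 * A ^+ 2 * B + 3 / 2 * A ^+ 3)
    + 5 / 2 * A ^+ 3 * d ^+ 2.
  have -> : s = (B ^+ 2 - A ^+ 2 - d ^+ 2) / 2 by rewrite BE; field.
  by field.
set Q := B ^+ 3 + _ + _ + _; set S := A + d.
have S0 : 0 <= S by exact: addr_ge0.
have AS : A <= S by rewrite lerDl.
have dd := sqr_ge0 d.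
have Q0 : 0 <= Q by rewrite /Q !addr_ge0// ?mulr_ge0// ?exprn_ge0.
have h3 : B ^+ 3 <= S ^+ 3 by rewrite lerXn2r ?nnegrE.
have h2 : A * B ^+ 2 <= S * S ^+ 2 by rewrite ler_pM ?sqr_ge0// lerXn2r ?nnegrE.
have h1 : A ^+ 2 * B <= S ^+ 2 * S by rewrite ler_pM ?sqr_ge0// lerXn2r ?nnegrE.
have h0 : A ^+ 3 <= S ^+ 3 by rewrite lerXn2r ?nnegrE.
have QS : Q <= 15 / 2 * S ^+ 3.
  rewrite /Q; move: h2 h1; rewrite -exprS -exprSr; lra.
have E1 : (B - A) ^+ 2 * Q <= d ^+ 2 * (15 / 2 * S ^+ 3).
  by apply: ler_pM => //; exact: sqr_ge0.
have E0 : 0 <= (B - A) ^+ 2 * Q by rewrite mulr_ge0 ?sqr_ge0.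
have F1 : A ^+ 3 * d ^+ 2 <= d ^+ 2 * S ^+ 3 by rewrite mulrC ler_wpM2l.
have F0 : 0 <= A ^+ 3 * d ^+ 2 by rewrite mulr_ge0 ?exprn_ge0.
rewrite ger0_norm; last by lra.
have T0 : 0 <= T by exact: le_trans ler01 T1.
have S2 : S ^+ 2 <= T ^+ 2 by rewrite lerXn2r ?nnegrE.
have P0 : 0 <= d ^+ 2 * S by rewrite mulr_ge0.
have := ler_wpM2l P0 S2; lra.
Qed.

Lemma mul_sq_le_cubes (a b : R) : 0 <= a -> 0 <= b -> a * b ^+ 2 <= a ^+ 3 + b ^+ 3.
Proof.
move=> a0 b0; have [ab|ba] := leP a b.
  by rewrite ler_wpDl ?exprn_ge0// [b ^+ 3]exprS ler_wpM2r ?sqr_ge0.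
rewrite ler_wpDr ?exprn_ge0// [a ^+ 3]exprS ler_wpM2l// lerXn2r ?nnegrE//.
exact: ltW.
Qed.

End PointwiseExpansion.

Section Expansion.
Context {R : realType}.
Local Notation mu := (@lebesgue_measure R).
Implicit Types (u v h : R -> R[i]) (f g : R -> R) (x : R).

(** The truncation min(|f|, |g|) is dominated everywhere and agrees with |f| almost
    everywhere. *)
Lemma L1_le_ae f g : measurable_fun setT f -> L1 g ->
  {ae mu, forall x, `|f x| <= g x} ->
  L1 f /\ `|\int[mu]_x f x| <= \int[mu]_x g x.
Proof.
move=> mf ig fg; have mg := L1_measurable ig.
pose m x := Num.min `|f x| `|g x|.
have mm : measurable_fun setT m.
  by apply: measurable_minr; apply: measurableT_comp.
have im : L1 m.
  apply: (L1_le mm (L1_norm ig)) => x; rewrite ger0_norm ?ge_min ?lexx ?orbT//.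
  by rewrite le_min !normr_ge0.
have fm : (fun x => `|f x|) = m %[ae mu].
  apply/ae_eqP; apply: ae_sub fg => x fgx.
  by apply/esym/min_idPl; exact: le_trans (ler_norm _).
have mnf : measurable_fun setT (fun x => `|f x|) by exact: measurableT_comp.
have inf : L1 (fun x => `|f x|).
  apply: (L1_ae_eq mm mnf _ im); apply/ae_eqP.
  by move/ae_eqP : fm; apply: ae_sub => x ->.
have if' : L1 f by apply: (L1_le mf inf).
split=> //; apply: le_trans (norm_integral_le mf inf (fun x => lexx _)) _.
have gn : (fun x => `|g x|) = g %[ae mu].
  apply/ae_eqP; apply: ae_sub fg => x fgx.
  by rewrite ger0_norm// (le_trans _ fgx).
rewrite -(integral_ae_eq _ mg gn); last exact: measurableT_comp.
rewrite (integral_ae_eq mnf mm fm); apply: le_integral_L1 => //.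
  exact: L1_norm.
by move=> x; rewrite ge_min lexx orbT.
Qed.

(** Both hypotheses on the integrals are homogeneous in [n]: small norms give a small
    supremum, which is what the expansion of the action uses. *)
Lemma weak_deriv_sup k u n : (0 < k)%N -> 0 < n ->
  is_weak_deriv u (weak_deriv u) ->
  L1 (fun x => modulus (weak_deriv u) x ^+ 2) -> L1 (fun x => modulus u x ^+ k) ->
  \int[mu]_x (modulus (weak_deriv u) x ^+ 2) <= n ^+ 2 ->
  \int[mu]_x (modulus u x ^+ k) <= n ^+ k ->
  {ae mu, forall x, modulus u x <= 8 * n}.
Proof.
move=> k0 n0 uw iw iu Iw Iu; have [mu' mw] := is_weak_deriv_measurable uw.
have [mru miu] := mu'; have [mrw miw] := mw.
have part (j : nat) (f : R -> R) (v : R -> R[i]) : (0 < j)%N -> measurable_complex v -> measurable_fun setT f ->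
    (forall x, `|f x| <= modulus v x) -> L1 (fun x => modulus v x ^+ j) ->
    \int[mu]_x (modulus v x ^+ j) <= n ^+ j ->
    forall x, \int[mu]_(y in `[x, x + 1]) `|f y| <= 2 * n.
  move=> j0 mv mf fv iv Iv.
  have i1 : L1 (fun x => `|f x| ^+ j).
    apply: (L1_le _ iv).
      by apply: measurable_funX; exact: measurableT_comp.
    by move=> x; rewrite ger0_norm ?exprn_ge0// lerXn2r ?nnegrE ?modulus_ge0.
  apply: (integral_segment_le j0 n0 mf i1); apply: le_trans Iv.
  by apply: le_integral_L1 => // x; rewrite lerXn2r ?nnegrE ?modulus_ge0.
have [w1 w2] := uw.
have b1 := weak_deriv_bounded w1
  (part k _ _ k0 mu' mru (@re_le_modulus _ u) iu Iu)
  (part 2 _ _ isT mw mrw (@re_le_modulus _ _) iw Iw).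
have b2 := weak_deriv_bounded w2
  (part k _ _ k0 mu' miu (@im_le_modulus _ u) iu Iu)
  (part 2 _ _ isT mw miw (@im_le_modulus _ _) iw Iw).
move: b1 b2; apply: ae_sub2 => x x1 x2.
apply: le_trans (modulus_le u x) _.
have -> : 8 * n = (2 * n + 2 * n) + (2 * n + 2 * n) by ring.
exact: lerD x1 x2.
Qed.

Lemma in_X_sup u : in_X u -> exists2 M, 1 <= M & {ae mu, forall x, modulus u x <= M}.
Proof.
move=> /in_XP[uw iw iu].
pose I2 := \int[mu]_x (modulus (weak_deriv u) x ^+ 2).
pose I3 := \int[mu]_x (modulus u x ^+ 3).
have I20 : 0 <= I2 by apply: Rintegral_ge0 => x _; exact: sqr_ge0.
have I30 : 0 <= I3 by apply: Rintegral_ge0 => x _; rewrite exprn_ge0 ?modulus_ge0.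
pose n := 1 + I2 + I3; have n1 : 1 <= n by rewrite /n; lra.
have n0 : 0 < n by exact: lt_le_trans n1.
exists (8 * n); first lra.
apply: (@weak_deriv_sup 3) => //; rewrite -/I2 -/I3.
- by apply: (@le_trans _ _ n); [rewrite /n; lra|rewrite ler_eXnr].
- by apply: (@le_trans _ _ n); [rewrite /n; lra|rewrite ler_eXnr].
Qed.

Lemma in_X_L1 u : in_X u -> L1 (fun x => modulus u x ^+ 4) /\ L1 (fun x => modulus u x ^+ 5).
Proof.
move=> Xu; have [M M1 uM] := in_X_sup Xu; have /in_XP[uw iw iu] := Xu.
have [mu' mw] := is_weak_deriv_measurable uw.
have mm := measurable_modulus mu'.
have h j : L1 (fun x => modulus u x ^+ (3 + j)).
  have [|||i _] := @L1_le_ae (fun x => modulus u x ^+ (3 + j))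
    (fun x => M ^+ j * modulus u x ^+ 3); last exact: i.
  - exact: measurable_funX.
  - exact: L1_Z.
  - apply: ae_sub uM => x ux; rewrite exprD ger0_norm; last first.
      by rewrite mulr_ge0// exprn_ge0// modulus_ge0.
    rewrite mulrC ler_wpM2r ?exprn_ge0 ?modulus_ge0// lerXn2r ?nnegrE ?modulus_ge0//.
    exact: le_trans (modulus_ge0 u x) ux.
by split; [exact: (h 1)|exact: (h 2)].
Qed.

Lemma modulusD2 u v x : modulus (fun x => u x + v x) x ^+ 2 =
  modulus u x ^+ 2 + 2 * (re u x * re v x + im u x * im v x) + modulus v x ^+ 2.
Proof. by rewrite !modulus_sq re_add im_add; ring. Qed.

Lemma inner_le_modulus u v x :
  `|re u x * re v x + im u x * im v x| <= modulus u x * modulus v x.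
Proof. by rewrite /modulus !normcE; exact: cauchy_schwarz2. Qed.

Lemma in_X_D u v : in_X u -> in_X v -> in_X (fun x => u x + v x) /\
  weak_deriv (fun x => u x + v x) = (fun x => weak_deriv u x + weak_deriv v x) %[ae mu].
Proof.
move=> /in_XP[uw iw iu] /in_XP[vw iv' iv].
have [mu' mw] := is_weak_deriv_measurable uw.
have [mv mwv] := is_weak_deriv_measurable vw.
have uvw := is_weak_derivD uw vw; split; last exact: weak_deriv_ae.
apply: (is_weak_deriv_in_X uvw).
  apply: (L1_le _ (L1_D (L1_Z 2 iw) (L1_Z 2 iv'))).
    by apply: measurable_funX; apply: measurable_modulus; exact: measurable_complexD.
  move=> x; rewrite ger0_norm ?sqr_ge0// modulusD2.
  have /ler_normlP[_] := inner_le_modulus (weak_deriv u) (weak_deriv v) x.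
  set a := modulus _ x; set b := modulus _ x; have := sqr_ge0 (a - b).
  rewrite sqrrB; lra.
apply: (L1_le _ (L1_D (L1_Z 8 iu) (L1_Z 8 iv))).
  by apply: measurable_funX; apply: measurable_modulus; exact: measurable_complexD.
move=> x; rewrite ger0_norm ?exprn_ge0 ?modulus_ge0//.
have h : modulus (fun x => u x + v x) x <= modulus u x + modulus v x.
  rewrite -ler_sqr ?nnegrE ?addr_ge0 ?modulus_ge0// modulusD2.
  have /ler_normlP[_] := inner_le_modulus u v x; rewrite sqrrD; lra.
apply: (@le_trans _ _ ((modulus u x + modulus v x) ^+ 3)).
  by rewrite lerXn2r ?nnegrE ?addr_ge0 ?modulus_ge0.
have := modulus_ge0 u x; have := modulus_ge0 v x.
set a := modulus u x; set b := modulus v x => b0 a0.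
have h1 := mul_sq_le_cubes a0 b0; have h2 := mul_sq_le_cubes b0 a0.
have := exprn_ge0 3 a0; have := exprn_ge0 3 b0.
rewrite (_ : (a + b) ^+ 3 = a ^+ 3 + b ^+ 3 + 3 * (a * b ^+ 2) + 3 * (b * a ^+ 2)); last by ring.
lra.
Qed.

End Expansion.

Section FirstVariation.
Context {R : realType}.
Local Notation mu := (@lebesgue_measure R).
Implicit Types (u v h : R -> R[i]) (x : R).

Definition nonlin (a1 a2 a3 r : R) : R := a1 * r + a2 * r ^+ 2 + a3 * r ^+ 3.

Definition inner (u v : R -> R[i]) (x : R) : R := re u x * re v x + im u x * im v x.

(** The candidate for S'(v) h, the complex functions being a real vector space. *)
Definition first_variation (a1 a2 a3 : R) v h : R :=
  \int[mu]_x inner (weak_deriv v) (weak_deriv h) x -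
  \int[mu]_x (nonlin a1 a2 a3 (modulus v x) * inner v h x).

Lemma measurable_inner u v : measurable_complex u -> measurable_complex v ->
  measurable_fun setT (inner u v).
Proof.
by move=> [ru iu] [rv iv]; apply: measurable_funD; exact: measurable_funM.
Qed.

Lemma L1_inner u v : measurable_complex u -> measurable_complex v ->
  L1 (fun x => modulus u x ^+ 2) -> L1 (fun x => modulus v x ^+ 2) ->
  L1 (inner u v).
Proof.
move=> mu' mv iu iv; apply: (L1_le _ (L1_D iu iv)); first exact: measurable_inner.
move=> x; apply: le_trans (inner_le_modulus u v x) _.
set a := modulus u x; set b := modulus v x.
have := sqr_ge0 (a - b); have := sqr_ge0 a; have := sqr_ge0 b.
rewrite sqrrB; lra.
Qed.

Lemma nonlin_bound a1 a2 a3 (r T : R) : 0 <= r -> r <= T -> 1 <= T ->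
  `|nonlin a1 a2 a3 r| <= (`|a1| + `|a2| + `|a3|) * T ^+ 2 * r.
Proof.
move=> r0 rT T1; have T0 : 0 <= T by exact: le_trans T1.
have t2 : 1 <= T ^+ 2 by rewrite exprn_ege1.
have r2 : r ^+ 2 <= T ^+ 2 by rewrite lerXn2r ?nnegrE.
have rT2 : r <= T ^+ 2 by apply: le_trans rT _; rewrite ler_eXnr.
rewrite /nonlin (_ : a1 * r + _ + _ = (a1 + a2 * r + a3 * r ^+ 2) * r); last by ring.
rewrite normrM (ger0_norm r0) ler_wpM2r// !mulrDl.
apply: le_trans (ler_normD _ _) _; apply: lerD; last first.
  by rewrite normrM (ger0_norm (sqr_ge0 _)) ler_wpM2l.
apply: le_trans (ler_normD _ _) _; apply: lerD; first by rewrite ler_peMr.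
by rewrite normrM (ger0_norm r0) ler_wpM2l.
Qed.

Lemma L1_nonlin_inner a1 a2 a3 v h : in_X v -> in_X h ->
  L1 (fun x => nonlin a1 a2 a3 (modulus v x) * inner v h x).
Proof.
move=> Xv Xh; have [M M1 vM] := in_X_sup Xv.
have /in_XP[vw _ iv] := Xv; have /in_XP[hw _ ih] := Xh.
have [mv _] := is_weak_deriv_measurable vw; have [mh _] := is_weak_deriv_measurable hw.
have mm := measurable_modulus mv.
pose K := (`|a1| + `|a2| + `|a3|) * M ^+ 2.
have K0 : 0 <= K by rewrite mulr_ge0 ?sqr_ge0// !addr_ge0.
have [|||i _] := @L1_le_ae R (fun x => nonlin a1 a2 a3 (modulus v x) * inner v h x)
  (fun x => K * (modulus h x ^+ 3 + modulus v x ^+ 3)); last exact: i.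
- apply: measurable_funM; last exact: measurable_inner.
  apply: measurable_funD; last by apply: measurable_funM => //; exact: measurable_funX.
  by apply: measurable_funD; apply: measurable_funM => //; exact: measurable_funX.
- by apply: L1_Z; exact: L1_D.
apply: ae_sub vM => x vx; rewrite normrM.
have v0 := modulus_ge0 v x; have h0 := modulus_ge0 h x.
apply: (@le_trans _ _ ((K * modulus v x) * (modulus v x * modulus h x))).
  by apply: ler_pM => //; [exact: nonlin_bound|exact: inner_le_modulus].
rewrite (_ : _ * _ * _ = K * (modulus h x * modulus v x ^+ 2)); last by ring.
by rewrite ler_wpM2l// mul_sq_le_cubes.
Qed.

Lemma X_norm_le u n : in_X u -> 0 < n -> X_norm u <= n ->
  \int[mu]_x (modulus (weak_deriv u) x ^+ 2) <= n ^+ 2 /\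
  \int[mu]_x (modulus u x ^+ 3) <= n ^+ 3.
Proof.
move=> Xu n0; rewrite /X_norm => un.
have p2 := Lp_norm_ge0 2 (weak_deriv u); have p3 := Lp_norm_ge0 3 u.
rewrite -(@Lp_normX R 2)// -(@Lp_normX R 3)//.
by split; rewrite lerXn2r ?nnegrE ?(ltW n0)// (le_trans _ un)// ?lerDl ?lerDr.
Qed.

(** The pointwise remainders are at most a constant times |h|^2 (|v| + |h|), whose
    integral is of second order in the norm of h, because v and h are bounded.
    Bounding the norm of h by an auxiliary n > 0 allows divisions by n. *)
Lemma action_expansion a1 a2 a3 v : in_X v -> exists2 C : R, 0 <= C &
  forall h n, in_X h -> 0 < n -> n <= 1 -> X_norm h <= n ->
  `|action a1 a2 a3 (fun x => v x + h x) - action a1 a2 a3 v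
    - first_variation a1 a2 a3 v h| <= C * n ^+ 2.
Proof.
move=> Xv; have [M M1 vM] := in_X_sup Xv.
have /in_XP[vw i2v i3v] := Xv; have [mv mv1] := is_weak_deriv_measurable vw.
have [i4v i5v] := in_X_L1 Xv.
pose T := M + 8; have T1 : 1 <= T by rewrite /T; lra.
pose K := (`|a1| + `|a2| + `|a3|) * (10 * T ^+ 2).
have K0 : 0 <= K.
  by apply: mulr_ge0; [rewrite !addr_ge0|rewrite mulr_ge0// sqr_ge0].
pose I3 := \int[mu]_x (modulus v x ^+ 3).
have I30 : 0 <= I3 by apply: Rintegral_ge0 => x _; rewrite exprn_ge0 ?modulus_ge0.
exists (2^-1 + K * (I3 + 2)); first by rewrite addr_ge0// mulr_ge0// addr_ge0.
move=> h n Xh n0 n1 hn; have [I2h I3h] := X_norm_le Xh n0 hn.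
have /in_XP[hw i2h i3h] := Xh; have [mh mh1] := is_weak_deriv_measurable hw.
have hM := weak_deriv_sup (isT : (0 < 3)%N) n0 hw i2h i3h I2h I3h.
set w := fun x => v x + h x; have [Xw wE] := in_X_D Xv Xh.
have /in_XP[ww i2w i3w] := Xw; have [mw mw1] := is_weak_deriv_measurable ww.
have [i4w i5w] := in_X_L1 Xw.
pose g x := weak_deriv v x + weak_deriv h x.
have vhg : is_weak_deriv w g by exact: is_weak_derivD.
have [_ mg] := is_weak_deriv_measurable vhg.
have i2g : L1 (fun x => modulus g x ^+ 2) by exact: (L1_modulus_ae_eq mw1 mg wE i2w).
have iin := L1_inner mv1 mh1 i2v i2h.
have inl := L1_nonlin_inner a1 a2 a3 Xv Xh.
pose D3 x := modulus w x ^+ 3 - modulus v x ^+ 3 - 3 * modulus v x * inner v h x.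
pose D4 x := modulus w x ^+ 4 - modulus v x ^+ 4 - 4 * modulus v x ^+ 2 * inner v h x.
pose D5 x := modulus w x ^+ 5 - modulus v x ^+ 5 - 5 * modulus v x ^+ 3 * inner v h x.
pose D x := a1 / 3 * D3 x + a2 / 4 * D4 x + a3 / 5 * D5 x.
have DE : action a1 a2 a3 w - action a1 a2 a3 v - first_variation a1 a2 a3 v h =
    2^-1 * \int[mu]_x (modulus (weak_deriv h) x ^+ 2) - \int[mu]_x D x.
  have -> : \int[mu]_x D x = a1 / 3 * \int[mu]_x (modulus w x ^+ 3) + a2 / 4 * \int[mu]_x (modulus w x ^+ 4)
     + a3 / 5 * \int[mu]_x (modulus w x ^+ 5)
     - (a1 / 3 * \int[mu]_x (modulus v x ^+ 3) + a2 / 4 * \int[mu]_x (modulus v x ^+ 4)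
     + a3 / 5 * \int[mu]_x (modulus v x ^+ 5))
     - \int[mu]_x (nonlin a1 a2 a3 (modulus v x) * inner v h x).
    have jw : L1 (fun x => a1 / 3 * modulus w x ^+ 3 + a2 / 4 * modulus w x ^+ 4 + a3 / 5 * modulus w x ^+ 5).
      by apply: L1_D; [apply: L1_D|]; exact: L1_Z.
    have jv : L1 (fun x => a1 / 3 * modulus v x ^+ 3 + a2 / 4 * modulus v x ^+ 4 + a3 / 5 * modulus v x ^+ 5).
      by apply: L1_D; [apply: L1_D|]; exact: L1_Z.
    rewrite -!integralZ_L1// -!integralD_L1//; try exact: L1_Z; try (apply: L1_D; exact: L1_Z).
    rewrite -!integralB_L1//; last exact: L1_B.
    by apply: eq_Rintegral => x _; rewrite /D /D3 /D4 /D5 /nonlin; field.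
  rewrite !actionE /first_variation.
  rewrite (integral_modulus_ae_eq 2 mw1 mg wE).
  have -> : \int[mu]_x (modulus g x ^+ 2) = \int[mu]_x (modulus (weak_deriv v) x ^+ 2)
     + 2 * \int[mu]_x inner (weak_deriv v) (weak_deriv h) x + \int[mu]_x (modulus (weak_deriv h) x ^+ 2).
    have j2 := L1_Z 2 iin.
    rewrite -integralZ_L1// -!integralD_L1//; last exact: L1_D.
    by apply: eq_Rintegral => x _; rewrite modulusD2.
  have alg (V I H p3 p4 p5 q3 q4 q5 N : R) :
      2^-1 * (V + 2 * I + H) - a1 / 3 * p3 - a2 / 4 * p4 - a3 / 5 * p5
      - (2^-1 * V - a1 / 3 * q3 - a2 / 4 * q4 - a3 / 5 * q5) - (I - N) =
      2^-1 * H - (a1 / 3 * p3 + a2 / 4 * p4 + a3 / 5 * p5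
        - (a1 / 3 * q3 + a2 / 4 * q4 + a3 / 5 * q5) - N) by field.
  exact: alg.
have mmv := measurable_modulus mv; have mmw := measurable_modulus mw.
have mmh := measurable_modulus mh; have min := measurable_inner mv mh.
have mX (f : R -> R) k : measurable_fun setT f -> measurable_fun setT (fun x => f x ^+ k).
  by move=> mf; exact: measurable_funX.
have mD : measurable_fun setT D.
  have mDk k : measurable_fun setT (fun x => modulus w x ^+ k.+2 - modulus v x ^+ k.+2 -
      (k.+2)%:R * modulus v x ^+ k * inner v h x).
    apply: measurable_funB; first by apply: measurable_funB; exact: mX.
    by apply: measurable_funM => //; apply: measurable_funM => //; exact: mX.
  have m3 : measurable_fun setT D3 by exact: (mDk 1%N).
  apply: measurable_funD; [apply: measurable_funD|].
  - exact: measurable_funM.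
  - by apply: measurable_funM => //; exact: (mDk 2).
  - by apply: measurable_funM => //; exact: (mDk 3).
have bD : {ae mu, forall x, `|D x| <= K * (n ^+ 2 * modulus v x ^+ 3 + (n^-1 + 1) * modulus h x ^+ 3)}.
  move: vM hM; apply: ae_sub2 => x vx hx.
  have v0 := modulus_ge0 v x; have h0 := modulus_ge0 h x; have w0 := modulus_ge0 w x.
  have wE2 : modulus w x ^+ 2 = modulus v x ^+ 2 + 2 * inner v h x + modulus h x ^+ 2.
    exact: modulusD2.
  have sle := inner_le_modulus v h x.
  have vhT : modulus v x + modulus h x <= T by rewrite /T; lra.
  have r3 := remainder3 v0 w0 h0 wE2 sle T1 vhT.
  have r4 := remainder4 v0 w0 h0 wE2 sle T1 vhT.
  have r5 := remainder5 v0 w0 h0 wE2 sle T1 vhT.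
  set q := 10 * T ^+ 2 * _ in r3 r4 r5.
  have q0 : 0 <= q by exact: le_trans r3.
  have cf (a c : R) (E : R) : 1 <= c -> `|E| <= q -> `|a / c * E| <= `|a| * q.
    move=> c1 Eq; rewrite normrM ler_pM// normrM ler_piMr//.
    by rewrite ger0_norm ?invr_ge0 ?invf_le1// ?(lt_le_trans ltr01)// (le_trans ler01).
  have Dq : `|D x| <= (`|a1| + `|a2| + `|a3|) * q.
    rewrite !mulrDl /D; apply: le_trans (ler_normD _ _) _; apply: lerD.
      apply: le_trans (ler_normD _ _) _.
      by apply: lerD; apply: cf; rewrite ?ler1n.
    by apply: cf; rewrite ?ler1n.
  apply: le_trans Dq _; rewrite /q mulrA -/K ler_wpM2l//.
  (* |v| |h|^2 = n^2 |v| (|h| / n)^2, where |h| / n has an L^3 norm of at most 1 *)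
  have := mul_sq_le_cubes v0 (divr_ge0 h0 (ltW n0)).
  rewrite !expr_div_n => hh.
  have := ler_wpM2l (sqr_ge0 n) hh.
  rewrite mulrA (_ : n ^+ 2 * modulus v x * _ = modulus v x * modulus h x ^+ 2); last by field; rewrite gt_eqF.
  rewrite mulrDr (_ : n ^+ 2 * (modulus h x ^+ 3 / n ^+ 3) = n^-1 * modulus h x ^+ 3); last by field; rewrite gt_eqF.
  lra.
have iB : L1 (fun x => K * (n ^+ 2 * modulus v x ^+ 3 + (n^-1 + 1) * modulus h x ^+ 3)).
  by apply: L1_Z; apply: L1_D; exact: L1_Z.
have [_ ID] := L1_le_ae mD iB bD.
have IB : \int[mu]_x (K * (n ^+ 2 * modulus v x ^+ 3 + (n^-1 + 1) * modulus h x ^+ 3))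
    <= K * (I3 + 2) * n ^+ 2.
  rewrite integralZ_L1; last by apply: L1_D; exact: L1_Z.
  rewrite -mulrA ler_wpM2l// integralD_L1 ?integralZ_L1//; try exact: L1_Z.
  rewrite -/I3; have nn : (n^-1 + 1) * \int[mu]_x (modulus h x ^+ 3) <= (n^-1 + 1) * n ^+ 3.
    by rewrite ler_wpM2l// addr_ge0 ?invr_ge0 ?ltW.
  have nE : (n^-1 + 1) * n ^+ 3 = n ^+ 2 + n ^+ 3 by field; rewrite gt_eqF.
  have n32 : n ^+ 3 <= n ^+ 2 by rewrite exprS ler_piMl ?sqr_ge0.
  rewrite nE in nn; lra.
rewrite DE; apply: le_trans (ler_normB _ _) _; rewrite mulrDl; apply: lerD.
  rewrite normrM ger0_norm ?invr_ge0// ler_wpM2l ?invr_ge0//.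
  by rewrite ger0_norm// Rintegral_ge0// => x _; exact: sqr_ge0.
exact: le_trans IB.
Qed.

End FirstVariation.

(** * Critical points of the action are the solutions of the equation *)

Section CriticalPoints.
Context {R : realType}.
Local Notation mu := (@lebesgue_measure R).
Implicit Types (u v h : R -> R[i]) (psi : R -> R) (x : R).

(** Serves for perturbations of norm zero, where one cannot divide by the norm. *)
Lemma eq0_of_quadratic_bound (y C : R) : 0 <= C ->
  (forall n, 0 < n -> n <= 1 -> `|y| <= C * n ^+ 2) -> y = 0.
Proof.
move=> C0 h; apply/eqP; rewrite -normr_le0; apply/ler_addgt0Pl => e e0.
rewrite addr0; pose n := Num.min 1 (e / (C + 1)).
have C1 : 0 < C + 1 by lra.
have n0 : 0 < n by rewrite lt_min ltr01 divr_gt0.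
have n1 : n <= 1 by rewrite ge_min lexx.
apply: le_trans (h n n0 n1) _.
have nC : n * (C + 1) <= e by rewrite -ler_pdivlMr// ge_min lexx orbT.
have nn : n ^+ 2 <= n by rewrite expr2 ler_piMl// ltW.
have := ler_wpM2l C0 nn; nra.
Qed.

Lemma first_variation_critical a1 a2 a3 v : in_X v ->
  (forall h, in_X h -> first_variation a1 a2 a3 v h = 0) ->
  is_critical_point a1 a2 a3 v.
Proof.
move=> Xv v0 eps eps0; have [C C0 hC] := action_expansion a1 a2 a3 Xv.
have C1 : 0 < C + 1 by lra.
exists (Num.min 1 (eps / (C + 1))); first by rewrite lt_min ltr01 divr_gt0.
move=> h Xh; rewrite lt_min => /andP[h1 he].
have hC' n : 0 < n -> n <= 1 -> X_norm h <= n ->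
    `|action a1 a2 a3 (fun x => v x + h x) - action a1 a2 a3 v| <= C * n ^+ 2.
  by move=> n0 n1 hn; have := hC h n Xh n0 n1 hn; rewrite v0// subr0.
have hn0 : 0 <= X_norm h by rewrite addr_ge0 ?Lp_norm_ge0.
move: hn0; rewrite le_eqVlt => /predU1P[h0|h0]; last first.
  apply: le_trans (hC' _ h0 (ltW h1) (lexx _)) _.
  rewrite expr2 mulrA ler_wpM2r ?(ltW h0)//.
  rewrite (le_trans _ (_ : (X_norm h) * (C + 1) <= _))//.
    by rewrite mulrC ler_wpM2l ?(ltW h0)//; lra.
  by rewrite -ler_pdivlMr// ltW.
rewrite -h0 mulr0 normr_le0; apply/eqP.
by apply: (@eq0_of_quadratic_bound _ C) => // n n0 n1; apply: hC' => //; rewrite -h0 ltW.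
Qed.

(** Test functions times a unit complex number al + i be: the units 1 and i give the
    real and the imaginary part of the equation, and the scalar t tends to 0. *)
Let dir (al be t : R) (psi : R -> R) : R -> R[i] :=
  fun x => ((t * al * psi x) +i* (t * be * psi x))%C.

Let dir_weak_deriv al be t psi : test_function psi ->
  is_weak_deriv (dir al be t psi) (dir al be t (derive1 psi)).
Proof.
move=> tpsi; have sp := test_function_smooth tpsi.
have h : is_weak_deriv_real psi (derive1 psi).
  apply: has_deriv_weak_deriv; first exact: smooth_has_deriv.
  by apply: smooth_continuous; exact: smooth_derive1.
by split; exact: (weak_derivZ _ h).
Qed.

Let dir_modulus al be t psi x : al ^+ 2 + be ^+ 2 = 1 ->
  modulus (dir al be t psi) x = `|t| * `|psi x|.
Proof.
move=> ab; rewrite /modulus /= -(@sqrtr_sqr _ t) -(@sqrtr_sqr _ (psi x)) -sqrtrM ?sqr_ge0//.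
congr Num.sqrt; rewrite -[RHS]mulr1 -ab; ring.
Qed.

Lemma test_L1 k psi : test_function psi -> L1 (fun x => `|psi x| ^+ k.+1).
Proof.
move=> tpsi; have sp := test_function_smooth tpsi.
have [M [m1 m2]] := test_function_support tpsi.
apply: (@continuous_L1 _ _ (- M) M).
- have cn : continuous (fun x => `|psi x|).
    move=> x; apply: (@continuous_comp _ _ _ psi Num.norm).
      exact: (smooth_continuous sp).
    exact: norm_continuous.
  elim: (k.+1) => [|j IHj] x; first by under eq_fun do rewrite expr0; exact: cvg_cst.
  by under eq_fun do rewrite exprS; apply: cvgM; [exact: cn|exact: IHj].
- by move=> x xM; rewrite m1// normr0 expr0n.
- by move=> x xM; rewrite m2// normr0 expr0n.
Qed.

Lemma derive1_test_function psi : test_function psi -> test_function (derive1 psi).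
Proof.
move=> tpsi; have sp := test_function_smooth tpsi.
have [M [m1 m2]] := test_function_support tpsi.
apply: (@smooth_test_function _ _ (- M) M); first exact: smooth_derive1.
- exact: (derive1_out (smooth_has_deriv sp) m1).
- exact: (derive1_out_r (smooth_has_deriv sp) m2).
Qed.

Let dir_X al be t psi : al ^+ 2 + be ^+ 2 = 1 -> test_function psi ->
  in_X (dir al be t psi).
Proof.
move=> ab tpsi; apply: (is_weak_deriv_in_X (dir_weak_deriv al be t tpsi)).
  have := L1_Z (`|t| ^+ 2) (test_L1 1 (derive1_test_function tpsi)).
  by congr L1; apply/funext => x; rewrite dir_modulus// exprMn.
have := L1_Z (`|t| ^+ 3) (test_L1 2 tpsi).
by congr L1; apply/funext => x; rewrite dir_modulus// exprMn.
Qed.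

Let dir_X_norm al be psi : al ^+ 2 + be ^+ 2 = 1 -> test_function psi ->
  exists2 N, 0 < N & forall t, X_norm (dir al be t psi) <= `|t| * N.
Proof.
move=> ab tpsi.
pose I2 := \int[mu]_x (`|derive1 psi x| ^+ 2); pose I3 := \int[mu]_x (`|psi x| ^+ 3).
have I20 : 0 <= I2 by apply: Rintegral_ge0 => x _; exact: sqr_ge0.
have I30 : 0 <= I3 by apply: Rintegral_ge0 => x _; exact: exprn_ge0.
pose n := 1 + I2 + I3; have n1 : 1 <= n by rewrite /n; lra.
have n0 : 0 <= n by exact: le_trans n1.
exists (2 * n); first by lra.
move=> t; have tn : 0 <= `|t| * n by exact: mulr_ge0.
have h2 : Lp_norm 2 (weak_deriv (dir al be t psi)) <= `|t| * n.
  rewrite -(@ler_pXn2r _ 2)// ?nnegrE ?Lp_norm_ge0// (@Lp_normX R 2)//.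
  have i2 : L1 (fun x => modulus (dir al be t (derive1 psi)) x ^+ 2).
    have := L1_Z (`|t| ^+ 2) (test_L1 1 (derive1_test_function tpsi)).
    by congr L1; apply/funext => x; rewrite dir_modulus// exprMn.
  rewrite (weak_deriv_modulus (dir_weak_deriv al be t tpsi) i2).2.
  under eq_Rintegral do rewrite dir_modulus// exprMn.
  rewrite integralZ_L1; last exact: (test_L1 1 (derive1_test_function tpsi)).
  rewrite exprMn ler_wpM2l ?sqr_ge0// -/I2.
  by apply: (@le_trans _ _ n); [rewrite /n; lra|rewrite ler_eXnr].
have h3 : Lp_norm 3 (dir al be t psi) <= `|t| * n.
  rewrite -(@ler_pXn2r _ 3)// ?nnegrE ?Lp_norm_ge0// (@Lp_normX R 3)//.
  under eq_Rintegral do rewrite dir_modulus// exprMn.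
  rewrite integralZ_L1; last exact: (test_L1 2 tpsi).
  rewrite exprMn ler_wpM2l ?exprn_ge0// -/I3.
  by apply: (@le_trans _ _ n); [rewrite /n; lra|rewrite ler_eXnr].
rewrite /X_norm; lra.
Qed.

Lemma solutionE a1 a2 a3 u : is_solution a1 a2 a3 u <->
  is_weak_deriv_real (re (weak_deriv u)) (fun x => - (nonlin a1 a2 a3 (modulus u x) * re u x)) /\
  is_weak_deriv_real (im (weak_deriv u)) (fun x => - (nonlin a1 a2 a3 (modulus u x) * im u x)).
Proof.
rewrite /is_solution /is_weak_deriv.
pose F x := - (((nonlin a1 a2 a3 (modulus u x))%:C)%C * u x).
rewrite -/(F : R -> R[i]) -/(re F) -/(im F).
have -> : re F = fun x => - (nonlin a1 a2 a3 (modulus u x) * re u x).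
  apply/funext => x; rewrite /re /F /=.
  by case: (u x) => p q /=; rewrite mul0r subr0.
have -> : im F = fun x => - (nonlin a1 a2 a3 (modulus u x) * im u x).
  apply/funext => x; rewrite /im /F /=.
  by case: (u x) => p q /=; rewrite mul0r addr0.
by [].
Qed.

Lemma nonlin_locally_integrable a1 a2 a3 u (f : R -> R) : in_X u ->
  measurable_fun setT f -> (forall x, `|f x| <= modulus u x) ->
  locally_integrable setT (fun x => nonlin a1 a2 a3 (modulus u x) * f x).
Proof.
move=> Xu mf fu; have [M M1 uM] := in_X_sup Xu.
have /in_XP[uw _ iu] := Xu; have [mu' _] := is_weak_deriv_measurable uw.
have mm := measurable_modulus mu'.
have mF : measurable_fun setT (fun x => nonlin a1 a2 a3 (modulus u x) * f x).
  apply: measurable_funM => //.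
  apply: measurable_funD; last by apply: measurable_funM => //; exact: measurable_funX.
  by apply: measurable_funD; apply: measurable_funM => //; exact: measurable_funX.
apply: locally_integrableP => // a b; apply/integrable_segment_restrict.
pose K := (`|a1| + `|a2| + `|a3|) * M ^+ 2.
have K0 : 0 <= K by rewrite mulr_ge0 ?sqr_ge0// !addr_ge0.
have icst : L1 ((fun=> 1 : R) \_ `[a, b]).
  apply/integrable_segment_restrict; apply: continuous_integrable_segment.
  by move=> x; exact: cvg_cst.
have [|||i _] := @L1_le_ae R ((fun x => nonlin a1 a2 a3 (modulus u x) * f x) \_ `[a, b])
    (fun x => K * (((fun=> 1 : R) \_ `[a, b]) x + modulus u x ^+ 3)); last exact: i.
- by apply/(measurable_restrictT _ _).1 => //; exact: measurable_funTS.
- by apply: L1_Z; exact: L1_D.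
apply: ae_sub uM => x ux; have u0 := modulus_ge0 u x.
rewrite !patchE; case: ifPn => _; last by rewrite normr0 mulr_ge0// addr_ge0// exprn_ge0.
rewrite normrM; apply: (@le_trans _ _ ((K * modulus u x) * modulus u x)).
  by apply: ler_pM => //; exact: nonlin_bound.
rewrite -mulrA ler_wpM2l// -expr2.
have [u1|/ltW u1] := leP (modulus u x) 1.
  by rewrite ler_wpDr ?exprn_ge0// exprn_ile1.
by rewrite ler_wpDl// ler_weXn2l.
Qed.

(** The first variation is linear in t along a ray, while criticality and the
    second-order expansion bound it by o(t). *)
Lemma critical_point_test a1 a2 a3 v al be psi : in_X v -> is_critical_point a1 a2 a3 v ->
  al ^+ 2 + be ^+ 2 = 1 -> test_function psi ->
  first_variation a1 a2 a3 v (dir al be 1 psi) = 0.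
Proof.
move=> Xv crit ab tpsi; have [C C0 hC] := action_expansion a1 a2 a3 Xv.
have [N N0 hN] := dir_X_norm ab tpsi.
have /in_XP[vw i2v _] := Xv; have [mv mv1] := is_weak_deriv_measurable vw.
have linear t : first_variation a1 a2 a3 v (dir al be t psi) =
    t * first_variation a1 a2 a3 v (dir al be 1 psi).
  have innerE s : inner (weak_deriv v) (weak_deriv (dir al be s psi)) =
      inner (weak_deriv v) (dir al be s (derive1 psi)) %[ae mu].
    apply/ae_eqP; have /ae_eqP := weak_deriv_ae (dir_weak_deriv al be s tpsi).
    by apply: ae_sub => x; rewrite /inner /re /im /= => ->.
  have mwd s : measurable_complex (weak_deriv (dir al be s psi)).
    have /in_XP[w _ _] := dir_X s ab tpsi.
    exact: (is_weak_deriv_measurable w).2.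
  have md s : measurable_complex (dir al be s (derive1 psi)).
    exact: (is_weak_deriv_measurable (dir_weak_deriv al be s tpsi)).2.
  rewrite /first_variation !(integral_ae_eq _ _ (innerE _)); try exact: measurable_inner.
  have i1 : L1 (inner (weak_deriv v) (dir al be 1 (derive1 psi))).
    apply: L1_inner => //.
    have := L1_Z (`|1| ^+ 2) (test_L1 1 (derive1_test_function tpsi)).
    by congr L1; apply/funext => x; rewrite dir_modulus// exprMn.
  have i2 := L1_nonlin_inner a1 a2 a3 Xv (dir_X 1 ab tpsi).
  rewrite mulrBr -!integralZ_L1//; congr (_ - _); apply: eq_Rintegral => x _.
    by rewrite /inner /dir /re /im/=; ring.
  by rewrite /inner /dir /re /im/=; ring.
set l := first_variation a1 a2 a3 v _ in linear *.
apply/eqP; rewrite -normr_le0; apply/ler_addgt0Pl => e e0; rewrite addr0.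
have e'0 : 0 < e / (2 * N) by rewrite divr_gt0// mulr_gt0.
have [delta d0 hd] := crit _ e'0.
pose t := Num.min (Num.min (N^-1) (delta / (2 * N))) (e / (2 * (C + 1) * N ^+ 2)).
have C1 : 0 < C + 1 by lra.
have t0 : 0 < t.
  rewrite !lt_min invr_gt0 N0 /=; apply/andP; split.
    by apply: divr_gt0 => //; exact: mulr_gt0.
  by apply: divr_gt0 => //; rewrite mulr_gt0 ?exprn_gt0// mulr_gt0.
have tN1 : t * N <= 1 by rewrite -ler_pdivlMr// div1r !ge_min lexx.
have tNd : t * N < delta.
  apply: (@le_lt_trans _ _ (delta / 2)); last by rewrite gtr_pMr// invf_lt1// ltr1n.
  by rewrite -ler_pdivlMr// -mulrA -invfM !ge_min lexx orbT.
have tNe : t * (2 * (C + 1) * N ^+ 2) <= e.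
  by rewrite -ler_pdivlMr ?ge_min ?lexx ?orbT// mulr_gt0 ?exprn_gt0// mulr_gt0.
have tN0 : 0 < t * N by exact: mulr_gt0.
have := hN t; rewrite gtr0_norm// => hNt.
have Xd := dir_X t ab tpsi.
have h1 := hd _ Xd (le_lt_trans hNt tNd).
have h2 := hC _ _ Xd tN0 tN1 hNt.
move: h1 h2; rewrite linear; set J := action _ _ _ _ - _ => h1 h2.
have h3 : `|t * l| <= e / (2 * N) * (t * N) + C * (t * N) ^+ 2.
  have -> : t * l = J - (J - t * l) by ring.
  apply: le_trans (ler_normB _ _) (lerD _ h2); apply: le_trans h1 _.
  by rewrite ler_wpM2l// ltW.
rewrite normrM gtr0_norm// in h3.
have E1 : e / (2 * N) * (t * N) = t * (e / 2) by field; rewrite gt_eqF.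
have tl : t * `|l| <= t * (e / 2 + C * t * N ^+ 2).
  by apply: le_trans h3 _; rewrite E1 mulrDr lerD2l; nra.
rewrite ler_pM2l// in tl; apply: le_trans tl _.
have tN2 : 0 <= t * N ^+ 2 by rewrite mulr_ge0 ?sqr_ge0// ltW.
nra.
Qed.

Lemma critical_point_solution a1 a2 a3 v : in_X v ->
  is_critical_point a1 a2 a3 v -> is_solution a1 a2 a3 v.
Proof.
move=> Xv crit; have /in_XP[vw i2v _] := Xv.
have [mv mv1] := is_weak_deriv_measurable vw; have [mrv miv] := mv.
have lF (f : R -> R) : measurable_fun setT f -> (forall x, `|f x| <= modulus v x) ->
    locally_integrable setT (fun x => - (nonlin a1 a2 a3 (modulus v x) * f x)).
  by move=> mf fv; apply: locally_integrableN; exact: nonlin_locally_integrable.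
have test al be psi : al ^+ 2 + be ^+ 2 = 1 -> test_function psi ->
    \int[mu]_x inner (weak_deriv v) (dir al be 1 (derive1 psi)) x =
    \int[mu]_x (nonlin a1 a2 a3 (modulus v x) * inner v (dir al be 1 psi) x).
  move=> ab tpsi; have /eqP := critical_point_test Xv crit ab tpsi.
  rewrite /first_variation subr_eq0 => /eqP <-; apply: integral_ae_eq.
  - apply: measurable_inner => //.
    exact: (is_weak_deriv_measurable (dir_weak_deriv al be 1 tpsi)).2.
  - apply: measurable_inner => //; have /in_XP[w _ _] := dir_X 1 ab tpsi.
    exact: (is_weak_deriv_measurable w).2.
  - apply/ae_eqP; have /ae_eqP := weak_deriv_ae (dir_weak_deriv al be 1 tpsi).
    by apply: ae_sub => x; rewrite /inner /re /im /= => ->.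
apply/solutionE; split; split.
- by have [[_ ? _] _] := vw.
- exact: (lF _ mrv (@re_le_modulus _ v)).
- move=> psi tpsi; have ab : (1 : R) ^+ 2 + 0 ^+ 2 = 1 by ring.
  have [i _] := locally_integrable_test (lF _ mrv (@re_le_modulus _ v)) tpsi.
  rewrite -integralN_L1//; have := test 1 0 psi ab tpsi.
  rewrite /inner /dir /re /im /=; under eq_Rintegral do rewrite !mulr1 !mulr0 !mul0r !mul1r mulr0 addr0.
  move=> ->; apply: eq_Rintegral => x _; ring.
- by have [_ [_ ? _]] := vw.
- exact: (lF _ miv (@im_le_modulus _ v)).
- move=> psi tpsi; have ab : (0 : R) ^+ 2 + 1 ^+ 2 = 1 by ring.
  have [i _] := locally_integrable_test (lF _ miv (@im_le_modulus _ v)) tpsi.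
  rewrite -integralN_L1//; have := test 0 1 psi ab tpsi.
  rewrite /inner /dir /re /im /=; under eq_Rintegral do rewrite !mulr1 !mulr0 !mul0r !mul1r mulr0 add0r.
  move=> ->; apply: eq_Rintegral => x _; ring.
Qed.

End CriticalPoints.

(** * Classical solutions of the equation *)

Section ODE.
Context {R : realType}.
Local Notation mu := (@lebesgue_measure R).
Implicit Types (f g D P Q : R -> R) (x : R).

Lemma continuous_ae_eq f g : continuous f -> continuous g -> f = g %[ae mu] ->
  f = g.
Proof.
move=> cf cg /ae_eqP [N [mN N0 sub]]; apply/funext => a; apply/eqP; rewrite -subr_eq0.
apply: contrapT => /negP fa.
have cfg : {for a, continuous (fun x => f x - g x)} by apply: cvgB; [exact: cf|exact: cg].
have : \forall x \near a, f x - g x != 0.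
  by apply: (cvgr_neq0 _ cfg).
rewrite -nbhs_nearE => /nbhs_ballP[r /= r0 ar].
have : (mu (ball a r) <= mu N)%E.
  apply: le_measure; rewrite ?inE//; first exact: measurable_ball.
  move=> x xr; apply: sub => /=; have := ar x xr; rewrite /= subr_eq0 => /eqP.
  exact.
by rewrite N0 lebesgue_measure_ball ?(ltW r0)// leNgt lte_fin pmulrn_lgt0// r0.
Qed.

(** A nonnegative integrable function cannot stay above [e] on a segment longer than
    its integral divided by [e]. *)
Lemma L1_small_segment f e : L1 f -> (forall x, 0 <= f x) -> 0 < e ->
  exists2 l, 0 < l & forall a, exists2 x, a <= x <= a + l & f x < e.
Proof.
move=> if' f0 e0; pose I := \int[mu]_x f x; have I0 : 0 <= I by exact: Rintegral_ge0.
pose l := I / e + 1; have l0 : 0 < l by rewrite ltr_wpDl// divr_ge0// ltW.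
exists l => // a; apply: contrapT => no.
have fe x : a <= x <= a + l -> e <= f x.
  by move=> ax; rewrite leNgt; apply/negP => fx; apply: no; exists x.
have icst (d : R) : mu.-integrable `[a, a + l] (EFin \o (fun=> d)).
  by apply: continuous_integrable_segment => y; exact: cvg_cst.
have ifs : mu.-integrable `[a, a + l] (EFin \o f) by exact: (integrableS _ _ _ if').
have mes : fine (mu `[a, a + l]) = l.
  by rewrite lebesgue_measure_itv/= lte_fin ltrDl l0/= addrAC subrr add0r.
have h1 : e * l <= \int[mu]_(x in `[a, a + l]) f x.
  by rewrite -{1}mes -Rintegral_cst//; apply: le_Rintegral.
have h2 : \int[mu]_(x in `[a, a + l]) f x <= I.
  rewrite /I /Rintegral fine_le//.
  - exact: integrable_fin_num ifs.
  - exact: integrable_fin_num if'.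
  - apply: ge0_subset_integral => //.
    + by apply/measurable_EFinP; exact: L1_measurable.
    + by move=> x _; rewrite lee_fin.
have : e * l <= I by exact: le_trans h2.
by rewrite /l mulrDr mulr1 mulrC divfK ?gt_eqF// gerDl leNgt e0.
Qed.

Lemma gronwall_right D D' C a b : has_deriv D D' -> a <= b ->
  (forall x, a <= x <= b -> D' x <= C * D x) -> D a <= 0 -> D b <= 0.
Proof.
move=> dD ab DC Da.
pose G x := D x * expR (- C * x + C * a).
have dG : has_deriv G (fun x => (D' x - C * D x) * expR (- C * x + C * a)).
  move=> x; have de := is_derive_compf (is_derive_affine (- C) (C * a) x)
    (is_derive_expR _).
  by apply: (is_derive_eq (is_derive_mulf (dD x) de)); ring.
have cG := has_deriv_continuous dG.
have Gba : G b <= G a.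
  apply: (@ler0_derive1_nincr _ G a b) => //.
  - by move=> x _; have [] := dG x.
  - move=> x; rewrite in_itv/= => /andP[ax xb]; rewrite (has_deriv_derive1 dG).
    by rewrite mulr_le0_ge0 ?expR_ge0// subr_le0 DC// !ltW.
  - exact: continuous_subspaceT.
have : G b <= 0.
  by apply: le_trans Gba _; rewrite mulr_le0_ge0 ?expR_ge0.
by rewrite pmulr_lle0 ?expR_gt0.
Qed.

(** For b < a, reflect the line. *)
Lemma gronwall_eq0 D D' C a b : has_deriv D D' -> (forall x, 0 <= D x) ->
  (forall x, `|x - a| <= `|b - a| -> `|D' x| <= C * D x) -> D a = 0 -> D b = 0.
Proof.
move=> dD D0 DC Da; apply/eqP; rewrite eq_le D0 andbT.
have [ab|/ltW ba] := leP a b.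
  apply: (gronwall_right (C := C) dD ab); last by rewrite Da.
  move=> x /andP[ax xb]; apply: le_trans (ler_norm _) _; apply: DC.
  by rewrite !ger0_norm ?subr_ge0 ?lerD2r// ?(le_trans ax).
pose D2 x := D (- 1 * x + 0); pose D2' x := - D' (- 1 * x + 0).
have dD2 : has_deriv D2 D2'.
  move=> x; apply: (is_derive_eq (is_derive_compf (is_derive_affine (- 1) 0 x) (dD _))).
  by rewrite /D2'; ring.
have D2E x : D2 (- x) = D x by rewrite /D2 mulN1r opprK addr0.
rewrite -D2E; apply: (gronwall_right (a := - a) (C := C) dD2); rewrite ?lerN2//.
  move=> x /andP[ax xb]; rewrite /D2' /D2 !mulN1r !addr0.
  apply: le_trans (ler_norm _) _; rewrite normrN; apply: DC.
  have -> : `|- x - a| = a + x by rewrite ler0_norm; [ring|lra].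
  have -> : `|b - a| = a - b by rewrite ler0_norm; [ring|lra].
  by lra.
by rewrite D2E Da.
Qed.

(** The energy contains odd powers of the modulus, which need differentiating also at
    its zeros. There P and Q are multiples of z - x with continuous factors, so the cube
    is z - x times a continuous function that vanishes at x. *)
Lemma is_derive_norm_cube P Q (p q : R) x : is_derive x 1 P p -> is_derive x 1 Q q ->
  is_derive x 1 (fun y => Num.sqrt (P y ^+ 2 + Q y ^+ 2) ^+ 3)
    (3 * Num.sqrt (P x ^+ 2 + Q x ^+ 2) * (P x * p + Q x * q)).
Proof.
move=> dP dQ; set N := fun y => P y ^+ 2 + Q y ^+ 2.
have dN : is_derive x 1 N (2 * (P x * p + Q x * q)).
  apply: (is_derive_eq (is_derive_addf (is_derive_expf 2 dP) (is_derive_expf 2 dQ))).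
  by rewrite /= !expr1; ring.
have N0 : 0 <= N x by rewrite addr_ge0 ?sqr_ge0.
move: N0; rewrite le_eqVlt => /predU1P[Nx|Nx]; last first.
  have ds := is_derive_compf dN (is_derive1_sqrt Nx).
  apply: (is_derive_eq (is_derive_expf 3 ds)); rewrite /= -/(N x).
  have : Num.sqrt (N x) != 0 by rewrite gt_eqF// sqrtr_gt0.
  by move=> s0; field.
have /eqP := esym Nx; rewrite paddr_eq0 ?sqr_ge0// !sqrf_eq0 => /andP[/eqP P0 /eqP Q0].
rewrite P0 Q0 !mul0r addr0 mulr0.
have /is_derive1_caratheodory[pp [Pz cpp _]] := dP.
have /is_derive1_caratheodory[qq [Qz cqq _]] := dQ.
apply/is_derive1_caratheodory.
exists (fun z => (pp z ^+ 2 + qq z ^+ 2) * (z - x) * Num.sqrt (N z)); split.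
- move=> z; rewrite P0 Q0 !expr0n/= addr0 sqrtr0 expr0n/= subr0 exprSr.
  rewrite sqr_sqrtr ?addr_ge0 ?sqr_ge0//.
  have := Pz z; have := Qz z; rewrite P0 Q0 !subr0 => Qz' Pz'.
  by rewrite /N Pz' Qz'; ring.
- have cN : {for x, continuous N} by exact: is_derive_continuous dN.
  apply: cvgM; last first.
    by apply: (@continuous_comp _ _ _ N Num.sqrt) => //; exact: sqrt_continuous.
  apply: cvgM; last by apply: cvgB; [exact: cvg_id|exact: cvg_cst].
  by apply: cvgD; apply: cvgM; [exact: cpp|exact: cpp|exact: cqq|exact: cqq].
- by rewrite subrr mulr0 mul0r.
Qed.

End ODE.

(** ** Conserved quantities and uniqueness *)

Section Orbits.
Context {R : realType}.
Local Notation mu := (@lebesgue_measure R).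
Implicit Types (P Q : R -> R) (u : R -> R[i]) (x : R).

Definition rho P Q x : R := Num.sqrt (P x ^+ 2 + Q x ^+ 2).

(** The trajectory (u, u') of a classical solution u = P + i Q, with u' = P1 + i Q1. *)
Definition orbit (a1 a2 a3 : R) P Q (P1 Q1 : R -> R) : Prop :=
  [/\ has_deriv P P1, has_deriv Q Q1,
      has_deriv P1 (fun x => - (nonlin a1 a2 a3 (rho P Q x) * P x)) &
      has_deriv Q1 (fun x => - (nonlin a1 a2 a3 (rho P Q x) * Q x))].

Lemma rho_ge0 P Q x : 0 <= rho P Q x. Proof. exact: sqrtr_ge0. Qed.

Lemma rho_sq P Q x : rho P Q x ^+ 2 = P x ^+ 2 + Q x ^+ 2.
Proof. by rewrite sqr_sqrtr// addr_ge0 ?sqr_ge0. Qed.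

Lemma continuous_rho P Q : continuous P -> continuous Q -> continuous (rho P Q).
Proof.
move=> cP cQ x; apply: (@continuous_comp _ _ _ (fun y => P y ^+ 2 + Q y ^+ 2) Num.sqrt).
  by apply: cvgD; apply: cvgM; [exact: cP|exact: cP|exact: cQ|exact: cQ].
exact: sqrt_continuous.
Qed.

Lemma continuous_nonlin_mul a1 a2 a3 (r f : R -> R) : continuous r -> continuous f ->
  continuous (fun x => - (nonlin a1 a2 a3 (r x) * f x)).
Proof.
move=> cr cf x; apply: cvgN; apply: cvgM; last exact: cf.
have cX k : {for x, continuous (fun y => r y ^+ k)}.
  by apply: (@continuous_comp _ _ _ r (fun y : R => y ^+ k));
    [exact: cr|exact: exprn_continuous].
apply: cvgD; last by apply: cvgM; [exact: cvg_cst|exact: cX].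
by apply: cvgD; apply: cvgM; [exact: cvg_cst|exact: cr|exact: cvg_cst|exact: cX].
Qed.

(** Regularity: u has a continuous representative, so the nonlinear term has one; apply
    the fundamental theorem of calculus to u' and then to u. *)
Lemma solution_orbit a1 a2 a3 u : is_weak_deriv u (weak_deriv u) ->
  is_solution a1 a2 a3 u ->
  exists P Q P1 Q1, [/\ orbit a1 a2 a3 P Q P1 Q1,
    re u = P %[ae mu] /\ im u = Q %[ae mu] &
    re (weak_deriv u) = P1 %[ae mu] /\ im (weak_deriv u) = Q1 %[ae mu]].
Proof.
move=> [up uq] /solutionE[sp sq].
have [P0 cP0 uP0] := weak_deriv_continuous up.
have [Q0 cQ0 uQ0] := weak_deriv_continuous uq.
have cr := continuous_rho cP0 cQ0.
have rE : {ae mu, forall x, modulus u x = rho P0 Q0 x}.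
  move/ae_eqP : uP0 => uP0; move/ae_eqP : uQ0; move: uP0; apply: ae_sub2 => x px qx.
  by rewrite /modulus normcE /rho -px -qx.
have [P1 dP1 uP1] := @weak_deriv_C1 _ _ _ (fun x => - (nonlin a1 a2 a3 (rho P0 Q0 x) * P0 x))
  sp (@continuous_nonlin_mul a1 a2 a3 _ _ cr cP0)
  ((ae_eqP _ _).2 (ae_sub2 (fun x => (fun rx (px : re u x = P0 x) =>
    f_equal2 (fun r p => - (nonlin a1 a2 a3 r * p)) rx px)) rE ((ae_eqP _ _).1 uP0))).
have [Q1 dQ1 uQ1] := @weak_deriv_C1 _ _ _ (fun x => - (nonlin a1 a2 a3 (rho P0 Q0 x) * Q0 x))
  sq (@continuous_nonlin_mul a1 a2 a3 _ _ cr cQ0)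
  ((ae_eqP _ _).2 (ae_sub2 (fun x => (fun rx (qx : im u x = Q0 x) =>
    f_equal2 (fun r p => - (nonlin a1 a2 a3 r * p)) rx qx)) rE ((ae_eqP _ _).1 uQ0))).
have [P dP uP] := weak_deriv_C1 up (has_deriv_continuous dP1) uP1.
have [Q dQ uQ] := weak_deriv_C1 uq (has_deriv_continuous dQ1) uQ1.
have trans (f g h : R -> R) : f = g %[ae mu] -> f = h %[ae mu] -> g = h %[ae mu].
  by move=> /ae_eqP fg /ae_eqP fh; apply/ae_eqP; apply: ae_sub2 fg fh => x -> ->.
have PE : P = P0.
  exact: (continuous_ae_eq (has_deriv_continuous dP) cP0 (trans _ _ _ uP uP0)).
have QE : Q = Q0.
  exact: (continuous_ae_eq (has_deriv_continuous dQ) cQ0 (trans _ _ _ uQ uQ0)).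
by exists P, Q, P1, Q1; split => //; rewrite /orbit PE QE; split => //; rewrite -?PE -?QE.
Qed.

Definition potential (a1 a2 a3 r : R) : R := a1 / 3 * r ^+ 3 + a2 / 4 * r ^+ 4 + a3 / 5 * r ^+ 5.

Lemma orbit_energy a1 a2 a3 P Q P1 Q1 x y : orbit a1 a2 a3 P Q P1 Q1 ->
  (P1 x ^+ 2 + Q1 x ^+ 2) / 2 + potential a1 a2 a3 (rho P Q x) =
  (P1 y ^+ 2 + Q1 y ^+ 2) / 2 + potential a1 a2 a3 (rho P Q y).
Proof.
move=> [dP dQ dP1 dQ1].
pose E x := 2^-1 * (P1 x ^+ 2 + Q1 x ^+ 2) + (a1 / 3 * rho P Q x ^+ 3 +
  a2 / 4 * (P x ^+ 2 + Q x ^+ 2) ^+ 2 + a3 / 5 * (rho P Q x ^+ 3 * (P x ^+ 2 + Q x ^+ 2))).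
have EE z : (P1 z ^+ 2 + Q1 z ^+ 2) / 2 + potential a1 a2 a3 (rho P Q z) = E z.
  rewrite /E /potential -!rho_sq; set r := rho P Q z; ring.
rewrite !EE; apply: is_derive_0_is_cst => z.
have d3 := is_derive_norm_cube (dP z) (dQ z); rewrite -/(rho P Q z) in d3.
have dN := is_derive_addf (is_derive_expf 2 (dP z)) (is_derive_expf 2 (dQ z)).
have dN1 := is_derive_addf (is_derive_expf 2 (dP1 z)) (is_derive_expf 2 (dQ1 z)).
have d5 := is_derive_mulf d3 dN.
apply: (is_derive_eq (is_derive_addf (is_derive_scalef 2^-1 dN1)
  (is_derive_addf (is_derive_addf (is_derive_scalef (a1 / 3) d3)
    (is_derive_scalef (a2 / 4) (is_derive_expf 2 dN))) (is_derive_scalef (a3 / 5) d5)))).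
rewrite /= !expr1 -/(rho P Q z) -rho_sq.
rewrite (_ : rho P Q z ^+ 3 = rho P Q z * (rho P Q z ^+ 2)); last by rewrite -exprS.
by rewrite /nonlin; set r := rho P Q z; field.
Qed.

Lemma orbit_angular_momentum a1 a2 a3 P Q P1 Q1 x y : orbit a1 a2 a3 P Q P1 Q1 ->
  P x * Q1 x - Q x * P1 x = P y * Q1 y - Q y * P1 y.
Proof.
move=> [dP dQ dP1 dQ1].
apply: (@is_derive_0_is_cst _ (fun z => P z * Q1 z - Q z * P1 z)) => z.
apply: (is_derive_eq (is_derive_subf (is_derive_mulf (dP z) (dQ1 z))
  (is_derive_mulf (dQ z) (dP1 z)))); ring.
Qed.

Lemma potential_bound a1 a2 a3 (r : R) : 0 <= r -> r <= 1 ->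
  `|potential a1 a2 a3 r| <= (`|a1| + `|a2| + `|a3|) * r.
Proof.
move=> r0 r1.
have h (a c : R) k : 1 <= c -> `|a / c * r ^+ k.+1| <= `|a| * r.
  move=> c1; rewrite !normrM (ger0_norm (exprn_ge0 _ r0)).
  apply: ler_pM => //; first exact: exprn_ge0.
    by rewrite ler_piMr// ger0_norm ?invr_ge0 ?invf_le1 ?(lt_le_trans ltr01)// (le_trans ler01).
  by rewrite exprS ler_piMr// exprn_ile1.
rewrite /potential !mulrDl; apply: le_trans (ler_normD _ _) _; apply: lerD.
  apply: le_trans (ler_normD _ _) _.
  by apply: lerD; apply: h; rewrite ler1n.
by apply: h; rewrite ler1n.
Qed.

(** Both conserved quantities tend to 0 when the orbit comes close to rest. *)
Lemma orbit_rest a1 a2 a3 P Q P1 Q1 : orbit a1 a2 a3 P Q P1 Q1 ->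
  (forall e, 0 < e -> exists x, rho P Q x < e /\ P1 x ^+ 2 + Q1 x ^+ 2 < e) ->
  forall x, (P1 x ^+ 2 + Q1 x ^+ 2) / 2 + potential a1 a2 a3 (rho P Q x) = 0 /\
    P x * Q1 x - Q x * P1 x = 0.
Proof.
move=> orb small x; pose K := `|a1| + `|a2| + `|a3| + 1.
have K1 : 1 <= K by rewrite /K lerDr !addr_ge0.
have smallK (y : R) : (forall e, 0 < e -> e <= 1 -> `|y| <= K * e) -> y = 0.
  move=> h; apply/eqP; rewrite -normr_le0; apply/ler_addgt0Pl => e e0; rewrite addr0.
  have K0 : 0 < K by exact: lt_le_trans K1.
  have := h (Num.min 1 (e / K)); rewrite lt_min ltr01 divr_gt0// ge_min lexx => /(_ isT isT).
  by move=> /le_trans; apply; rewrite mulrC -ler_pdivlMr// ge_min lexx orbT.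
split; apply: smallK => e e0 e1; have [y [ry vy]] := small e e0.
  rewrite (orbit_energy x y orb); apply: le_trans (ler_normD _ _) _.
  have r0 := rho_ge0 P Q y.
  have pb := potential_bound a1 a2 a3 r0 (le_trans (ltW ry) e1).
  have -> : K * e = (`|a1| + `|a2| + `|a3|) * e + e by rewrite /K mulrDl mul1r.
  rewrite addrC; apply: lerD.
    by apply: le_trans pb _; rewrite ler_wpM2l ?(ltW ry)// !addr_ge0.
  have v0 : 0 <= P1 y ^+ 2 + Q1 y ^+ 2 by rewrite addr_ge0 ?sqr_ge0.
  by rewrite ger0_norm ?divr_ge0//; lra.
rewrite (orbit_angular_momentum x y orb).
have h := cauchy_schwarz2 (P y) (- Q y) (Q1 y) (P1 y).
rewrite mulNr sqrrN -/(rho P Q y) in h; apply: le_trans h _.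
have v1 : Num.sqrt (Q1 y ^+ 2 + P1 y ^+ 2) <= 1.
  rewrite -sqrtr1 ler_wsqrtr// addrC; apply: le_trans (ltW vy) e1.
apply: (@le_trans _ _ e).
  apply: (@le_trans _ _ (rho P Q y)); last exact: ltW.
  by rewrite ler_piMr// rho_ge0.
by rewrite ler_peMl// ltW.
Qed.

Lemma nonlin_lipschitz a1 a2 a3 (r s B : R) : 0 <= r -> 0 <= s -> r <= B -> s <= B ->
  1 <= B -> `|nonlin a1 a2 a3 r - nonlin a1 a2 a3 s| <=
    (`|a1| + `|a2| + `|a3|) * (3 * B ^+ 2) * `|r - s|.
Proof.
move=> r0 s0 rB sB B1.
have -> : nonlin a1 a2 a3 r - nonlin a1 a2 a3 s =
  (a1 + a2 * (r + s) + a3 * (r ^+ 2 + r * s + s ^+ 2)) * (r - s) by rewrite /nonlin; ring.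
rewrite normrM ler_wpM2r// 2!mulrDl.
have B0 : 0 <= B by exact: le_trans B1.
have BB : B <= B ^+ 2 by rewrite ler_eXnr.
have b1 : 1 <= 3 * B ^+ 2 by lra.
have b2 : `|r + s| <= 3 * B ^+ 2 by rewrite ger0_norm ?addr_ge0//; lra.
have rr : r ^+ 2 <= B ^+ 2 by rewrite lerXn2r ?nnegrE.
have ss : s ^+ 2 <= B ^+ 2 by rewrite lerXn2r ?nnegrE.
have rs : r * s <= B ^+ 2 by rewrite expr2 ler_pM.
have b3 : `|r ^+ 2 + r * s + s ^+ 2| <= 3 * B ^+ 2.
  by rewrite ger0_norm ?addr_ge0 ?sqr_ge0 ?mulr_ge0//; lra.
apply: le_trans (ler_normD _ _) _; apply: lerD; last by rewrite normrM ler_wpM2l.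
apply: le_trans (ler_normD _ _) _; apply: lerD; first by rewrite ler_peMr.
by rewrite normrM ler_wpM2l.
Qed.

Lemma rho_lipschitz P Q P' Q' x :
  `|rho P Q x - rho P' Q' x| <= `|P x - P' x| + `|Q x - Q' x|.
Proof.
have h (a b c d : R) : Num.sqrt (a ^+ 2 + b ^+ 2) <=
    Num.sqrt (c ^+ 2 + d ^+ 2) + (`|a - c| + `|b - d|).
  set s := Num.sqrt (c ^+ 2 + d ^+ 2); set t := `|a - c| + `|b - d|.
  have s0 : 0 <= s by exact: sqrtr_ge0.
  have t0 : 0 <= t by exact: addr_ge0.
  rewrite -[leRHS]ger0_norm ?addr_ge0// -sqrtr_sqr ler_wsqrtr//.
  have s2 : s ^+ 2 = c ^+ 2 + d ^+ 2 by rewrite sqr_sqrtr// addr_ge0 ?sqr_ge0.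
  have t2 : (a - c) ^+ 2 + (b - d) ^+ 2 <= t ^+ 2.
    rewrite /t [leRHS]sqrrD !real_normK ?num_real//.
    by have := mulr_ge0 (normr_ge0 (a - c)) (normr_ge0 (b - d)); rewrite mulr2n; lra.
  have cs := cauchy_schwarz2 c d (a - c) (b - d); rewrite -/s in cs.
  have st : Num.sqrt ((a - c) ^+ 2 + (b - d) ^+ 2) <= t.
    by rewrite -[leRHS]ger0_norm// -sqrtr_sqr ler_wsqrtr.
  have : c * (a - c) + d * (b - d) <= s * t.
    by apply: le_trans (ler_norm _) _; apply: le_trans cs _; rewrite ler_wpM2l.
  have -> : a ^+ 2 + b ^+ 2 = s ^+ 2 + 2 * (c * (a - c) + d * (b - d)) +
     ((a - c) ^+ 2 + (b - d) ^+ 2) by rewrite s2; ring.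
  move=> hst; rewrite [leRHS]sqrrD mulr2n; lra.
apply/ler_normlP; split.
  rewrite opprB lerBlDl (distrC (P x)) (distrC (Q x)); exact: h.
by rewrite lerBlDl; exact: h.
Qed.

(** The nonlinearity is Lipschitz on bounded sets, so the squared distance of the two
    trajectories in phase space obeys a linear differential inequality. *)
Lemma orbit_unique a1 a2 a3 P Q P1 Q1 P' Q' P1' Q1' c :
  orbit a1 a2 a3 P Q P1 Q1 -> orbit a1 a2 a3 P' Q' P1' Q1' ->
  P c = P' c -> Q c = Q' c -> P1 c = P1' c -> Q1 c = Q1' c ->
  forall x, P x = P' x /\ Q x = Q' x.
Proof.
move=> [dP dQ dP1 dQ1] [dP' dQ' dP1' dQ1'] pc qc p1c q1c x.
have cr := continuous_rho (has_deriv_continuous dP) (has_deriv_continuous dQ).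
have cr' := continuous_rho (has_deriv_continuous dP') (has_deriv_continuous dQ').
pose L := `|x - c|; have cL : c - L <= c + L by rewrite lerD2l ge0_cp// normr_ge0.
have [B1 _ bB1] := EVT_max cL (continuous_subspaceT cr).
have [B2 _ bB2] := EVT_max cL (continuous_subspaceT cr').
pose B := 1 + rho P Q B1 + rho P' Q' B2.
have r1 := rho_ge0 P Q B1; have r2 := rho_ge0 P' Q' B2.
have B1' : 1 <= B by rewrite /B; lra.
pose A := `|a1| + `|a2| + `|a3|; have A0 : 0 <= A by rewrite !addr_ge0.
have B0 : 0 <= B by exact: le_trans B1'.
have AB0 : 0 <= A * (3 * B ^+ 2) by rewrite mulr_ge0// mulr_ge0// sqr_ge0.
pose K := A * (3 * B ^+ 2) * B; pose Lc := K * (1 + B).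
have K0 : 0 <= K by rewrite mulr_ge0.
have Lc0 : 0 <= Lc by rewrite mulr_ge0//; lra.
pose D z := (P z - P' z) ^+ 2 + (Q z - Q' z) ^+ 2 +
  ((P1 z - P1' z) ^+ 2 + (Q1 z - Q1' z) ^+ 2).
pose nP z := nonlin a1 a2 a3 (rho P Q z) * P z - nonlin a1 a2 a3 (rho P' Q' z) * P' z.
pose nQ z := nonlin a1 a2 a3 (rho P Q z) * Q z - nonlin a1 a2 a3 (rho P' Q' z) * Q' z.
pose D' z := 2 * ((P z - P' z) * (P1 z - P1' z) + (Q z - Q' z) * (Q1 z - Q1' z)
  - (P1 z - P1' z) * nP z - (Q1 z - Q1' z) * nQ z).
have dD : has_deriv D D'.
  move=> z; apply: (is_derive_eq (is_derive_addf
    (is_derive_addf (is_derive_expf 2 (is_derive_subf (dP z) (dP' z)))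
      (is_derive_expf 2 (is_derive_subf (dQ z) (dQ' z))))
    (is_derive_addf (is_derive_expf 2 (is_derive_subf (dP1 z) (dP1' z)))
      (is_derive_expf 2 (is_derive_subf (dQ1 z) (dQ1' z)))))).
  by rewrite /D' /nP /nQ /= !expr1; ring.
have D0 z : 0 <= D z by rewrite !addr_ge0 ?sqr_ge0.
have lip (f f' : R) z : `|z - c| <= L -> `|f'| <= rho P' Q' z ->
    `|nonlin a1 a2 a3 (rho P Q z) * f - nonlin a1 a2 a3 (rho P' Q' z) * f'| <=
    K * `|f - f'| + K * B * (`|P z - P' z| + `|Q z - Q' z|).
  move=> zc ff'; have /ler_normlP[z1 z2] := zc.
  have zin : z \in `[c - L, c + L] by rewrite in_itv/=; apply/andP; split; lra.
  have rB : rho P Q z <= B by have := bB1 z zin; rewrite /B; lra.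
  have rB' : rho P' Q' z <= B by have := bB2 z zin; rewrite /B; lra.
  have r0 := rho_ge0 P Q z; have r0' := rho_ge0 P' Q' z.
  have -> : nonlin a1 a2 a3 (rho P Q z) * f - nonlin a1 a2 a3 (rho P' Q' z) * f' =
    nonlin a1 a2 a3 (rho P Q z) * (f - f') +
    (nonlin a1 a2 a3 (rho P Q z) - nonlin a1 a2 a3 (rho P' Q' z)) * f' by ring.
  apply: le_trans (ler_normD _ _) _; apply: lerD; rewrite normrM.
    rewrite ler_wpM2r//; apply: le_trans (nonlin_bound a1 a2 a3 r0 rB B1') _.
    rewrite -/A /K; apply: ler_pM => //; first by rewrite mulr_ge0// sqr_ge0.
    by rewrite ler_wpM2l// ler_peMl ?sqr_ge0// ler1n.
  have nl := nonlin_lipschitz a1 a2 a3 r0 r0' rB rB' B1'; rewrite -/A in nl.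
  rewrite mulrAC; apply: ler_pM => //; last exact: le_trans rB'.
  apply: le_trans nl _; apply: ler_pM => //; last exact: rho_lipschitz.
  by rewrite /K ler_peMr.
have DD z : `|z - c| <= L -> `|D' z| <= (1 + 2 * Lc) * D z.
  move=> zc.
  have PP' : `|P' z| <= rho P' Q' z.
    by rewrite -ler_sqr ?nnegrE ?rho_ge0// rho_sq real_normK ?num_real// lerDl sqr_ge0.
  have QQ' : `|Q' z| <= rho P' Q' z.
    by rewrite -ler_sqr ?nnegrE ?rho_ge0// rho_sq real_normK ?num_real// lerDr sqr_ge0.
  have lP := lip (P z) (P' z) z zc PP'; have lQ := lip (Q z) (Q' z) z zc QQ'.
  rewrite -/(nP z) in lP; rewrite -/(nQ z) in lQ.
  have -> : D z = `|P z - P' z| ^+ 2 + `|Q z - Q' z| ^+ 2 +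
      (`|P1 z - P1' z| ^+ 2 + `|Q1 z - Q1' z| ^+ 2) by rewrite !real_normK ?num_real.
  have tri (s t k1 k2 n1 n2 : R) : `|2 * (s * k1 + t * k2 - k1 * n1 - k2 * n2)| <=
      2 * (`|s| * `|k1| + `|t| * `|k2| + `|k1| * `|n1| + `|k2| * `|n2|).
    rewrite normrM ger0_norm// ler_wpM2l// -!normrM.
    apply: le_trans (ler_normB _ _) _; rewrite lerD2r.
    apply: le_trans (ler_normB _ _) _; rewrite lerD2r.
    exact: ler_normD.
  apply: le_trans (tri _ _ _ _ _ _) _.
  move: lP lQ (normr_ge0 (P z - P' z)) (normr_ge0 (Q z - Q' z))
    (normr_ge0 (P1 z - P1' z)) (normr_ge0 (Q1 z - Q1' z)).
  set p := `|P z - _|; set q := `|Q z - _|; set r := `|P1 z - _|; set t := `|Q1 z - _|.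
  set m := `|nP z|; set n := `|nQ z| => lP lQ p0 q0 r0 t0.
  have KB0 : 0 <= K * B by exact: mulr_ge0.
  have mL : m <= Lc * (p + q).
    apply: le_trans lP _; rewrite /Lc; have := mulr_ge0 K0 q0; lra.
  have nL : n <= Lc * (p + q).
    apply: le_trans lQ _; rewrite /Lc; have := mulr_ge0 K0 p0; lra.
  have rm := ler_wpM2l r0 mL; have tn := ler_wpM2l t0 nL.
  have sq1 : 2 * (p * r + q * t) <= p ^+ 2 + q ^+ 2 + (r ^+ 2 + t ^+ 2).
    by have := sqr_ge0 (p - r); have := sqr_ge0 (q - t); rewrite !sqrrB !mulr2n; lra.
  have sq2 : (r + t) * (p + q) <= p ^+ 2 + q ^+ 2 + (r ^+ 2 + t ^+ 2).
    have := sqr_ge0 (r + t - (p + q)); have := sqr_ge0 (r - t); have := sqr_ge0 (p - q).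
    rewrite !expr2; lra.
  have := ler_wpM2l Lc0 sq2; lra.
have Dx : D x = 0.
  apply: (gronwall_eq0 dD D0 (a := c)); first exact: DD.
  by rewrite /D pc qc p1c q1c !subrr !expr0n/= !addr0.
move/eqP: Dx; rewrite /D paddr_eq0 ?addr_ge0 ?sqr_ge0// => /andP[+ _].
rewrite paddr_eq0 ?sqr_ge0// !sqrf_eq0 !subr_eq0 => /andP[/eqP -> /eqP ->].
by [].
Qed.

End Orbits.

(** ** The amplitude of a solution *)

Section Amplitude.
Context {R : realType}.
Local Notation mu := (@lebesgue_measure R).
Implicit Types (P Q : R -> R) (u : R -> R[i]) (x : R).

(** At an interior maximum of the modulus the real part of conj(u) u' vanishes; its
    imaginary part is the angular momentum, which is 0; hence u' = 0 there. Every smaller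
    modulus is attained on the way to rest, and there the energy identity gives the sign
    of the potential. *)
Lemma orbit_turning_point a1 a2 a3 P Q (P1 Q1 : R -> R) :
  orbit a1 a2 a3 P Q P1 Q1 ->
  (forall e M, 0 < e -> exists x, [/\ M < x, rho P Q x < e & P1 x ^+ 2 + Q1 x ^+ 2 < e]) ->
  (forall e M, 0 < e -> exists x, [/\ x < M, rho P Q x < e & P1 x ^+ 2 + Q1 x ^+ 2 < e]) ->
  (exists x, rho P Q x != 0) ->
  exists c, [/\ 0 < rho P Q c, P1 c = 0 /\ Q1 c = 0, potential a1 a2 a3 (rho P Q c) = 0
    & forall r, 0 < r -> r < rho P Q c -> potential a1 a2 a3 r <= 0].
Proof.
move=> orb right left [xs xs0]; have [dP dQ dP1 dQ1] := orb.
have rest := orbit_rest orb (fun e e0 => let: ex_intro x (And3 _ r v) := right e 0 e0 in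
  ex_intro _ x (conj r v)).
have cr := continuous_rho (has_deriv_continuous dP) (has_deriv_continuous dQ).
have rs0 : 0 < rho P Q xs by rewrite lt_neqAle eq_sym xs0 rho_ge0.
have [b [xb rb _]] := right _ xs rs0; have [a [ax ra _]] := left _ xs rs0.
have ab : a <= b by rewrite ltW// (lt_trans ax).
have [c cab cmax] := EVT_max ab (continuous_subspaceT cr).
have rc : 0 < rho P Q c.
  by apply: lt_le_trans rs0 (cmax _ _); rewrite in_itv/= !ltW.
have rsc : rho P Q xs <= rho P Q c by apply: cmax; rewrite in_itv/= !ltW.
have cab' : c \in `]a, b[.
  move: cab; rewrite !in_itv/= => /andP[ac cb].
  rewrite !lt_neqAle ac cb !andbT; apply/andP; split.
    by apply/eqP => E; move: (lt_le_trans ra rsc); rewrite E ltxx.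
  by apply/eqP => E; move: (lt_le_trans rb rsc); rewrite E ltxx.
pose N x := P x ^+ 2 + Q x ^+ 2.
have dN x : is_derive x 1 N (2 * (P x * P1 x + Q x * Q1 x)).
  apply: (is_derive_eq (is_derive_addf (is_derive_expf 2 (dP x)) (is_derive_expf 2 (dQ x)))).
  by rewrite /= !expr1; ring.
have dN0 : is_derive c 1 N 0.
  apply: (@derive1_at_max _ N a b) => //.
  move=> t tab; rewrite /N -!rho_sq lerXn2r ?nnegrE ?rho_ge0//.
  by apply: cmax; exact: subset_itv_oo_cc tab.
have R0 : P c * P1 c + Q c * Q1 c = 0.
  have := is_derive_derive1 (dN c); rewrite (is_derive_derive1 dN0) => /esym/eqP.
  by rewrite mulf_eq0 pnatr_eq0/= => /eqP.
have [E0 W0] := rest c.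
have V0 : P1 c ^+ 2 + Q1 c ^+ 2 = 0.
  have h : rho P Q c ^+ 2 * (P1 c ^+ 2 + Q1 c ^+ 2) = 0.
    rewrite rho_sq (_ : _ * _ = (P c * P1 c + Q c * Q1 c) ^+ 2 +
      (P c * Q1 c - Q c * P1 c) ^+ 2); last by ring.
    by rewrite R0 W0 expr0n/= addr0.
  by move/eqP: h; rewrite mulf_eq0 expf_eq0/= gt_eqF//= => /eqP.
exists c; split => //.
- by move/eqP : V0; rewrite paddr_eq0 ?sqr_ge0// !sqrf_eq0 => /andP[/eqP -> /eqP ->].
- by rewrite V0 mul0r add0r in E0.
- move=> r r0 rrc; have [d [cd rd _]] := right r c r0.
  have [y _ yr] : exists2 y, y \in `[c, d] & rho P Q y = r.
    apply: IVT; [exact: ltW|exact: continuous_subspaceT|].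
    rewrite ge_min le_max; apply/andP; split; apply/orP.
      by right; exact: ltW.
    by left; exact: ltW.
  have [Ey _] := rest y; rewrite yr in Ey.
  have := sqr_ge0 (P1 y); have := sqr_ge0 (Q1 y); lra.
Qed.

(** The potential at r is - r^5 / 2 times the quadratic q0 (w - w0) (w - w1) at
    w = 1/r. In each of the three cases this quadratic has a positive leading
    coefficient and a positive, simple, largest root w0. *)
Definition coefficients (a1 a2 a3 q0 w0 w1 : R) : Prop :=
  [/\ 0 < q0, 0 < w0, w1 < w0 &
    [/\ a1 = - (3 / 2) * q0, a2 = 2 * q0 * (w0 + w1) & a3 = - (5 / 2) * q0 * w0 * w1]].

Lemma coefficients_exist (a1 a2 a3 : R) :
  [\/ [/\ a1 < 0, 0 < a2 & 0 < a3], [/\ a1 < 0, a2 < 0 & 0 < a3] |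
      [/\ a1 = -1, a3 = -1 & 8 / Num.sqrt 15 < a2]] ->
  exists q0 w0 w1, coefficients a1 a2 a3 q0 w0 w1.
Proof.
move=> ha; pose q0 := - (2 / 3) * a1; pose D := a2 ^+ 2 / 4 - 16 / 15 * (a1 * a3).
suff [a10 D0 w0pos] : [/\ a1 < 0, 0 < D & 0 < a2 / 2 + Num.sqrt D].
  have q00 : 0 < q0 by rewrite /q0; lra.
  have s0 : 0 < Num.sqrt D by rewrite sqrtr_gt0.
  have s2 : Num.sqrt D ^+ 2 = D by rewrite sqr_sqrtr// ltW.
  set s := Num.sqrt D in w0pos s0 s2.
  exists q0, ((a2 / 2 + s) / (2 * q0)), ((a2 / 2 - s) / (2 * q0)).
  have q20 : 0 < 2 * q0 by rewrite mulr_gt0.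
  have qn : q0 != 0 by rewrite gt_eqF.
  split => //; first exact: divr_gt0.
    by rewrite ltr_pM2r ?invr_gt0//; lra.
  split; first by rewrite /q0; field.
    by field.
  have -> : - (5 / 2) * q0 * ((a2 / 2 + s) / (2 * q0)) * ((a2 / 2 - s) / (2 * q0)) =
    - (5 / 8) / q0 * (a2 ^+ 2 / 4 - s ^+ 2) by field.
  rewrite s2 /D (_ : _ - (_ - _) = 16 / 15 * (a1 * a3)); last by ring.
  have a1n : a1 != 0 by rewrite lt_eqF.
  by rewrite /q0; field.
have root (a1n : a1 < 0) (D0 : a2 ^+ 2 / 4 < D) : [/\ a1 < 0, 0 < D & 0 < a2 / 2 + Num.sqrt D].
  have a24 : 0 <= a2 ^+ 2 / 4 by rewrite divr_ge0 ?sqr_ge0.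
  split => //; first exact: le_lt_trans D0.
  have : `|a2 / 2| < Num.sqrt D.
    rewrite -sqrtr_sqr ltr_sqrt; last exact: le_lt_trans D0.
    by rewrite expr_div_n (_ : 2 ^+ 2 = 4)//; ring.
  by move=> /ltr_normlP[]; lra.
case: ha => [[a1n a2p a3p]|[a1n a2n a3p]|[a1E a3E a2p]].
- apply: root => //; have : a1 * a3 < 0 by rewrite nmulr_rlt0.
  by rewrite /D; lra.
- apply: root => //; have : a1 * a3 < 0 by rewrite nmulr_rlt0.
  by rewrite /D; lra.
have s15 : 0 < Num.sqrt (15 : R) by rewrite sqrtr_gt0.
have a20 : 0 < a2 by apply: lt_trans a2p; rewrite divr_gt0.
have D0 : 0 < D.
  rewrite /D a1E a3E; have : (8 / Num.sqrt 15) ^+ 2 < a2 ^+ 2.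
    by rewrite ltrXn2r ?nnegrE// ?divr_ge0// ltW.
  rewrite expr_div_n sqr_sqrtr//; lra.
split => //; first by rewrite a1E; lra.
by rewrite addr_gt0 ?sqrtr_gt0// divr_gt0.
Qed.

Lemma coefficients_potential (a1 a2 a3 q0 w0 w1 r : R) : coefficients a1 a2 a3 q0 w0 w1 ->
  potential a1 a2 a3 r = - (q0 / 2) * r ^+ 3 * ((1 - w0 * r) * (1 - w1 * r)).
Proof. by move=> [_ _ _ [-> -> ->]]; rewrite /potential; field. Qed.

(** The only other positive zero of the potential can be 1/w1 > 1/w0, but the potential
    is positive between the two zeros. *)
Lemma amplitude (a1 a2 a3 q0 w0 w1 m : R) : coefficients a1 a2 a3 q0 w0 w1 ->
  0 < m -> potential a1 a2 a3 m = 0 ->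
  (forall r, 0 < r -> r < m -> potential a1 a2 a3 r <= 0) -> m = w0^-1.
Proof.
move=> co m0; have [q00 w00 w10 _] := co; rewrite (coefficients_potential _ co) => /eqP.
have K0 : - (q0 / 2) * m ^+ 3 != 0.
  by rewrite lt_eqF// mulNr oppr_lt0 mulr_gt0 ?exprn_gt0// divr_gt0.
have w0n : w0 != 0 by rewrite gt_eqF.
rewrite mulf_eq0 (negbTE K0)/= mulf_eq0.
case/orP => [/eqP wm _|/eqP wm below].
  by apply: (mulfI w0n); rewrite mulfV//; lra.
exfalso; have w1m : w1 * m = 1 by lra.
have w1p : 0 < w1 by rewrite -(pmulr_lgt0 _ m0) w1m.
have w1n : w1 != 0 by rewrite gt_eqF.
have mE : m = w1^-1 by apply: (mulfI w1n); rewrite mulfV.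
have w0i : 0 < w0^-1 by rewrite invr_gt0.
have iw : w0^-1 < m by rewrite mE ltf_pV2.
pose r := (w0^-1 + m) / 2; have r0 : 0 < r by rewrite /r; lra.
have rm : r < m by rewrite /r; lra.
have w0r : 1 < w0 * r.
  by rewrite -ltr_pdivrMl// mulr1 /r; lra.
have w1r : w1 * r < 1.
  by rewrite -ltr_pdivlMl// mulr1 -mE.
have := below r r0 rm; rewrite (coefficients_potential _ co) leNgt => /negP; apply.
rewrite mulNr mulNr -mulrN; apply: mulr_gt0.
  by rewrite mulr_gt0 ?exprn_gt0// divr_gt0.
by rewrite -mulNr mulr_gt0//; lra.
Qed.

End Amplitude.

(** * The profile *)

Section Profile.
Context {R : realType}.
Local Notation mu := (@lebesgue_measure R).
Implicit Types (x y z : R).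

(** The solution is the inverse of the primitive of 1/h; the bounds on h make this
    primitive a bijection of the line. *)
Lemma autonomous_ode (h : R -> R) (k K : R) : continuous h -> 0 < k ->
  (forall x, k <= h x) -> (forall x, h x <= K) ->
  exists z : R -> R, has_deriv z (h \o z) /\ z 0 = 0.
Proof.
move=> ch k0 kh hK; have h0 x : 0 < h x by exact: lt_le_trans (kh x).
have K0 : 0 < K by exact: lt_le_trans (h0 0) (hK 0).
pose g x := (h x)^-1.
have cg : continuous g by move=> x; apply: cvgV; [rewrite gt_eqF|exact: ch].
pose T x := primitive g x - primitive g 0.
have dT : has_deriv T g.
  move=> x; rewrite -[g x]subr0; apply: is_derive_subf; exact: primitive_has_deriv.
have cT := has_deriv_continuous dT.
have T0 : T 0 = 0 by rewrite /T subrr.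
have mvt x y : x < y -> exists c, T y - T x = g c * (y - x).
  move=> xy; have [c _ ->] := MVT xy (fun z _ => dT z) (continuous_subspaceT cT).
  by exists c.
have g0 x : K^-1 <= g x by rewrite lef_pV2 ?posrE.
have Ki : 0 < K^-1 by rewrite invr_gt0.
have Tlow x y : x <= y -> K^-1 * (y - x) <= T y - T x.
  rewrite le_eqVlt => /predU1P[->|xy]; first by rewrite !subrr mulr0.
  by have [c ->] := mvt x y xy; rewrite ler_wpM2r// subr_ge0 ltW.
have Tinc x y : x < y -> T x < T y.
  by move=> xy; rewrite -subr_gt0 (lt_le_trans _ (Tlow x y (ltW xy)))// mulr_gt0// subr_gt0.
have Tinj : injective T.
  by move=> x y Txy; case: (ltgtP x y) => // /Tinc; rewrite Txy ltxx.
have Tsurj x : exists y, T y = x.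
  pose L := K * `|x|; have L0 : 0 <= L by rewrite mulr_ge0// ltW.
  have [y _ yx] : exists2 y, y \in `[- L, L] & T y = x.
    have l1 := Tlow 0 L L0; rewrite T0 !subr0 /L mulKf ?gt_eqF// -/L in l1.
    have l2 : K^-1 * (0 - - L) <= T 0 - T (- L) by apply: Tlow; rewrite oppr_le0.
    rewrite T0 !sub0r opprK /L mulKf ?gt_eqF// -/L in l2.
    have x1 := ler_norm x; have x2 := ler_norm (- x); rewrite normrN in x2.
    apply: IVT; [lra|exact: continuous_subspaceT|].
    rewrite ge_min le_max; apply/andP; split; apply/orP; [left|right]; lra.
  by exists y.
pose z x := projT1 (cid (Tsurj x)).
have Tz x : T (z x) = x by rewrite /z; case: cid.
have zT x : z (T x) = x by apply: Tinj; rewrite Tz.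
exists z; split; last by rewrite -T0 zT.
move=> x; rewrite /= -{1}[x]Tz.
have := @is_derive_inverse R T z (g (z x)) (z x) _ _ (dT _) _.
rewrite /g invrK; apply.
- by near=> y; rewrite zT.
- by near=> y; exact: cT.
- by rewrite invr_eq0 gt_eqF.
Unshelve. all: by end_near. Qed.

(** With w = 1/f and w = w0 + z^2 the energy identity
    f'^2 = q0 f^5 (w - w0) (w - w1) becomes
    z'^2 = q0 (w0 - w1 + z^2) / (4 (w0 + z^2)), which is regular at the turning point
    z = 0. Since z grows linearly, f decays like 1/x^2. *)
Lemma profile_exists (a1 a2 a3 q0 w0 w1 : R) : coefficients a1 a2 a3 q0 w0 w1 ->
  exists f f1 : R -> R,
    [/\ has_deriv f f1, has_deriv f1 (fun x => - (nonlin a1 a2 a3 (f x) * f x)),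
        forall x, 0 < f x, f 0 = w0^-1 /\ f1 0 = 0 &
        (forall x, x != 0 -> f x < f 0) /\
        exists2 C, 0 < C & forall x, f x <= C * (1 + x ^+ 2)^-1].
Proof.
move=> [q00 w00 w10 [aE1 aE2 aE3]]; pose A := w0 - w1.
have A0 : 0 < A by rewrite subr_gt0.
pose N x := q0 * (A + x ^+ 2); pose M x := 4 * (w0 + x ^+ 2).
have N0 x : 0 < N x by rewrite mulr_gt0// ltr_wpDr ?sqr_ge0.
have M0 x : 0 < M x by rewrite mulr_gt0// ltr_wpDr ?sqr_ge0.
pose H x := N x / M x.
have H0 x : 0 < H x by rewrite divr_gt0.
pose h x := Num.sqrt (H x).
have h0 x : 0 < h x by rewrite sqrtr_gt0.
have h2 x : h x ^+ 2 = H x by rewrite sqr_sqrtr// ltW.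
have dsq x : is_derive x 1 (fun y : R => y ^+ 2) (2 * x).
  apply: (is_derive_eq (is_derive_expf 2 (is_derive_id x 1))).
  by rewrite /= expr1 mulr1.
have dN x : is_derive x 1 N (2 * q0 * x).
  apply: (is_derive_eq (is_derive_scalef q0 (is_derive_addf (is_derive_cst A x 1) (dsq x)))).
  by ring.
have dM x : is_derive x 1 M (8 * x).
  apply: (is_derive_eq (is_derive_scalef 4 (is_derive_addf (is_derive_cst w0 x 1) (dsq x)))).
  by ring.
pose H' x := (2 * q0 * x * M x - N x * (8 * x)) / M x ^+ 2.
have dH x : is_derive x 1 H (H' x).
  have Mn : M x != 0 by rewrite gt_eqF.
  apply: (is_derive_eq (is_derive_mulf (dN x) (is_derive_invf Mn (dM x)))).
  by rewrite /H'; field.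
have dh x : is_derive x 1 h (H' x / (2 * h x)).
  apply: (is_derive_eq (is_derive_compf (dH x) (is_derive1_sqrt (H0 x)))).
  by rewrite mulrC.
pose k := Num.sqrt (q0 * A / (4 * (A + w0))); pose K := Num.sqrt (q0 * (A + w0) / (4 * w0)).
have Aw : 0 < A + w0 by rewrite addr_gt0.
have k0 : 0 < k by rewrite sqrtr_gt0 divr_gt0// mulr_gt0.
have kh x : k <= h x.
  rewrite ler_wsqrtr// /H /N /M ler_pdivlMr// ?mulr_gt0//; last by rewrite ltr_wpDr ?sqr_ge0.
  rewrite mulrAC ler_pdivrMr ?mulr_gt0//.
  have x2 := sqr_ge0 x; have q1 := mulr_ge0 (ltW q00) x2.
  have := mulr_ge0 q1 (ltW w00); have := mulr_ge0 (mulr_ge0 (ltW q00) (ltW A0)) (ltW A0); nra.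
have hK x : h x <= K.
  rewrite ler_wsqrtr// /H /N /M ler_pdivrMr ?mulr_gt0//; last by rewrite ltr_wpDr ?sqr_ge0.
  rewrite mulrAC ler_pdivlMr ?mulr_gt0//.
  have x2 := sqr_ge0 x; have q1 := mulr_ge0 (ltW q00) x2.
  have := mulr_ge0 q1 (ltW A0); have := mulr_ge0 (mulr_ge0 (ltW q00) (ltW w00)) (ltW w00); nra.
have [z [dz z0]] := autonomous_ode (fun x => is_derive_continuous (dh x)) k0 kh hK.
pose w x := w0 + z x ^+ 2; have wp x : 0 < w x by rewrite ltr_wpDr ?sqr_ge0.
have wn x : w x != 0 by rewrite gt_eqF.
have dw x : is_derive x 1 w (2 * z x * h (z x)).
  apply: (is_derive_eq (is_derive_addf (is_derive_cst w0 x 1) (is_derive_expf 2 (dz x)))).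
  by rewrite /= expr1 add0r.
pose f x := (w x)^-1; pose f1 x := - (2 * z x * h (z x)) / w x ^+ 2.
have df : has_deriv f f1 by move=> x; exact: is_derive_invf (wn x) (dw x).
have fp x : 0 < f x by rewrite invr_gt0.
exists f, f1; split; [exact: df| |exact: fp| |].
- move=> x; set zx := z x.
  have dhz := is_derive_compf (dz x) (dh (z x)).
  have dnum := is_derive_oppf (is_derive_mulf (is_derive_scalef 2 (dz x)) dhz).
  have w2n : w x ^+ 2 != 0 by rewrite expf_neq0.
  have dden := @is_derive_invf R (fun y => w y ^+ 2) x _ w2n (is_derive_expf 2 (dw x)).
  apply: (is_derive_eq (is_derive_mulf dnum dden)).
  rewrite /= expr1 /nonlin aE1 aE2 aE3 /f -/zx.
  have hn : h zx != 0 by rewrite gt_eqF.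
  have wE : w0 = w x - zx ^+ 2 by rewrite /w /zx; ring.
  have ME : M zx = 4 * w x by rewrite /M /w.
  have w1E : w1 = w x - zx ^+ 2 - A by rewrite -wE /A; ring.
  have NE : N zx = q0 * (A + zx ^+ 2) by [].
  have H1 : h zx ^+ 2 = q0 * (A + zx ^+ 2) / (4 * w x) by rewrite h2 /H ME NE.
  have H2 : H' zx = (2 * q0 * zx * (4 * w x) - q0 * (A + zx ^+ 2) * (8 * zx)) / (4 * w x) ^+ 2.
    by rewrite /H' ME NE.
  rewrite [LHS](_ : _ = - 2 * h zx ^+ 2 / w x ^+ 2 - zx * H' zx / w x ^+ 2
    + 8 * zx ^+ 2 * h zx ^+ 2 / w x ^+ 3); last by field; rewrite hn wn.
  rewrite H1 H2 w1E wE; have := wn x.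
  by move=> wne; field.
- by split; rewrite /f /f1 /w z0 ?expr0n/= ?addr0// mulr0 mul0r oppr0 mul0r.
have zlow x : k * `|x| <= `|z x|.
  have cz := has_deriv_continuous dz.
  case: (ltgtP x 0) => [x0|x0|->]; last by rewrite normr0 mulr0.
    have [c _] := MVT x0 (fun y _ => dz y) (continuous_subspaceT cz).
    rewrite z0 !sub0r => E; rewrite -[`|z x|]normrN E normrM normrN ler_wpM2r//.
    by rewrite gtr0_norm; [exact: kh|exact: h0].
  have [c _] := MVT x0 (fun y _ => dz y) (continuous_subspaceT cz).
  rewrite z0 !subr0 => ->; rewrite normrM ler_wpM2r//.
  by rewrite gtr0_norm; [exact: kh|exact: h0].
have z2 x : k ^+ 2 * x ^+ 2 <= z x ^+ 2.
  rewrite -[x ^+ 2]real_normK ?num_real// -[z x ^+ 2]real_normK ?num_real// -exprMn.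
  by rewrite lerXn2r ?nnegrE ?mulr_ge0 ?(ltW k0).
split.
  move=> x x0; rewrite /f ltf_pV2 ?posrE//.
  rewrite /w z0 expr0n/= addr0 ltrDl.
  apply: lt_le_trans (z2 x); apply: mulr_gt0; first exact: exprn_gt0.
  by rewrite lt_neqAle sqr_ge0 andbT eq_sym sqrf_eq0.
pose m := Num.min w0 (k ^+ 2); have m0 : 0 < m by rewrite lt_min w00 exprn_gt0.
exists m^-1; first by rewrite invr_gt0.
move=> x; have x1 : 0 < 1 + x ^+ 2 by rewrite ltr_wpDr ?sqr_ge0.
rewrite -invfM /f lef_pV2 ?posrE ?mulr_gt0// mulrDr mulr1 /w; apply: lerD.
  by rewrite ge_min lexx.
by apply: le_trans (z2 x); rewrite ler_wpM2r ?sqr_ge0// ge_min lexx orbT.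
Qed.

Lemma L1_oneDsqrV : L1 (fun x : R => (1 + x ^+ 2)^-1).
Proof.
have E x : (1 + x ^+ 2)^-1 = (oneDsqr x)^-1 by [].
have p0 x : 0 <= (1 + x ^+ 2)^-1 by rewrite invr_ge0 addr_ge0 ?sqr_ge0.
have cf : continuous (fun x : R => (1 + x ^+ 2)^-1).
  move=> x; apply: cvgV; first by rewrite gt_eqF// ltr_wpDr ?sqr_ge0.
  by apply: cvgD; [exact: cvg_cst|exact: exprn_continuous].
apply/integrableP; split.
  by apply/measurable_EFinP; exact: continuous_measurable_fun.
under eq_integral => x _ do rewrite /= ger0_norm//.
rewrite ge0_symfun_integralT//; last by move=> x /=; rewrite sqrrN.
rewrite (_ : [set x | 0 <= x] = `[0, +oo[%classic); last first.
  by apply/seteqP; split => x /=; rewrite in_itv/= andbT.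
by rewrite integral0y_oneDsqr -EFinM ltry.
Qed.

End Profile.

(** * Standing waves *)

Section StandingWave.
Context {R : realType}.
Local Notation mu := (@lebesgue_measure R).
Local Notation wd := (@is_weak_deriv_real R).
Implicit Types (u h : R -> R[i]) (x : R).

Lemma integral_shift (g : R -> R) (c : R) : continuous g -> (forall x, 0 <= g x) ->
  L1 g -> L1 (fun x => g (x - c)) /\ \int[mu]_x g (x - c) = \int[mu]_x g x.
Proof.
move=> cg g0 ig; pose F := fun x : R => x - c.
have dF : has_deriv F (fun=> 1).
  by move=> x; apply: is_derive_shift; exact: is_derive_id.
have cgc : continuous (fun x => g (x - c)).
  move=> x; apply: (@continuous_comp _ _ _ F g); last exact: cg.
  exact: (has_deriv_continuous dF).
have E : (\int[mu]_x (g x)%:E = \int[mu]_x (g (x - c))%:E)%E.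
  rewrite (@increasing_ge0_integration_by_substitutionT R F g)//.
  - apply: eq_integral => x _; rewrite (has_deriv_derive1 dF)/=.
    by congr EFin; rewrite /GRing.mul/= mulr1.
  - by move=> x y xy; rewrite /F ltrD2r.
  - by rewrite (has_deriv_derive1 dF) => x; exact: cvg_cst.
  - by rewrite (has_deriv_derive1 dF); exact: is_cvg_cst.
  - by rewrite (has_deriv_derive1 dF); exact: is_cvg_cst.
  - exact: cvg_addrr_Ny.
  - exact: cvg_addrr.
split; last by rewrite /Rintegral E.
apply/integrableP; split.
  by apply/measurable_EFinP; exact: continuous_measurable_fun.
have /integrableP[_] := ig.
under eq_integral => x _ do rewrite /= ger0_norm//.
by under [X in _ -> (X < _)%E]eq_integral => x _ do rewrite /= ger0_norm//; rewrite E.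
Qed.

Lemma unit_circle (x y : R) : x ^+ 2 + y ^+ 2 = 1 ->
  exists t, x = cos t /\ y = sin t.
Proof.
move=> xy; have x1 : -1 <= x <= 1.
  have := sqr_ge0 y; have := sqr_ge0 x => ? ?; rewrite -ler_norml.
  by rewrite -(@ler_pXn2r _ 2)// ?nnegrE// expr1n real_normK ?num_real//; lra.
have sE : sin (acos x) = `|y|.
  by rewrite sin_acos// -sqrtr_sqr; congr Num.sqrt; rewrite -xy; ring.
have xin : x \in `[-1, 1] by rewrite in_itv.
have [y0|y0] := leP 0 y.
  by exists (acos x); rewrite acosK// sE ger0_norm.
by exists (- acos x); rewrite cosN sinN acosK// sE ltr0_norm// opprK.
Qed.

Definition profile (a1 a2 a3 : R) (f f1 : R -> R) : Prop :=
  [/\ has_deriv f f1, has_deriv f1 (fun x => - (nonlin a1 a2 a3 (f x) * f x)),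
      forall x, 0 < f x,
      forall x, f1 x ^+ 2 = - 2 * potential a1 a2 a3 (f x) &
      L1 f /\ exists B, forall x, f x <= B].

Lemma profile_shift a1 a2 a3 f f1 c : profile a1 a2 a3 f f1 ->
  profile a1 a2 a3 (fun x => f (x - c)) (fun x => f1 (x - c)).
Proof.
move=> [df df1 fp en [if' [B fB]]]; split.
- by move=> x; apply: is_derive_shift; exact: df.
- by move=> x; apply: (@is_derive_shift _ f1 c x); exact: df1.
- by move=> x; exact: fp.
- by move=> x; exact: en.
split; last by exists B.
by have [] := integral_shift c (has_deriv_continuous df) (fun x => ltW (fp x)) if'.
Qed.

(** The functions p(f) + q(f) f', with p and q polynomials, are stable under
    differentiation since f'^2 and f'' are polynomials in f. *)
Lemma profile_smooth a1 a2 a3 f f1 : profile a1 a2 a3 f f1 -> smooth f1.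
Proof.
move=> [df df1 fp en _].
pose N : {poly R} := - (a1 *: 'X^2 + a2 *: 'X^3 + a3 *: 'X^4).
pose G : {poly R} := - 2 *: ((a1 / 3) *: 'X^3 + (a2 / 4) *: 'X^4 + (a3 / 5) *: 'X^5).
have NE x : N.[f x] = - (nonlin a1 a2 a3 (f x) * f x).
  by rewrite /N hornerN !hornerD !hornerZ !hornerXn /nonlin; ring.
have GE x : G.[f x] = f1 x ^+ 2 by rewrite en /G hornerZ !hornerD !hornerZ !hornerXn /potential.
apply: (@smooth_family _ [set g | exists p q : {poly R}, g = fun x => p.[f x] + q.[f x] * f1 x]).
  move=> _ [p [q ->]]; exists (fun x => (deriv q * G + q * N).[f x] + (deriv p).[f x] * f1 x).
    move=> x; have dp := is_derive_compf (df x) (is_derive_poly p (f x)).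
    have dq := is_derive_compf (df x) (is_derive_poly q (f x)).
    apply: (is_derive_eq (is_derive_addf dp (is_derive_mulf dq (df1 x)))).
    by rewrite !hornerD !hornerM GE NE; ring.
  by exists (deriv q * G + q * N), (deriv p).
by exists 0, 1; apply/funext => x; rewrite !hornerE.
Qed.

(** Dominates the integrands below by multiples of the integrable f. *)
Lemma profile_bounds a1 a2 a3 f f1 : profile a1 a2 a3 f f1 -> exists C, [/\ 1 <= C,
  forall x, f x <= C, forall x, `|f1 x| <= C * f x &
  forall x, `|nonlin a1 a2 a3 (f x) * f x| <= C * f x].
Proof.
move=> [_ _ fp en [_ [B0 fB0]]]; pose B := 1 + `|B0|.
have B1 : 1 <= B by rewrite /B lerDl.
have Bp : 0 <= B by exact: le_trans B1.
have fB x : f x <= B by rewrite (le_trans (fB0 x))// /B (le_trans (ler_norm _))// lerDr.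
pose A := `|a1| + `|a2| + `|a3|; have A0 : 0 <= A by rewrite !addr_ge0.
pose K := A * B ^+ 2 * B; have K0 : 0 <= K by rewrite mulr_ge0// mulr_ge0// sqr_ge0.
have nl x : `|nonlin a1 a2 a3 (f x)| <= K.
  apply: le_trans (nonlin_bound a1 a2 a3 (ltW (fp x)) (fB x) B1) _.
  by rewrite /K ler_wpM2l// mulr_ge0// sqr_ge0.
have pot x : - 2 * potential a1 a2 a3 (f x) <= 2 * K * f x ^+ 2.
  have -> : potential a1 a2 a3 (f x) = nonlin (a1 / 3) (a2 / 4) (a3 / 5) (f x) * f x ^+ 2.
    by rewrite /potential /nonlin; ring.
  have h : `|nonlin (a1 / 3) (a2 / 4) (a3 / 5) (f x)| <= K.
    apply: le_trans (nonlin_bound _ _ _ (ltW (fp x)) (fB x) B1) _.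
    rewrite /K; apply: ler_pM => //.
    - by rewrite mulr_ge0 ?sqr_ge0// !addr_ge0.
    - exact: ltW.
    rewrite ler_wpM2r ?sqr_ge0// /A; apply: lerD; [apply: lerD|].
    - by rewrite normrM ler_piMr// gtr0_norm ?invr_gt0// invf_le1// ler1n.
    - by rewrite normrM ler_piMr// gtr0_norm ?invr_gt0// invf_le1// ler1n.
    - by rewrite normrM ler_piMr// gtr0_norm ?invr_gt0// invf_le1// ler1n.
  have /ler_normlP[h1 _] := h.
  rewrite mulrA; apply: ler_wpM2r; first exact: sqr_ge0.
  by lra.
pose C := B + 1 + 2 * K; have C1 : 1 <= C by rewrite /C; lra.
exists C; split=> // x.
- by have := fB x; rewrite /C; lra.
- rewrite -(@ler_pXn2r _ 2)// ?nnegrE// ?mulr_ge0 ?(ltW (fp x)) ?(le_trans ler01)//.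
  rewrite real_normK ?num_real// en exprMn; apply: le_trans (pot x) _.
  rewrite ler_wpM2r ?sqr_ge0//; have : C <= C ^+ 2 by rewrite ler_eXnr.
  by rewrite /C; lra.
- rewrite normrM (gtr0_norm (fp x)) ler_wpM2r ?(ltW (fp x))//.
  by have := nl x; rewrite /C; lra.
Qed.

(** A weak derivative may be tested against f', which is smooth: cut it off and pass to
    the limit by dominated convergence, f being integrable. *)
Lemma profile_weak_equation a1 a2 a3 f f1 (k k' : R -> R) : profile a1 a2 a3 f f1 ->
  wd k k' -> L1 (fun x => `|k x| ^+ 3) -> L1 (fun x => k' x ^+ 2) ->
  \int[mu]_x (f1 x * k' x) = \int[mu]_x (nonlin a1 a2 a3 (f x) * f x * k x).
Proof.
move=> prof kk' ik ik'; have [df df1 fp en [if' _]] := prof.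
have sf1 := profile_smooth prof; have [C [C1 fC f1C nlC]] := profile_bounds prof.
have C0 : 0 <= C by exact: le_trans C1.
have [[mk _ _] [mk' _ _] _] := kk'.
pose F2 x := - (nonlin a1 a2 a3 (f x) * f x).
have cf2 : continuous F2.
  by have := smooth_continuous (smooth_derive1 sf1); rewrite (has_deriv_derive1 df1).
pose chi n x := step (- n%:R - 1) 1 x - step n%:R 1 x : R.
have schi n : smooth (chi n) by apply: smoothB; exact: smooth_step.
have dchi n x : derive1 (chi n) x = derive1 (step (- n%:R - 1) 1) x - derive1 (step n%:R 1) x.
  by apply: is_derive_derive1; apply: is_derive_subf; apply: smooth_has_deriv; exact: smooth_step.
have [M M0 bM] := @derive1_step_bounded R.
have chi1 n x : `|chi n x| <= 1.
  have /andP[s0 s1] := step_itv (- n%:R - 1) (@ltr01 R) x.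
  have /andP[t0 t1] := step_itv n%:R (@ltr01 R) x.
  by rewrite ler_norml /chi; apply/andP; split; lra.
have dchiM n x : `|derive1 (chi n) x| <= 2 * M.
  rewrite dchi; apply: le_trans (ler_normB _ _) _.
  have := bM (- n%:R - 1) 1 x ltr01; have := bM n%:R 1 x ltr01; rewrite divr1; lra.
pose psi n x := chi n x * f1 x.
have spsi n : smooth (psi n) by exact: smoothM.
have dpsi n x : derive1 (psi n) x = derive1 (chi n) x * f1 x + chi n x * F2 x.
  apply: is_derive_derive1; apply: is_derive_mulf (df1 x).
  exact: smooth_has_deriv.
have psil n x : x < - n%:R - 1 -> psi n x = 0.
  move=> xn; have n0 : 0 <= n%:R :> R by rewrite ler0n.
  by rewrite /psi /chi !step_le ?subrr ?mul0r//; lra.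
have psir n x : n%:R + 1 < x -> psi n x = 0.
  move=> xn; have n0 : 0 <= n%:R :> R by rewrite ler0n.
  by rewrite /psi /chi !step_ge ?subrr ?mul0r//; lra.
have E n : \int[mu]_x (k x * derive1 (psi n) x) = - \int[mu]_x (k' x * psi n x).
  exact: (weak_deriv_test kk' (spsi n) (psil n) (psir n)).
have near x : \forall n \near \oo, `|x| < n%:R :> R.
  exact: nbhs_infty_gtr.
have chin n x : `|x| < n%:R -> chi n x = 1 /\ derive1 (chi n) x = 0.
  move=> /ltr_normlP[x1 x2]; split.
    by rewrite /chi step_ge ?step_le ?subr0//; lra.
  by rewrite dchi derive1_step_gt ?derive1_step_lt ?subrr//; lra.
have iF : L1 (fun x => (2 * M + 1) * C * (f x + C * `|k x| ^+ 3)).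
  by apply: L1_Z; apply: L1_D => //; exact: L1_Z.
have iG : L1 (fun x => C ^+ 2 * C * f x + k' x ^+ 2).
  by apply: L1_D => //; exact: L1_Z.
have lim1 : \int[mu]_x (k x * derive1 (psi n) x) @[n --> \oo] --> \int[mu]_x (k x * F2 x).
  apply: (@dominated_cvg_integral _ _ _ _ _ _ iF).
  - by move=> n; apply: measurable_funM => //; apply: smooth_measurable; exact: smooth_derive1.
  - by apply: measurable_funM => //; exact: continuous_measurable_fun.
  - move=> x; apply: cvg_near_cst; apply: filterS (near x) => n /chin[c1 c2].
    by rewrite dpsi c1 c2 mul0r add0r mul1r.
  move=> n x; rewrite normrM dpsi.
  have b1 : `|derive1 (chi n) x * f1 x + chi n x * F2 x| <= (2 * M + 1) * (C * f x).
    have -> : (2 * M + 1) * (C * f x) = 2 * M * (C * f x) + 1 * (C * f x) by ring.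
    apply: le_trans (ler_normD _ _) _; apply: lerD; rewrite normrM.
      by apply: ler_pM.
    by apply: ler_pM => //; rewrite normrN.
  have k3 : `|k x| * f x <= f x + C * `|k x| ^+ 3.
    have fx := ltW (fp x); have [k1|/ltW k1] := leP `|k x| 1.
      by rewrite ler_wpDr ?mulr_ge0 ?exprn_ge0// ler_piMl.
    rewrite ler_wpDl// mulrC; apply: ler_pM => //.
    by rewrite -{1}[`|k x|]expr1 ler_weXn2l.
  apply: (@le_trans _ _ (`|k x| * ((2 * M + 1) * (C * f x)))); first by rewrite ler_wpM2l.
  have -> : `|k x| * ((2 * M + 1) * (C * f x)) = (2 * M + 1) * C * (`|k x| * f x) by ring.
  by rewrite ler_wpM2l// mulr_ge0//; lra.
have lim2 : \int[mu]_x (k' x * psi n x) @[n --> \oo] --> \int[mu]_x (k' x * f1 x).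
  apply: (@dominated_cvg_integral _ _ _ _ _ _ iG).
  - by move=> n; apply: measurable_funM => //; exact: smooth_measurable.
  - by apply: measurable_funM => //; exact: smooth_measurable.
  - move=> x; apply: cvg_near_cst; apply: filterS (near x) => n /chin[c1 c2].
    by rewrite /psi c1 mul1r.
  move=> n x; rewrite normrM /psi normrM.
  have fx := ltW (fp x).
  have b1 : `|chi n x| * `|f1 x| <= C * f x.
    by rewrite -[leRHS]mul1r; apply: ler_pM.
  apply: (@le_trans _ _ (`|k' x| * (C * f x))); first by rewrite ler_wpM2l.
  have f2 : (C * f x) ^+ 2 <= C ^+ 2 * C * f x.
    rewrite exprMn -mulrA ler_wpM2l ?sqr_ge0// expr2 ler_wpM2r//.
  rewrite -[k' x ^+ 2]real_normK ?num_real//.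
  have := sqr_ge0 (`|k' x| - C * f x); have := sqr_ge0 `|k' x|.
  have := sqr_ge0 (C * f x); rewrite sqrrB mulr2n; lra.
have h : \int[mu]_x (k x * F2 x) = - \int[mu]_x (k' x * f1 x).
  rewrite -(cvg_lim (@Rhausdorff R) lim1); apply: cvg_lim => //.
  by under eq_fun do rewrite E; exact: cvgN.
transitivity (\int[mu]_x (k' x * f1 x)); first by apply: eq_Rintegral => x _; rewrite mulrC.
rewrite -[LHS]opprK -h -integralN_L1.
  by apply: eq_Rintegral => x _; rewrite /F2; ring.
apply: (L1_le _ iF); first by apply: measurable_funM => //; exact: continuous_measurable_fun.
move=> x; rewrite normrM normrN.
have fx := ltW (fp x).
have k3 : `|k x| * f x <= f x + C * `|k x| ^+ 3.
  have [k1|/ltW k1] := leP `|k x| 1.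
    by rewrite ler_wpDr ?mulr_ge0 ?exprn_ge0// ler_piMl.
  rewrite ler_wpDl// mulrC; apply: ler_pM => //.
  by rewrite -{1}[`|k x|]expr1 ler_weXn2l.
apply: (@le_trans _ _ (`|k x| * (C * f x))); first by rewrite ler_wpM2l.
rewrite mulrCA; apply: (@le_trans _ _ (C * (f x + C * `|k x| ^+ 3))); first by rewrite ler_wpM2l.
rewrite -mulrA ler_peMl//; last by lra.
by rewrite mulr_ge0// addr_ge0// mulr_ge0// exprn_ge0.
Qed.

End StandingWave.

Section Waves.
Context {R : realType}.
Local Notation mu := (@lebesgue_measure R).
Local Notation wd := (@is_weak_deriv_real R).
Implicit Types (u h : R -> R[i]) (f : R -> R) (x : R).

Definition complexify f : R -> R[i] := fun x => (f x)%:C%C.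

Definition wave (t c : R) f : R -> R[i] := fun x => phase t * complexify f (x - c).

Lemma re_wave t c f x : re (wave t c f) x = cos t * f (x - c).
Proof. by rewrite /re /wave /complexify /phase /= mulr0 subr0. Qed.

Lemma im_wave t c f x : im (wave t c f) x = sin t * f (x - c).
Proof. by rewrite /im /wave /complexify /phase /= mulr0 add0r. Qed.

Lemma modulus_wave t c f x : modulus (wave t c f) x = `|f (x - c)|.
Proof.
have -> : modulus (wave t c f) x =
    Num.sqrt (re (wave t c f) x ^+ 2 + im (wave t c f) x ^+ 2) by exact: normcE.
rewrite re_wave im_wave.
rewrite -sqrtr_sqr; congr Num.sqrt.
by rewrite -[RHS]mul1r -(cos2Dsin2 t); ring.
Qed.

Lemma complexify_wave f : complexify f = wave 0 0 f.
Proof.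
by apply/funext => x; rewrite /wave /phase cos0 sin0 subr0 mul1r.
Qed.

Lemma wave_weak_deriv t c f (f1 : R -> R) : has_deriv f f1 -> continuous f1 ->
  is_weak_deriv (wave t c f) (wave t c f1).
Proof.
move=> df cf1; have cs : continuous (fun x => f1 (x - c)).
  move=> x; apply: (@continuous_comp _ _ _ (fun y => y - c) f1); last exact: cf1.
  by apply: cvgB; [exact: cvg_id|exact: cvg_cst].
have w : wd (fun x => f (x - c)) (fun x => f1 (x - c)).
  by apply: has_deriv_weak_deriv => // x; apply: is_derive_shift; exact: df.
split.
  rewrite -/(re (wave t c f)) -/(re (wave t c f1)).
  rewrite (_ : re (wave t c f) = fun x => cos t * f (x - c)); last exact/funext/re_wave.
  rewrite (_ : re (wave t c f1) = fun x => cos t * f1 (x - c)); last exact/funext/re_wave.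
  exact: weak_derivZ.
rewrite -/(im (wave t c f)) -/(im (wave t c f1)).
rewrite (_ : im (wave t c f) = fun x => sin t * f (x - c)); last exact/funext/im_wave.
rewrite (_ : im (wave t c f1) = fun x => sin t * f1 (x - c)); last exact/funext/im_wave.
exact: weak_derivZ.
Qed.

Lemma profile_powers a1 a2 a3 f f1 k : profile a1 a2 a3 f f1 ->
  L1 (fun x => `|f x| ^+ k.+1) /\ L1 (fun x => `|f1 x| ^+ 2).
Proof.
move=> prof; have [df df1 fp _ [if' _]] := prof.
have [C [C1 fC f1C _]] := profile_bounds prof; have C0 : 0 <= C by exact: le_trans C1.
have mf := continuous_measurable_fun (has_deriv_continuous df).
have mf1 := continuous_measurable_fun (has_deriv_continuous df1).
split.
  apply: (L1_le _ (L1_Z (C ^+ k) if')).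
    by apply: measurable_funX; exact: measurableT_comp.
  move=> x; rewrite ger0_norm ?exprn_ge0// gtr0_norm// exprSr ler_wpM2r ?(ltW (fp x))//.
  by rewrite lerXn2r ?nnegrE ?(ltW (fp x)).
apply: (L1_le _ (L1_Z (C ^+ 2 * C) if')).
  by apply: measurable_funX; exact: measurableT_comp.
move=> x; rewrite ger0_norm ?sqr_ge0//.
have fx := ltW (fp x); apply: (@le_trans _ _ ((C * f x) ^+ 2)).
  by rewrite lerXn2r ?nnegrE ?mulr_ge0.
have -> : C ^+ 2 * C * f x = C ^+ 2 * (C * f x) by ring.
by rewrite exprMn; apply: ler_wpM2l; [exact: sqr_ge0|rewrite expr2 ler_wpM2r].
Qed.

Lemma wave_integrals a1 a2 a3 f f1 t c k : profile a1 a2 a3 f f1 ->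
  [/\ L1 (fun x => modulus (wave t c f) x ^+ k.+1),
    \int[mu]_x (modulus (wave t c f) x ^+ k.+1) = \int[mu]_x (`|f x| ^+ k.+1),
    L1 (fun x => modulus (wave t c f1) x ^+ 2) &
    \int[mu]_x (modulus (wave t c f1) x ^+ 2) = \int[mu]_x (`|f1 x| ^+ 2)].
Proof.
move=> prof; have [df df1 _ _ _] := prof.
have [i1 i2] := profile_powers k prof.
have cX (g : R -> R) j : continuous g -> continuous (fun x => `|g x| ^+ j).
  move=> cg x; apply: (@continuous_comp _ _ _ (fun y => `|g y|) (fun y : R => y ^+ j)).
    by apply: (@continuous_comp _ _ _ g Num.norm); [exact: cg|exact: norm_continuous].
  exact: exprn_continuous.
have [j1 e1] := integral_shift c (cX _ k.+1 (has_deriv_continuous df))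
  (fun x => exprn_ge0 _ (normr_ge0 (f x))) i1.
have [j2 e2] := integral_shift c (cX _ 2 (has_deriv_continuous df1))
  (fun x => exprn_ge0 _ (normr_ge0 (f1 x))) i2.
split.
- by under [X in L1 X]eq_fun do rewrite modulus_wave.
- by rewrite -e1; apply: eq_Rintegral => x _; rewrite modulus_wave.
- by under [X in L1 X]eq_fun do rewrite modulus_wave.
- by rewrite -e2; apply: eq_Rintegral => x _; rewrite modulus_wave.
Qed.

Lemma is_weak_deriv_ae_eq u v g : measurable_complex v -> u = v %[ae mu] ->
  is_weak_deriv u g -> is_weak_deriv v g.
Proof.
move=> [mrv miv] /ae_eqP uv ug; have [_ [mrg mig]] := is_weak_deriv_measurable ug.
have gg (k : R -> R) : k = k %[ae mu] by apply/ae_eqP; exact: ae_all.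
have [h1 h2] := ug; split.
  apply: (weak_deriv_ae_eq mrv mrg _ (gg _) h1); apply/ae_eqP.
  by apply: ae_sub uv => x /= ->.
apply: (weak_deriv_ae_eq miv mig _ (gg _) h2); apply/ae_eqP.
by apply: ae_sub uv => x /= ->.
Qed.

(** Every integral in the action is invariant under translations and phase rotations,
    so all waves have the same action. *)
Lemma wave_action a1 a2 a3 f f1 t c u : profile a1 a2 a3 f f1 ->
  measurable_complex u -> u = wave t c f %[ae mu] ->
  action a1 a2 a3 u = 2^-1 * \int[mu]_x (`|f1 x| ^+ 2)
    - a1 / 3 * \int[mu]_x (`|f x| ^+ 3) - a2 / 4 * \int[mu]_x (`|f x| ^+ 4)
    - a3 / 5 * \int[mu]_x (`|f x| ^+ 5).
Proof.
move=> prof mu' uw; have [df df1 _ _ _] := prof.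
have ww := wave_weak_deriv t c df (has_deriv_continuous df1).
have [mw _] := is_weak_deriv_measurable ww.
have uw1 := is_weak_deriv_ae_eq mu' (ae_eq_sym uw) ww.
have [_ i3 i2 e2] := wave_integrals t c 2 prof.
have [_ i4 _ _] := wave_integrals t c 3 prof.
have [_ i5 _ _] := wave_integrals t c 4 prof.
rewrite actionE (weak_deriv_modulus uw1 i2).2 e2.
by rewrite !(integral_modulus_ae_eq _ mu' mw uw) i3 i4 i5.
Qed.

(** Pairing with the wave only sees the real part of exp(- i t) h; this reduces the claim
    to the real equation of the profile. *)
Lemma wave_first_variation a1 a2 a3 f f1 t c u h : profile a1 a2 a3 f f1 ->
  measurable_complex u -> u = wave t c f %[ae mu] -> in_X h ->
  first_variation a1 a2 a3 u h = 0.
Proof.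
move=> prof mu' uw Xh; have [df df1 fp _ _] := prof.
have ww := wave_weak_deriv t c df (has_deriv_continuous df1).
have uw1 := is_weak_deriv_ae_eq mu' (ae_eq_sym uw) ww.
have /ae_eqP du := weak_deriv_ae uw1.
have [mw mw1] := is_weak_deriv_measurable ww.
have mdu := (is_weak_deriv_measurable (weak_deriv_spec uw1)).2.
have /in_XP[hw i2h i3h] := Xh; have [mh mh1] := is_weak_deriv_measurable hw.
pose k x := cos t * re h x + sin t * im h x.
pose k' x := cos t * re (weak_deriv h) x + sin t * im (weak_deriv h) x.
have kk' : wd k k'.
  by have [h1 h2] := hw; apply: weak_derivD; exact: weak_derivZ.
have cs (z : R[i]) : `|cos t * complex.Re z + sin t * complex.Im z| <= Normc.normc z.
  apply: le_trans (cauchy_schwarz2 _ _ _ _) _.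
  by rewrite cos2Dsin2 sqrtr1 mul1r normcE.
have [[mk _ _] [mk' _ _] _] := kk'.
have ik : L1 (fun x => `|k x| ^+ 3).
  apply: (L1_le _ i3h); first by apply: measurable_funX; exact: measurableT_comp.
  move=> x; rewrite ger0_norm ?exprn_ge0// lerXn2r ?nnegrE ?modulus_ge0//.
  exact: cs.
have ik' : L1 (fun x => k' x ^+ 2).
  apply: (L1_le _ i2h); first exact: measurable_funX.
  move=> x; rewrite ger0_norm ?sqr_ge0// -[k' x ^+ 2]real_normK ?num_real//.
  rewrite lerXn2r ?nnegrE ?modulus_ge0//.
  exact: cs.
have eqn := profile_weak_equation (profile_shift c prof) kk' ik ik'.
rewrite /first_variation.
have -> : \int[mu]_x inner (weak_deriv u) (weak_deriv h) x = \int[mu]_x (f1 (x - c) * k' x).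
  transitivity (\int[mu]_x inner (wave t c f1) (weak_deriv h) x).
    apply: integral_ae_eq; [exact: measurable_inner..|].
    by apply/ae_eqP; apply: ae_sub du => x; rewrite /inner /re /im /= => ->.
  by apply: eq_Rintegral => x _; rewrite /inner re_wave im_wave /k'; ring.
have nlm v : measurable_complex v -> measurable_fun setT (fun x => nonlin a1 a2 a3 (modulus v x)).
  move=> mv; have mm := measurable_modulus mv.
  apply: measurable_funD; last by apply: measurable_funM => //; exact: measurable_funX.
  by apply: measurable_funD; apply: measurable_funM => //; exact: measurable_funX.
have -> : \int[mu]_x (nonlin a1 a2 a3 (modulus u x) * inner u h x) =
    \int[mu]_x (nonlin a1 a2 a3 (f (x - c)) * f (x - c) * k x).
  transitivity (\int[mu]_x (nonlin a1 a2 a3 (modulus (wave t c f) x) * inner (wave t c f) h x)).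
    apply: integral_ae_eq.
    - by apply: measurable_funM; [exact: nlm|exact: measurable_inner].
    - by apply: measurable_funM; [exact: nlm|exact: measurable_inner].
    - by apply/ae_eqP; move/ae_eqP : uw; apply: ae_sub => x; rewrite /inner /re /im /modulus /= => ->.
  apply: eq_Rintegral => x _; rewrite modulus_wave gtr0_norm// /inner re_wave im_wave /k; ring.
by rewrite eqn subrr.
Qed.

Lemma wave_orbit a1 a2 a3 f f1 t c : profile a1 a2 a3 f f1 ->
  orbit a1 a2 a3 (fun x => cos t * f (x - c)) (fun x => sin t * f (x - c))
    (fun x => cos t * f1 (x - c)) (fun x => sin t * f1 (x - c)).
Proof.
move=> prof; have [df df1 fp _ _] := profile_shift c prof.
have rE x : rho (fun x => cos t * f (x - c)) (fun x => sin t * f (x - c)) x = f (x - c).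
  rewrite /rho -[RHS]gtr0_norm// -sqrtr_sqr; congr Num.sqrt.
  by rewrite -[RHS]mul1r -(cos2Dsin2 t); ring.
split.
- by move=> x; apply: is_derive_scalef; exact: df.
- by move=> x; apply: is_derive_scalef; exact: df.
- move=> x; rewrite rE; apply: (is_derive_eq (is_derive_scalef (cos t) (df1 x))); ring.
- move=> x; rewrite rE; apply: (is_derive_eq (is_derive_scalef (sin t) (df1 x))); ring.
Qed.

(** At its turning point the solution has the amplitude of the profile at the origin and
    velocity 0, so uniqueness of the Cauchy problem identifies it with a wave. *)
Lemma solution_is_wave a1 a2 a3 q0 w0 w1 f f1 u k :
  coefficients a1 a2 a3 q0 w0 w1 -> profile a1 a2 a3 f f1 ->
  f 0 = w0^-1 -> f1 0 = 0 -> (0 < k)%N ->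
  is_weak_deriv u (weak_deriv u) ->
  L1 (fun x => modulus (weak_deriv u) x ^+ 2) -> L1 (fun x => modulus u x ^+ k) ->
  nontrivial u -> is_solution a1 a2 a3 u ->
  exists t c, u = wave t c f %[ae mu].
Proof.
move=> co prof f0 f10 k0 uw iw iu nu sol.
have [P [Q [P1 [Q1 [orb [/ae_eqP uP /ae_eqP uQ] [/ae_eqP uP1 /ae_eqP uQ1]]]]]] := solution_orbit uw sol.
have [dP dQ dP1 dQ1] := orb.
have [mu' mw] := is_weak_deriv_measurable uw.
have cr := continuous_rho (has_deriv_continuous dP) (has_deriv_continuous dQ).
have cX (g : R -> R) j : continuous g -> continuous (fun x => g x ^+ j).
  move=> cg x; apply: (@continuous_comp _ _ _ g (fun y : R => y ^+ j)); first exact: cg.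
  exact: exprn_continuous.
have ir : L1 (fun x => rho P Q x ^+ k).
  apply: (L1_ae_eq _ _ _ iu).
  - by apply: measurable_funX; exact: measurable_modulus.
  - by apply: continuous_measurable_fun; exact: cX.
  apply/ae_eqP; move: uP uQ; apply: ae_sub2 => x px qx.
  by rewrite /modulus normcE /rho -px -qx.
have cv : continuous (fun x => P1 x ^+ 2 + Q1 x ^+ 2).
  move=> x; apply: cvgD; apply: cX.
    exact: (has_deriv_continuous dP1).
  exact: (has_deriv_continuous dQ1).
have iv : L1 (fun x => P1 x ^+ 2 + Q1 x ^+ 2).
  apply: (L1_ae_eq _ _ _ iw).
  - by apply: measurable_funX; exact: measurable_modulus.
  - exact: continuous_measurable_fun.
  apply/ae_eqP; move: uP1 uQ1; apply: ae_sub2 => x px qx.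
  by rewrite modulus_sq px qx.
have itot := L1_D ir iv.
have tot0 x : 0 <= rho P Q x ^+ k + (P1 x ^+ 2 + Q1 x ^+ 2).
  by rewrite addr_ge0 ?exprn_ge0 ?rho_ge0// addr_ge0 ?sqr_ge0.
have small e x : 0 < e -> rho P Q x ^+ k + (P1 x ^+ 2 + Q1 x ^+ 2) < Num.min (e ^+ k) e ->
    rho P Q x < e /\ P1 x ^+ 2 + Q1 x ^+ 2 < e.
  move=> e0; rewrite lt_min => /andP[h1 h2].
  have r0 : 0 <= rho P Q x ^+ k by rewrite exprn_ge0 ?rho_ge0.
  have v0 : 0 <= P1 x ^+ 2 + Q1 x ^+ 2 by rewrite addr_ge0 ?sqr_ge0.
  split; last by lra.
  rewrite -(@ltr_pXn2r _ k)// ?nnegrE ?rho_ge0 ?(ltW e0)//; lra.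
have [|||c [rc [p1c q1c] pot below]] := orbit_turning_point orb.
- move=> e M e0; have [|l l0 /(_ (M + 1))] := @L1_small_segment R _ (Num.min (e ^+ k) e) itot tot0.
    by rewrite lt_min exprn_gt0.
  move=> [x /andP[Mx _] /(small _ _ e0)[? ?]]; exists x; split=> //; lra.
- move=> e M e0; have [|l l0 /(_ (M - 1 - l))] := @L1_small_segment R _ (Num.min (e ^+ k) e) itot tot0.
    by rewrite lt_min exprn_gt0.
  move=> [x /andP[_ xM] /(small _ _ e0)[? ?]]; exists x; split=> //; lra.
- apply: contrapT => no; apply: nu; apply/ae_eqP; move: uP uQ; apply: ae_sub2 => x px qx.
  have /eqP : rho P Q x = 0 by apply/eqP/negPn/negP => rx; apply: no; exists x.
  rewrite -sqrf_eq0 rho_sq paddr_eq0 ?sqr_ge0// !sqrf_eq0 -px -qx /re /im /=.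
  by case: (u x) => ? ? /= /andP[/eqP -> /eqP ->].
have rE := amplitude co rc pot below; set m := rho P Q c in rc rE.
have mn : m != 0 by rewrite gt_eqF.
have PQm : (P c / m) ^+ 2 + (Q c / m) ^+ 2 = 1.
  by rewrite !expr_div_n -mulrDl -rho_sq -/m divff// expf_neq0.
have [t [ct st]] := unit_circle PQm.
have w := wave_orbit t c prof.
exists t, c; apply/ae_eqP.
have PQ := orbit_unique orb w (c := c).
have {}PQ x : P x = cos t * f (x - c) /\ Q x = sin t * f (x - c).
  apply: PQ; rewrite ?subrr ?f0 ?f10 ?mulr0// -rE -?ct -?st divfK//.
move: uP uQ; apply: ae_sub2 => x px qx; have [Px Qx] := PQ x.
have hr : re u x = re (wave t c f) x by rewrite px re_wave.
have hi : im u x = im (wave t c f) x by rewrite qx im_wave.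
by apply/eqP; rewrite eq_complex; apply/andP; split; apply/eqP.
Qed.

End Waves.

(** * Existence, uniqueness and ground states *)

Section Conclusion.
Context {R : realType}.
Local Notation mu := (@lebesgue_measure R).
Implicit Types (u : R -> R[i]) (f : R -> R) (x : R).

(** The energy of the profile is read off at the turning point, where it is 0. *)
Lemma coefficients_profile (a1 a2 a3 q0 w0 w1 : R) : coefficients a1 a2 a3 q0 w0 w1 ->
  exists f f1 : R -> R, [/\ profile a1 a2 a3 f f1, f 0 = w0^-1, f1 0 = 0 &
    forall x, x != 0 -> f x < f 0].
Proof.
move=> co; have [f [f1 [df df1 fp [f0 f10] [flt [C C0 fC]]]]] := profile_exists co.
exists f, f1; split => //; split => //.
- have rE x : rho f (fun=> 0) x = f x.
    by rewrite /rho expr0n/= addr0 sqrtr_sqr gtr0_norm.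
  have orb : orbit a1 a2 a3 f (fun=> 0) f1 (fun=> 0).
    split => //.
    + by move=> x; exact: is_derive_cst.
    + by move=> x; rewrite rE; exact: df1.
    + by move=> x; rewrite mulr0 oppr0; exact: is_derive_cst.
  move=> x; have := orbit_energy x 0 orb; rewrite !rE f10 f0 expr0n/= !addr0 mul0r add0r.
  rewrite (coefficients_potential w0^-1 co) mulfV ?subrr ?mul0r ?mulr0; last first.
    by have [_ w00 _ _] := co; rewrite gt_eqF.
  by move=> h; lra.
- split; last first.
    exists C => x; apply: le_trans (fC x) _; rewrite ler_piMr ?(ltW C0)//.
    by rewrite invf_le1 ?lerDl ?sqr_ge0// ltr_wpDr ?sqr_ge0.
  apply: (L1_le _ (L1_Z C L1_oneDsqrV)).
      by apply: continuous_measurable_fun; exact: (has_deriv_continuous df).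
  by move=> x; rewrite gtr0_norm.
Qed.

Lemma continuous_shift (f : R -> R) c : continuous f -> continuous (fun x => f (x - c)).
Proof.
move=> cf x; apply: (@continuous_comp _ _ _ (fun y => y - c) f); last exact: cf.
by apply: cvgB; [exact: cvg_id|exact: cvg_cst].
Qed.

Lemma wave_nontrivial a1 a2 a3 f f1 t c : profile a1 a2 a3 f f1 ->
  nontrivial (wave t c f).
Proof.
move=> [df _ fp _ _] /ae_eqP w0.
have w0' : (fun x => f (x - c)) = (fun=> 0) %[ae mu].
  apply/ae_eqP; apply: ae_sub w0 => x w0.
  have := modulus_wave t c f x; rewrite /modulus w0 Normc.normc0 => /esym/eqP.
  by rewrite normr_eq0 => /eqP.
have cf := @continuous_shift _ c (has_deriv_continuous df).
have c0 : continuous (fun _ : R => 0 : R) by move=> x; exact: cvg_cst.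
have E := @continuous_ae_eq _ _ _ cf c0 w0'.
have := fp (0 - c); have -> : f (0 - c) = 0 by have := congr1 (fun g : R -> R => g 0) E.
by rewrite ltxx.
Qed.

Lemma wave_spaces a1 a2 a3 f f1 t c : profile a1 a2 a3 f f1 ->
  in_X (wave t c f) /\ in_H1 (wave t c f).
Proof.
move=> prof; have [df df1 _ _ _] := prof.
have ww := wave_weak_deriv t c df (has_deriv_continuous df1).
have [mw mw1] := is_weak_deriv_measurable ww.
have [i3 _ i2 _] := wave_integrals t c 2 prof.
have [i1 _ _ _] := wave_integrals t c 1 prof.
split; first exact: is_weak_deriv_in_X ww i2 i3.
split; first exact/(@LpP _ 2 _ isT).
by exists (wave t c f1); split => //; exact/(@LpP _ 2 _ isT).
Qed.

Lemma wave_critical a1 a2 a3 f f1 t c u : profile a1 a2 a3 f f1 -> in_X u ->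
  nontrivial u -> u = wave t c f %[ae mu] -> nontrivial_critical a1 a2 a3 u.
Proof.
move=> prof Xu nu uw; have /in_XP[ud _ _] := Xu.
split => //; apply: first_variation_critical => // h.
exact: wave_first_variation prof (is_weak_deriv_measurable ud).1 uw.
Qed.

Lemma wave_solution a1 a2 a3 f f1 t c : profile a1 a2 a3 f f1 ->
  is_solution a1 a2 a3 (wave t c f).
Proof.
move=> prof; have [Xw _] := wave_spaces t c prof.
have refl : wave t c f = wave t c f %[ae mu] by apply/ae_eqP; exact: ae_all.
have [_ _] := wave_critical prof Xw (@wave_nontrivial _ _ _ _ _ t c prof) refl.
exact: critical_point_solution.
Qed.

(** The equation is invariant under reflection, and f'(0) = 0. *)
Lemma profile_even a1 a2 a3 f f1 : profile a1 a2 a3 f f1 -> f1 0 = 0 ->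
  forall x, f (- x) = f x.
Proof.
move=> prof f10 x; have [df df1 fp _ _] := prof.
have o := wave_orbit 0 0 prof.
pose fm x := f (- x); pose fm1 x := - f1 (- x).
have rE y : rho fm (fun=> 0) y = fm y.
  by rewrite /rho expr0n/= addr0 sqrtr_sqr gtr0_norm// /fm.
have dN (y : R) : is_derive y 1 (fun z : R => - z) (-1).
  exact: is_derive_oppf (is_derive_id y 1).
have dfm : has_deriv fm fm1.
  move=> y; apply: (is_derive_eq (is_derive_compf (dN y) (df (- y)))).
  by rewrite /fm1; ring.
have dfm1 : has_deriv fm1 (fun x => - (nonlin a1 a2 a3 (fm x) * fm x)).
  move=> y; apply: (is_derive_eq (is_derive_oppf (is_derive_compf (dN y) (df1 (- y))))).
  by rewrite /fm; ring.
have om : orbit a1 a2 a3 fm (fun=> 0) fm1 (fun=> 0).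
  split => //.
  - by move=> y; exact: is_derive_cst.
  - by move=> y; rewrite rE; exact: dfm1.
  - by move=> y; rewrite mulr0 oppr0; exact: is_derive_cst.
have [||||+ _] := orbit_unique om o (c := 0) _ _ _ _ x.
- by rewrite /fm subr0 oppr0 cos0 mul1r.
- by rewrite sin0 mul0r.
- by rewrite /fm1 subr0 oppr0 f10 oppr0 mulr0.
- by rewrite sin0 mul0r.
by rewrite /fm cos0 mul1r subr0.
Qed.

Lemma ae_wave_eq (psi : R -> R[i]) f f1 t c : has_deriv f f1 ->
  continuous (re psi) -> continuous (im psi) -> psi = wave t c f %[ae mu] ->
  forall x, re psi x = cos t * f (x - c) /\ im psi x = sin t * f (x - c).
Proof.
move=> df cr ci /ae_eqP E x.
have cw (a : R) : continuous (fun y => a * f (y - c)).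
  move=> y; apply: cvgM; first exact: cvg_cst.
  exact: (@continuous_shift _ c (has_deriv_continuous df)).
have Er : re psi = (fun y => cos t * f (y - c)).
  apply: continuous_ae_eq => //; apply/ae_eqP; apply: ae_sub E => y yE.
  by rewrite -re_wave /re /= yE.
have Ei : im psi = (fun y => sin t * f (y - c)).
  apply: continuous_ae_eq => //; apply/ae_eqP; apply: ae_sub E => y yE.
  by rewrite -im_wave /im /= yE.
by rewrite Er Ei.
Qed.

(** Positivity forces the phase to be trivial and evenness forces the strict
    maximum of the profile to sit at the origin. *)
Lemma even_positive_wave (psi : R -> R[i]) f f1 t c : has_deriv f f1 ->
  (forall x, 0 < f x) -> (forall x, x != 0 -> f x < f 0) ->
  continuous (re psi) -> continuous (im psi) ->
  (forall x, psi (- x) = psi x) -> (forall x, 0 < psi x) ->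
  psi = wave t c f %[ae mu] -> psi = complexify f.
Proof.
move=> df fp fmax cr ci ev pos E.
have PQ := ae_wave_eq df cr ci E.
have posE x : im psi x = 0 /\ 0 < re psi x.
  have := pos x; rewrite ltcE /= => /andP[/eqP <- //].
have st : sin t = 0.
  have [i0 _] := posE 0; have [_] := PQ 0; rewrite i0 => /esym/eqP.
  by rewrite mulf_eq0 (gt_eqF (fp _)) orbF => /eqP.
have ct : cos t = 1.
  have [_ r0] := posE 0; have [rE _] := PQ 0.
  have ct0 : 0 < cos t by move: r0; rewrite rE pmulr_lgt0.
  by apply/eqP; rewrite -(@eqrXn2 _ 2)// ?ler01 ?(ltW ct0)// expr1n -(cos2Dsin2 t) st expr0n/= addr0.
have c0 : c = 0.
  apply/eqP/negPn/negP => cn.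
  have [e1 _] := PQ c; have [e2 _] := PQ (- c).
  have e3 : re psi (- c) = re psi c by rewrite /re /= ev.
  move: e2; rewrite e3 e1 ct !mul1r subrr => e.
  have : - c - c != 0 by rewrite -opprD oppr_eq0 -mulr2n mulrn_eq0.
  by move=> /fmax; rewrite -e ltxx.
apply/funext => x; have [rx ix] := PQ x; move: rx ix; rewrite ct st c0 subr0 mul1r mul0r /re /im /complexify /=.
by case: (psi x) => a b /= -> ->.
Qed.

Lemma in_H1_weak_deriv u : in_H1 u -> [/\ is_weak_deriv u (weak_deriv u),
  L1 (fun x => modulus (weak_deriv u) x ^+ 2) & L1 (fun x => modulus u x ^+ 2)].
Proof.
move=> [/(@LpP _ 2 _ isT)[_ iu] hu]; split => //; first exact: weak_derivP.
by have [] := weak_deriv_L2 hu.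
Qed.

Lemma positive_nontrivial (psi : R -> R[i]) :
  (forall x, 0 < psi x) -> nontrivial psi.
Proof.
move=> pos /ae_eqP E.
have : (fun _ : R => 1 : R) = (fun=> 0) %[ae mu].
  by apply/ae_eqP; apply: ae_sub E => x xE; have := pos x; rewrite xE ltxx.
move=> E1; have c (a : R) : continuous (fun _ : R => a : R) by move=> x; exact: cvg_cst.
have := congr1 (fun g : R -> R => g 0) (continuous_ae_eq (c 1) (c 0) E1).
by move/eqP; rewrite oner_eq0.
Qed.

Lemma profile_even_positive a1 a2 a3 f f1 : profile a1 a2 a3 f f1 -> f1 0 = 0 ->
  even_positive_H1_solution a1 a2 a3 (complexify f).
Proof.
move=> prof f10; have [df _ fp _ _] := prof; split.
- by rewrite complexify_wave; split; [exact: (wave_spaces 0 0 prof).2|exact: wave_solution prof].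
- split; first exact: (has_deriv_continuous df).
  by move=> x; exact: cvg_cst.
- by move=> x; rewrite /complexify (profile_even prof f10).
- by move=> x; rewrite ltcE /= eqxx fp.
Qed.

End Conclusion.

Theorem proposition1p1 (R : realType) (a1 a2 a3 : R)
  (ha : [\/ [/\ a1 < 0, 0 < a2 & 0 < a3],
            [/\ a1 < 0, a2 < 0 & 0 < a3] |
            [/\ a1 = -1, a3 = -1 & 8 / Num.sqrt 15 < a2]]) :
  exists phi : R -> R[i],
    [/\ even_positive_H1_solution a1 a2 a3 phi,
        forall psi : R -> R[i],
          even_positive_H1_solution a1 a2 a3 psi -> psi = phi &
        forall u : R -> R[i],
          in_X u -> nontrivial u -> is_solution a1 a2 a3 u ->
          (exists theta x0 : R,
             u = (fun x => phase theta * phi (x - x0))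
               %[ae @lebesgue_measure R]) /\
          algebraic_standing_wave a1 a2 a3 u].
Proof.
have [q0 [w0 [w1 co]]] := coefficients_exist ha.
have [f [f1 [prof f0 f10 fmax]]] := coefficients_profile co.
have [df df1 fp _ _] := prof.
have cvt u : in_X u -> nontrivial u -> is_solution a1 a2 a3 u ->
    exists t c, u = wave t c f %[ae @lebesgue_measure R].
  move=> /in_XP[uw iw iu] nu sol.
  exact: (@solution_is_wave _ _ _ _ _ _ _ _ _ _ 3 co prof f0 f10 isT uw iw iu nu sol).
exists (complexify f); split; first exact: profile_even_positive prof f10.
  move=> psi [[H1 sol] [cr ci] ev pos].
  have [uw iw iu] := in_H1_weak_deriv H1.
  have [t [c E]] := @solution_is_wave _ _ _ _ _ _ _ _ _ _ 2 co prof f0 f10 isT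
    uw iw iu (positive_nontrivial pos) sol.
  exact: even_positive_wave df fp fmax cr ci ev pos E.
move=> u Xu nu sol; have [t [c uw]] := cvt u Xu nu sol.
split; first by exists t, c.
have crit := wave_critical prof Xu nu uw; split => //.
rewrite /ground_level (_ : [set _ | _ in _] = [set (action a1 a2 a3 u)%:E]) ?ereal_inf1//.
apply/seteqP; split => [_ [v [Xv nv cv] <-]|_ ->]; last by exists u.
have [s [b vw]] := cvt v Xv nv (critical_point_solution Xv cv).
have /in_XP[ud _ _] := Xu; have /in_XP[vd _ _] := Xv.
rewrite /= (wave_action prof (is_weak_deriv_measurable ud).1 uw).
by rewrite (wave_action prof (is_weak_deriv_measurable vd).1 vw).
Qed.
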